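(* Let $\mathcal A,\mathcal B$ be two sequences of even formal variables, $\mathcal M,\mathcal N$ two sequences of odd formal variables, $\alpha_0^{1/2}$ another even formal variable, and let $\Psi_j$, $j\in\frac12\mathbb Z$, be the canonical formal series in these variables defined in the context. There exists a unique canonical formal series $$\Gamma=\Gamma(\alpha_0^{1/2},\mathcal A,\mathcal M,\mathcal B,\mathcal N)\in\big(\mathbb C[\alpha_0^{1/2},\alpha_0^{-1/2}][[\mathcal A,\mathcal B]][\mathcal M,\mathcal N]\big)^0$$ such that $$\Gamma=\sum_{j\ge1}\Big(\Big(\frac{j^3-j}{12}\Big)\alpha_0^{-j}\mathcal A_j\mathcal B_j+\Big(\frac{j^2-j}3\Big)\alpha_0^{-j+\frac12}\mathcal N_{j-\frac12}\mathcal M_{j-\frac12}\Big)+\Gamma_0,$$ where $\Gamma_0$ contains only terms with total degree at least three in the $\mathcal A_j$'s, $\mathcal M_{j-1/2}$'s, $\mathcal B_j$'s and $\mathcal N_{j-1/2}$'s, with each term containing at least one of the $\mathcal A_j$'s or $\mathcal M_{j-1/2}$'s and at least one of the $\mathcal B_j$'s or $\mathcal N_{j-1/2}$'s, and such that in $\big(U_P(\mathfrak{ns})[\alpha_0^{1/2},\alpha_0^{-1/2}][[\mathcal A,\mathcal B]][\mathcal M,\mathcal N]\big)^0$ $$e^{-\sum_{j\ge1}(\mathcal A_jL_j+\mathcal M_{j-\frac12}G_{j-\frac12})}\,(\alpha_0^{1/2})^{-2L_0}\,e^{-\sum_{j\ge1}(\mathcal B_jL_{-j}+\mathcal N_{j-\frac12}G_{-j+\frac12})}$$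 $$=e^{\sum_{j\ge1}(\Psi_{-j}L_{-j}+\Psi_{-j+\frac12}G_{-j+\frac12})}\,e^{\sum_{j\ge1}(\Psi_jL_j+\Psi_{j-\frac12}G_{j-\frac12})}\,e^{2\Psi_0L_0}\,(\alpha_0^{1/2})^{-2L_0}\,e^{\Gamma d}.$$
   Context: $V[[\mathcal A,\mathcal B]][\mathcal M,\mathcal N]$ denotes all formal, possibly infinite, sums of monomials in $\mathcal A_j,\mathcal B_j$ (even), $\mathcal M_{j-1/2},\mathcal N_{j-1/2}$ (odd, mutually anticommuting, square zero), $j\ge1$, with coefficients in $V$; superscript $0$ denotes the even part. Odd formal variables anticommute with odd elements of $U_P(\mathfrak{ns})$. $\mathfrak{ns}$ is the $N=1$ Neveu-Schwarz Lie superalgebra over $\mathbb C$ with basis $d$ (central, even), $L_n$ (even), $G_{n+1/2}$ (odd), $n\in\mathbb Z$, and brackets $[L_m,L_n]=(m-n)L_{m+n}+\frac1{12}(m^3-m)\delta_{m+n,0}d$, $[G_{m+\frac12},L_n]=(m-\frac{n-1}2)G_{m+n+\frac12}$, $[G_{m+\frac12},G_{n-\frac12}]=2L_{m+n}+\frac13(m^2+m)\delta_{m+n,0}d$. $U_P(\mathfrak{ns})$ is the associative superalgebra generated by $\mathfrak{ns}$ and even elements $P_n$, $n\in\frac12\mathbb Z$, with relations those of the universal enveloping algebra of $\mathfrak{ns}$ together with $P_iP_j=\delta_{i,j}P_i$, $P_iL_m=L_mP_{i+m}$, $P_iG_{m-\frac12}=G_{m-\frac12}P_{i+m-\frac12}$,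 $P_id=dP_i$; linearly $U_P(\mathfrak{ns})=U(\mathfrak{ns})\otimes\mathrm{span}\{P_n\}$ extended so as to contain $U(\mathfrak{ns})$. For $k\in2\mathbb Z\smallsetminus\{0\}$, $(t^{1/2})^{kL_0}=\sum_{n\in\frac12\mathbb Z}P_n(t^{1/2})^{kn}$ (a formal infinite sum, so that $(t^{1/2})^{kL_0}L_m=L_m(t^{1/2})^{-km}(t^{1/2})^{kL_0}$, $(t^{1/2})^{kL_0}G_{m-1/2}=G_{m-1/2}(t^{1/2})^{-k(m-1/2)}(t^{1/2})^{kL_0}$, and it commutes with $d$); the identity is understood with this formal sum allowed. Definition of $\Psi_j$: let $x$ be even and $\varphi$ odd, $L_j(x,\varphi)=-(x^{j+1}\partial_x+\frac{j+1}2\varphi x^j\partial_\varphi)$, $G_{j-1/2}(x,\varphi)=-x^j(\partial_\varphi-\varphi\partial_x)$, and let $b^{\mp2L_0(x,\varphi)}$ send $c\varphi^mx^n$ to $c\,b^{\pm(2n+m)}\varphi^mx^n$. $\Psi_j\in\mathbb C[\alpha_0^{1/2},\alpha_0^{-1/2}][[\mathcal A,\mathcal B]][\mathcal M,\mathcal N]$, $j\in\frac12\mathbb Z$ (even for $j\in\mathbb Z$, odd otherwise), are the unique series without constant term such that $\bar F^{(1)}=\exp(\sum_{j\ge1}(\Psi_{-j}L_{-j}(x,\varphi)+\Psi_{-j+1/2}G_{-j+1/2}(x,\varphi)))\cdot(x,\varphi)$ and $\bar F^{(2)}=\exp(-2\Psi_0L_0(x,\varphi))\cdot(\alpha_0^{1/2})^{2L_0(x,\varphi)}\cdot\exp(-\sum_{j\ge1}(\Psi_jL_j(x,\varphi)+\Psi_{j-1/2}G_{j-1/2}(x,\varphi)))\cdot(x,\varphi)$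 satisfy $\bar F^{(1)}=\bar F^{(2)}\circ\bar K\circ\bar H$, where $\bar H=\exp(-\sum_{j\ge1}(\mathcal A_jL_j(x,\varphi)+\mathcal M_{j-1/2}G_{j-1/2}(x,\varphi)))\cdot(\alpha_0^{1/2})^{-2L_0(x,\varphi)}\cdot(x,\varphi)$ and $\bar K=\exp(-\sum_{j\ge1}(\mathcal B_jL_{-j}(x,\varphi)+\mathcal N_{j-1/2}G_{-j+1/2}(x,\varphi)))\cdot(x,\varphi)$ (operators act right to left; compositions expanded in nonnegative powers of the $\mathcal A_j,\mathcal B_j,\mathcal M_{j-1/2},\mathcal N_{j-1/2}$). *)

(* Defs.v *)
From HB Require Import structures.
From mathcomp Require Import all_boot all_algebra finmap multiset.
From mathcomp Require Import boolp classical_sets functions cardinality fsbigop.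
From mathcomp Require Import generic_quotient.

Set Implicit Arguments.
Unset Strict Implicit.
Unset Printing Implicit Defensive.

Import GRing.Theory.

Local Open Scope ring_scope.

(** * The superalgebra U_P(ns) *)

(* [Lg m] is L_m, [Gg m] is G_{m+1/2}, [Pg k] is P_{k/2}: half-integers are
   always encoded by integers. *)
Inductive generator : Type :=
| Lg of int
| Gg of int
| dg
| Pg of int.

Section Presentation.
Variable K : fieldType.

Inductive term : Type :=
| Gen of generator
| Cst of K
| Add of term & term
| Mul of term & term.

Declare Scope term_scope.
Delimit Scope term_scope with T.
Bind Scope term_scope with term.
Local Notation "s + t" := (Add s t) : term_scope.
Local Notation "s * t" := (Mul s t) : term_scope.
Local Notation "c %:K" := (Cst c) (at level 1, format "c %:K").
Local Notation L m := (Gen (Lg m)).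
Local Notation G m := (Gen (Gg m)).
Local Notation d := (Gen dg).
Local Notation P k := (Gen (Pg k)).

Definition zint (m : int) : K := m%:~R.

(* The superbracket of two odd elements is the anticommutator.  In [rel_GG],
   [rel_PG] the second odd index is n - 1/2, i.e. [G (n - 1)]. *)
Inductive defining_relation : term -> term -> Prop :=
| rel_LL m n : defining_relation
    (L m * L n)
    (L n * L m + ((zint m - zint n)%:K * L (m + n)%R
      + (if m + n == 0 then (zint m ^+ 3 - zint m) / 12%:R else 0)%:K * d))
| rel_GL m n : defining_relation
    (G m * L n)
    (L n * G m + (zint m - (zint n - 1) / 2%:R)%:K * G (m + n)%R)
| rel_GG m n : defining_relation
    (G m * G (n - 1)%R + G (n - 1)%R * G m)
    (2%:R%:K * L (m + n)%R
      + (if m + n == 0 then (zint m ^+ 2 + zint m) / 3%:R else 0)%:K * d)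
| rel_dL m : defining_relation (d * L m) (L m * d)
| rel_dG m : defining_relation (d * G m) (G m * d)
| rel_PP i j : defining_relation
    (P i * P j) (if i == j then P i else 0%:K)
| rel_PL i m : defining_relation (P i * L m) (L m * P (i + m *+ 2)%R)
| rel_PG i m : defining_relation
    (P i * G (m - 1)%R) (G (m - 1)%R * P (i + m *+ 2 - 1)%R)
| rel_Pd i : defining_relation (P i * d) (d * P i).

(* The congruence generated by the axioms of unital associative [K]-algebras
   and by the defining relations. *)
Inductive cong : term -> term -> Prop :=
| cong_rel s t : defining_relation s t -> cong s t
| cong_refl s : cong s s
| cong_sym s t : cong s t -> cong t s
| cong_trans s t u : cong s t -> cong t u -> cong s u
| cong_add s s' t t' : cong s s' -> cong t t' -> cong (s + t) (s' + t')
| cong_mul s s' t t' : cong s s' -> cong t t' -> cong (s * t) (s' * t')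
| cong_addA s t u : cong (s + (t + u)) (s + t + u)
| cong_addC s t : cong (s + t) (t + s)
| cong_add0 s : cong (0%:K + s) s
| cong_addN s : cong ((-1)%:K * s + s) 0%:K
| cong_mulA s t u : cong (s * (t * u)) (s * t * u)
| cong_mul1 s : cong (1%:K * s) s
| cong_mulDl s t u : cong ((s + t) * u) (s * u + t * u)
| cong_mulDr s t u : cong (s * (t + u)) (s * t + s * u)
| cong_cstD a b : cong (a + b)%R%:K (a%:K + b%:K)
| cong_cstM a b : cong (a * b)%R%:K (a%:K * b%:K)
| cong_cstC a s : cong (a%:K * s) (s * a%:K).

Definition congb (s t : term) : bool := `[< cong s t >].

Lemma congb_equiv : equiv_class_of congb.
Proof.
split.
- by move=> s; apply/asboolP; exact: cong_refl.
- by move=> s t; apply/asboolP/asboolP; exact: cong_sym.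
- move=> t s u /asboolP st /asboolP tu; apply/asboolP; exact: cong_trans st tu.
Qed.

Canonical cong_equiv := EquivRelPack congb_equiv.

HB.instance Definition _ := gen_eqMixin term.
HB.instance Definition _ := gen_choiceMixin term.

Definition UP : Type := {eq_quot cong_equiv}%qT.

HB.instance Definition _ := Choice.on UP.
HB.instance Definition _ := EqQuotient.on UP.

Definition toUP (t : term) : UP := (\pi_UP t)%qT.

Lemma toUPP s t : toUP s = toUP t <-> cong s t.
Proof.
split=> [/eqP|st]; first by rewrite eqmodE => /asboolP.
by apply/eqP; rewrite eqmodE; apply/asboolP.
Qed.

Lemma reprK (u : UP) : toUP (repr u) = u.
Proof. exact: reprK. Qed.

Lemma cong_repr t : cong (repr (toUP t)) t.
Proof. by apply/toUPP; rewrite reprK. Qed.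

Definition UPadd (u v : UP) : UP := toUP (repr u + repr v).
Definition UPmul (u v : UP) : UP := toUP (repr u * repr v).
Definition UPopp (u : UP) : UP := toUP ((-1)%:K * repr u).

Lemma UPaddE s t : UPadd (toUP s) (toUP t) = toUP (s + t).
Proof. by apply/toUPP/cong_add; exact: cong_repr. Qed.

Lemma UPmulE s t : UPmul (toUP s) (toUP t) = toUP (s * t).
Proof. by apply/toUPP/cong_mul; exact: cong_repr. Qed.

Lemma UPoppE s : UPopp (toUP s) = toUP ((-1)%:K * s).
Proof. by apply/toUPP/cong_mul; [exact: cong_refl|exact: cong_repr]. Qed.

Lemma UPind (Q : UP -> Prop) : (forall t, Q (toUP t)) -> forall u, Q u.
Proof. by move=> Qt u; rewrite -(reprK u). Qed.

Fact UPaddA : associative UPadd.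
Proof.
elim/UPind=> s; elim/UPind=> t; elim/UPind=> u; rewrite !UPaddE.
by apply/toUPP/cong_addA.
Qed.
Fact UPaddC : commutative UPadd.
Proof.
by elim/UPind=> s; elim/UPind=> t; rewrite !UPaddE; apply/toUPP/cong_addC.
Qed.
Fact UPadd0 : left_id (toUP 0%:K) UPadd.
Proof. by elim/UPind=> s; rewrite UPaddE; apply/toUPP/cong_add0. Qed.
Fact UPaddN : left_inverse (toUP 0%:K) UPopp UPadd.
Proof. by elim/UPind=> s; rewrite UPoppE UPaddE; apply/toUPP/cong_addN. Qed.
Fact UPmulA : associative UPmul.
Proof.
elim/UPind=> s; elim/UPind=> t; elim/UPind=> u; rewrite !UPmulE.
by apply/toUPP/cong_mulA.
Qed.
Fact UPmul1l : left_id (toUP 1%:K) UPmul.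
Proof. by elim/UPind=> s; rewrite UPmulE; apply/toUPP/cong_mul1. Qed.
Fact UPmul1r : right_id (toUP 1%:K) UPmul.
Proof.
elim/UPind=> s; rewrite UPmulE; apply/toUPP.
by apply: cong_trans (cong_mul1 s); apply: cong_sym; exact: cong_cstC.
Qed.
Fact UPmulDl : left_distributive UPmul UPadd.
Proof.
elim/UPind=> s; elim/UPind=> t; elim/UPind=> u; rewrite !(UPmulE, UPaddE).
by apply/toUPP/cong_mulDl.
Qed.
Fact UPmulDr : right_distributive UPmul UPadd.
Proof.
elim/UPind=> s; elim/UPind=> t; elim/UPind=> u; rewrite !(UPmulE, UPaddE).
by apply/toUPP/cong_mulDr.
Qed.

Fixpoint augment (t : term) : K :=
  match t with
  | Gen _ => 0
  | Cst c => c
  | Add s t => augment s + augment t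
  | Mul s t => augment s * augment t
  end.

Lemma augment_cong s t : cong s t -> augment s = augment t.
Proof.
elim=> {s t} //=; last by move=> a s; rewrite mulrC.
- by move=> s t [] * /=; rewrite ?(mulr0, mul0r, addr0) //; case: eqP.
- by move=> s t u _ -> _ ->.
- by move=> s s' t t' _ -> _ ->.
- by move=> s s' t t' _ -> _ ->.
- by move=> s t u; rewrite addrA.
- by move=> s t; rewrite addrC.
- by move=> s; rewrite add0r.
- by move=> s; rewrite mulN1r addNr.
- by move=> s t u; rewrite mulrA.
- by move=> s; rewrite mul1r.
- by move=> s t u; rewrite mulrDl.
- by move=> s t u; rewrite mulrDr.
Qed.

Fact UP1_neq0 : toUP 1%:K != toUP 0%:K.
Proof. by apply/eqP => /toUPP/augment_cong/eqP; rewrite oner_eq0. Qed.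

HB.instance Definition _ :=
  GRing.isZmodule.Build UP UPaddA UPaddC UPadd0 UPaddN.
HB.instance Definition _ := GRing.Zmodule_isNzRing.Build UP
  UPmulA UPmul1l UPmul1r UPmulDl UPmulDr UP1_neq0.

Lemma toUPD s t : toUP (s + t) = toUP s + toUP t.
Proof. by rewrite -UPaddE. Qed.
Lemma toUPM s t : toUP (s * t) = toUP s * toUP t.
Proof. by rewrite -UPmulE. Qed.

Definition UPscale (c : K) (u : UP) : UP := toUP c%:K * u.

Fact UPscaleA a b u : UPscale a (UPscale b u) = UPscale (a * b) u.
Proof.
rewrite /UPscale mulrA -toUPM; congr (_ * _).
by apply/toUPP/cong_sym/cong_cstM.
Qed.
Fact UPscale1 : left_id 1 UPscale.
Proof. by move=> u; exact: mul1r. Qed.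
Fact UPscaleDr : right_distributive UPscale +%R.
Proof. by move=> c u v; exact: mulrDr. Qed.
Fact UPscaleDl u : {morph UPscale^~ u : a b / a + b}.
Proof.
move=> a b; rewrite /UPscale -mulrDl -toUPD; congr (_ * _).
by apply/toUPP/cong_cstD.
Qed.
HB.instance Definition _ := GRing.Zmodule_isLmodule.Build K UP
  UPscaleA UPscale1 UPscaleDr UPscaleDl.

Fact UPscaleAl (c : K) (u v : UP) : c *: (u * v) = (c *: u) * v.
Proof. exact: mulrA. Qed.
HB.instance Definition _ := GRing.Lmodule_isLalgebra.Build K UP UPscaleAl.

Fact UPscaleAr (c : K) (u v : UP) : c *: (u * v) = u * (c *: v).
Proof.
change (UPscale c (u * v) = u * UPscale c v).
rewrite /UPscale !mulrA; congr (_ * _); elim/UPind: u => s.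
by rewrite -!toUPM; apply/toUPP/cong_cstC.
Qed.
HB.instance Definition _ := GRing.Lalgebra_isAlgebra.Build K UP UPscaleAr.

(* The parity involution of U_P(ns): [u] is even (odd) iff [parity_inv u] is
   [u] ([- u]). *)
Fixpoint term_parity (t : term) : term :=
  match t with
  | Gen (Gg m) => (-1)%:K * G m
  | Gen g => Gen g
  | Cst c => c%:K
  | Add s t => term_parity s + term_parity t
  | Mul s t => term_parity s * term_parity t
  end%T.

Definition parity_inv (u : UP) : UP := toUP (term_parity (repr u)).

Definition UL (m : int) : UP := toUP (L m).
Definition UG (m : int) : UP := toUP (G m).
Definition Ud : UP := toUP d.
Definition UPr (k : int) : UP := toUP (P k).

Lemma toUPC c : toUP c%:K = c%:A.
Proof. by rewrite -[LHS]mulr1. Qed.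

Lemma parity_cong s t : cong s t -> cong (term_parity s) (term_parity t).
Proof.
elim=> {s t} /=; try by [constructor | econstructor; eassumption].
move=> s t st; apply/toUPP.
have N1 : toUP (-1)%:K = -1 by rewrite toUPC scaleN1r.
case: st => [m n|m n|m n|m|m|i j|i m|i m|i].
- by apply/toUPP/cong_rel/rel_LL.
- have /cong_rel/toUPP := rel_GL m n.
  rewrite !(toUPD, toUPM, N1, mulN1r, mulNr, mulrN) -opprD.
  by move=> ->.
- have /cong_rel/toUPP := rel_GG m n.
  by rewrite !(toUPD, toUPM, N1, mulN1r, mulNr, mulrN) !opprK.
- by apply/toUPP/cong_rel/rel_dL.
- have /cong_rel/toUPP := rel_dG m.
  by rewrite !(toUPM, N1, mulN1r, mulNr, mulrN) => ->.
- have /cong_rel/toUPP := rel_PP i j.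
  by case: eqP.
- by apply/toUPP/cong_rel/rel_PL.
- have /cong_rel/toUPP := rel_PG i m.
  by rewrite !(toUPM, N1, mulN1r, mulNr, mulrN) => ->.
- by apply/toUPP/cong_rel/rel_Pd.
Qed.

Lemma parity_invE t : parity_inv (toUP t) = toUP (term_parity t).
Proof. by apply/toUPP/parity_cong; exact: cong_repr. Qed.

End Presentation.

(** * Formal series *)

(* Variables are numbered from 0: [inl i] and [inr i] stand for A_{i+1} and
   B_{i+1} in [meven], and [Some (inl i)] and [Some (inr i)] for M_{i+1/2} and
   N_{i+1/2} in [modd], where [None] is phi.  The exponents of alpha_0^{1/2}
   and x are [malpha] and [mx].  The monomial denoted by [t] is the product of
   these powers and of the odd variables of [modd t] in increasing [orank]
   order, so phi comes first. *)
Record monomial : Type := Mono {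
  malpha : int;
  mx : int;
  meven : {mset nat + nat}%mset;
  modd : {fset option (nat + nat)}%fset }.

HB.instance Definition _ := gen_eqMixin monomial.
HB.instance Definition _ := gen_choiceMixin monomial.

Definition orank (v : option (nat + nat)) : nat :=
  match v with
  | None => 0
  | Some (inl i) => i.*2.+1
  | Some (inr i) => i.*2.+2
  end.

Definition mono1 : monomial := Mono 0 0 mset0 fset0.

Definition mono_mul (s t : monomial) : monomial :=
  Mono (malpha s + malpha t) (mx s + mx t) (meven s `+` meven t)%mset
    (modd s `|` modd t)%fset.

Definition mono_deg (t : monomial) : nat :=
  (size (meven t) + #|` modd t|)%N.

Section Series.
Variable K : fieldType.

(* The sign relating the product of the monomials [s] and [t] to
   [mono_mul s t]; it is 0 when they share an odd variable. *)
Definition koszul (s t : monomial) : K :=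
  if [disjoint modd s & modd t]%fset then
    (-1) ^+ (\sum_(a <- modd s) \sum_(b <- modd t) (orank b < orank a))%N
  else 0.

(* A series [f] is the formal sum of the [f t] times [t].  All infinite sums
   below are taken coefficientwise: [\sum_(i \in D) F i] is the sum of the
   nonzero [F i] when there are finitely many of them. *)
Notation series := (monomial -> K).

Definition smono (t : monomial) : series := fun s => (s == t)%:R.
Definition sone : series := smono mono1.
Definition apow (k : int) : series := smono (Mono k 0 mset0 fset0).
Definition xpow (k : int) : series := smono (Mono 0 k mset0 fset0).
Definition varA (i : nat) : series := smono (Mono 0 0 [mset inl i]%mset fset0).
Definition varB (i : nat) : series := smono (Mono 0 0 [mset inr i]%mset fset0).
Definition varM (i : nat) : series :=
  smono (Mono 0 0 mset0 [fset Some (inl i)]%fset).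
Definition varN (i : nat) : series :=
  smono (Mono 0 0 mset0 [fset Some (inr i)]%fset).
Definition phi : series := smono (Mono 0 0 mset0 [fset None]%fset).

Definition smul (f g : series) : series := fun t =>
  \sum_(p \in [set p | mono_mul p.1 p.2 = t]%classic)
    koszul p.1 p.2 * f p.1 * g p.2.
Local Notation "f *s g" := (smul f g) (at level 40, left associativity).

Definition sscale (c : K) (f : series) : series := fun t => c * f t.
Local Notation "c *:s f" := (sscale c f) (at level 40).

Definition spow (f : series) (k : nat) : series := iter k (smul f) sone.

Definition ssum (F : nat -> series) : series := fun t =>
  \sum_(i \in [set: nat]%classic) F i t.

(* The ring C[alpha_0^{1/2}, alpha_0^{-1/2}][[A,B]][M,N]. *)
Definition is_scalar (f : series) : Prop :=
  (forall t, f t != 0 -> mx t = 0 /\ None \notin modd t) /\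
  (forall e o, finite_set [set k | f (Mono k 0 e o) != 0]%classic).

Definition has_parity (b : bool) (f : series) : Prop :=
  forall t, f t != 0 -> odd #|` modd t| = b.

Definition no_constant_term (f : series) : Prop :=
  forall t, f t != 0 -> (0 < mono_deg t)%N.

(** ** Superderivations and superfunctions in x, phi *)

Definition dx (f : series) : series := fun t =>
  (mx t + 1)%:~R * f (Mono (malpha t) (mx t + 1) (meven t) (modd t)).

(* The left derivative: it anticommutes with odd variables. *)
Definition dphi (f : series) : series := fun t =>
  if None \in modd t then 0
  else f (Mono (malpha t) (mx t) (meven t) (None |` modd t)%fset).

(* L_j(x,phi), and G_{m+1/2}(x,phi). *)
Definition Lop (j : int) (f : series) : series :=
  - (xpow (j + 1) *s dx f
     + ((j + 1)%:~R / 2%:R) *:s (phi *s xpow j *s dphi f)).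
Definition Gop (m : int) (f : series) : series :=
  - (xpow (m + 1) *s (dphi f - phi *s dx f)).

(* (alpha_0^{1/2})^{2h L_0(x,phi)} *)
Definition alphaL0op (h : int) (f : series) : series := fun t =>
  f (Mono (malpha t + h * (mx t *+ 2 + (None \in modd t)%:R)) (mx t)
       (meven t) (modd t)).

(* sum_{j>=1} (a_j L_j + m_{j-1/2} G_{j-1/2}) with a_{i+1} = [a i] and
   m_{i+1/2} = [m i]; [negop] is the same with L_{-j} and G_{-j+1/2}. *)
Definition posop (a m : nat -> series) (f : series) : series :=
  ssum (fun i => a i *s Lop i.+1%:Z f + m i *s Gop i%:Z f).
Definition negop (a m : nat -> series) (f : series) : series :=
  ssum (fun i => a i *s Lop (- i.+1%:Z) f + m i *s Gop (- i.+1%:Z) f).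

Definition expop (D : series -> series) (f : series) : series := fun t =>
  \sum_(k \in [set: nat]%classic) (k`!%:R)^-1 * iter k D f t.

Definition xphi : series * series := (xpow 1, phi).

Definition mapp (D : series -> series) (f : series * series) :
  series * series := (D f.1, D f.2).

(* f^n for f equal to alpha_0 x plus terms of positive degree in the A, B, M,
   N, expanded in nonnegative powers of the latter. *)
Definition zbinom (n : int) (k : nat) : K :=
  (\prod_(i < k) (n%:~R - i%:R)) / k`!%:R.
Definition lead : series := apow 2 *s xpow 1.
Definition zpow (f : series) (n : int) : series := fun t =>
  \sum_(k \in [set: nat]%classic)
    zbinom n k
    * (apow ((n - k%:Z) *+ 2) *s xpow (n - k%:Z) *s spow (f - lead) k) t.

(* Substitution of the even [f] for x and of the odd [p] for phi in [F], for
   f as in [zpow]. *)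
Definition subst (F f p : series) : series := fun t =>
  \sum_(s \in [set: monomial]%classic)
    F s * ((if None \in modd s then p else sone)
           *s smono (Mono (malpha s) 0 (meven s) (modd s `\ None)%fset)
           *s zpow f (mx s)) t.

(* [comp F G] is F o G; below, G is H or K o H, whose first components are
   alpha_0 x plus terms of positive degree. *)
Definition comp (F G : series * series) : series * series :=
  (subst F.1 G.1 G.2, subst F.2 G.1 G.2).

(** ** The series Psi *)

Definition Hbar : series * series :=
  mapp (expop (fun f => - posop varA varM f)) (mapp (alphaL0op (-1)) xphi).

Definition Kbar : series * series :=
  mapp (expop (fun f => - negop varB varN f)) xphi.

(* [Psi k] is Psi_{k/2}. *)
Section Psi.
Variable Psi : int -> series.

Definition Psi_pos_even (i : nat) : series := Psi (i.+1.*2)%:Z.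
Definition Psi_pos_odd (i : nat) : series := Psi (i.*2.+1)%:Z.
Definition Psi_neg_even (i : nat) : series := Psi (- (i.+1.*2)%:Z).
Definition Psi_neg_odd (i : nat) : series := Psi (- (i.*2.+1)%:Z).

Definition Fbar1 : series * series :=
  mapp (expop (negop Psi_neg_even Psi_neg_odd)) xphi.

Definition Fbar2 : series * series :=
  mapp (expop (fun f => - (2%:R *:s (Psi 0 *s Lop 0 f))))
    (mapp (alphaL0op 1)
      (mapp (expop (fun f => - posop Psi_pos_even Psi_pos_odd f)) xphi)).

Definition is_Psi : Prop :=
  [/\ forall k, is_scalar (Psi k),
      forall k, has_parity (odd `|k|%N) (Psi k),
      forall k, no_constant_term (Psi k)
    & Fbar1 = comp Fbar2 (comp Kbar Hbar)].

End Psi.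

(** ** Series with coefficients in U_P(ns) *)

(* Formal sums over k of elements of U_P(ns) P_{k/2} are allowed as
   coefficients: [f t k] is the component in U_P(ns) P_{k/2} of the coefficient
   of [t], which is written on the left of [t].  U_P(ns) acts through
   u = sum_k u P_{k/2}, and since P_i (u P_j) vanishes for almost all i, the
   product of two formal sums is
   (sum_i u_i) (sum_k v_k) = sum_k (sum_i u_i v_k), for u_i and v_k in
   U_P(ns) P_{i/2} and U_P(ns) P_{k/2}. *)
Notation useries := (monomial -> int -> UP K).

Definition umul (f g : useries) : useries := fun t k =>
  \sum_(q \in [set q : monomial * monomial * int |
               mono_mul q.1.1 q.1.2 = t]%classic)
    koszul q.1.1 q.1.2 *:
      (f q.1.1 q.2
       * iter #|` modd q.1.1| (@parity_inv K) (g q.1.2 k)).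
Local Notation "f *u g" := (umul f g) (at level 40, left associativity).

Definition uconst (u : UP K) : useries := fun t k =>
  if t == mono1 then u * UPr K k else 0.

Definition uscalar (c : series) : useries := fun t k => c t *: UPr K k.

Definition usum (F : nat -> useries) : useries := fun t k =>
  \sum_(i \in [set: nat]%classic) F i t k.

Definition uexp (f : useries) : useries := fun t k =>
  \sum_(n \in [set: nat]%classic)
    (n`!%:R)^-1 *: iter n (umul f) (uconst 1) t k.

(* (alpha_0^{1/2})^{2h L_0} = sum_n P_n (alpha_0^{1/2})^{2hn} *)
Definition alphaL0 (h : int) : useries := fun t k =>
  if t == Mono (h * k) 0 mset0 fset0 then UPr K k else 0.

(* The analogues of [posop] and [negop]. *)
Definition upos (a m : nat -> series) : useries :=
  usum (fun i => uscalar (a i) *u uconst (UL K i.+1%:Z)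
                 + uscalar (m i) *u uconst (UG K i%:Z)).
Definition uneg (a m : nat -> series) : useries :=
  usum (fun i => uscalar (a i) *u uconst (UL K (- i.+1%:Z))
                 + uscalar (m i) *u uconst (UG K (- i.+1%:Z))).

(** ** The series Gamma *)

Definition Gamma_lead : series :=
  ssum (fun i => let j : K := i.+1%:R in
    ((j ^+ 3 - j) / 12%:R) *:s (apow (- (i.+1.*2)%:Z) *s varA i *s varB i)
    + ((j ^+ 2 - j) / 3%:R) *:s (apow (- (i.*2.+1)%:Z) *s varN i *s varM i)).

Definition has_AM (t : monomial) : Prop :=
  exists i, inl i \in meven t \/ Some (inl i) \in modd t.
Definition has_BN (t : monomial) : Prop :=
  exists i, inr i \in meven t \/ Some (inr i) \in modd t.

End Series.

Notation series K := (monomial -> K) (only parsing).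
Notation useries K := (monomial -> int -> UP K) (only parsing).
Notation "f *u g" := (umul f g) (at level 40, left associativity).
Notation "c *:s f" := (sscale c f) (at level 40).

(* Main.v *)
(* The variables are given the weights that make A_j L_j, B_j L_{-j}, ...
   homogeneous of weight 0.  Each exponential in the statement becomes the
   exponential of an operator (multiply by the variable after applying L_j or G_j)
   that raises the degree in A, B, M, N; such operators act on series
   in x, phi (through the vector fields, with d = 0) and on series with
   coefficients in U_P(ns), and identities between them that only use the
   brackets hold in both modules.  Composition with K o H is the operator of the
   left-hand side in the first module, so that the equation defining Psi says
   that e^{Y_-} and T := e^{X_A} e^{X_B} e^{-Y_0} e^{-Y_+} agree on x.  Comparing
   degree by degree, this forces Psi_k to be homogeneous of weight k.

   For the Euler derivation E with respect to the degree, conjugation by e^{Y}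
   takes E to E - eta(Y), where eta(Y) is again a combination of the L_j, G_j
   and d.  Hence the logarithmic derivatives of e^{Y_-} and T agree on x, and
   since a vector field is determined by its value on x, they differ by a
   central element gamma d, in every module.  With Gamma the antiderivative of
   gamma, e^{-Gamma d} e^{-Y_-} T commutes with E and is 1 in degree 0, so that
   it is the identity; in the module of series over U_P(ns) this is the
   factorization.  In degree 2, Gamma d is the central part of [X_A, X_B].

   For the uniqueness, all factors but e^{Gamma d} are invertible, and the
   lowest-degree part of Gamma - Gamma' is killed by d P_0.  That d P_0 is not 0
   follows from an explicit module. *)

Require Import Defs.
From HB Require Import structures.
From mathcomp Require Import all_boot all_order all_algebra finmap multiset.
From mathcomp Require Import boolp classical_sets functions cardinality fsbigop.
From mathcomp Require Import reals complex.
From mathcomp Require Import zify ring.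

Set Implicit Arguments.
Unset Strict Implicit.
Unset Printing Implicit Defensive.

Import Order.TTheory GRing.Theory Num.Theory.

Local Open Scope ring_scope.

(** Homogeneity keeps the Lie algebra elements small. A monomial of weight k can only multiply the
    generator of doubled index k, and d if k = 0, so an element is a pair of scalar series.
    Brackets, Ad and eta are computed on such pairs without any module. The transfer from vector
    fields to U_P(ns) rests on this: the fields do not see d, but they decide the first components,
    and the second ones are read off the same pairs. The obstacle is alpha_0^{-L_0}, which is not
    unipotent and stands in the middle of the product. Moved to the right, it turns B_j into
    alpha_0^{-j} B_j and N_{j-1/2} into alpha_0^{-j+1/2} N_{j-1/2}. Hence the powers of alpha_0 in
    Gamma: with these variables the exponent of alpha_0 in a monomial is a function of its B's and
    N's, and a monomial has finitely many normalized divisors. Over U_P(ns), the formal sums over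
    the P_k are cut into columns, the components in U_P(ns) P_{k/2}. On a column alpha_0^{-L_0} is
    just a power of alpha_0, and the exponentials to its left are operators of left
    multiplication. *)

Definition oddvar : Type := option (nat + nat).

(** * Monomials: weights, degree and divisibility *)

Definition evensum (f : nat + nat -> int) (e : {mset nat + nat}%mset) : int :=
  \sum_(v <- e) f v.
Definition oddsum (g : oddvar -> int) (o : {fset oddvar}%fset) : int :=
  \sum_(v <- o) g v.

(* Doubled L_0-weights, for which A_j L_j, B_j L_{-j}, M_{j-1/2} G_{j-1/2} and
   N_{j-1/2} G_{-j+1/2} have weight 0; phi is left out. *)
Definition weven (v : nat + nat) : int :=
  match v with inl i => (i.+1.*2)%:Z | inr i => - (i.+1.*2)%:Z end.
Definition wodd (v : oddvar) : int :=
  match v with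
  | None => 0 | Some (inl i) => (i.*2.+1)%:Z | Some (inr i) => - (i.*2.+1)%:Z
  end.
Definition wevenB (v : nat + nat) : int := if v is inr _ then weven v else 0.
Definition woddB (v : oddvar) : int := if v is Some (inr _) then wodd v else 0.

Definition wt (t : monomial) : int :=
  evensum weven (meven t) + oddsum wodd (modd t).
Definition wtB (t : monomial) : int :=
  evensum wevenB (meven t) + oddsum woddB (modd t).
Definition sdeg (t : monomial) : nat :=
  (size (meven t) + #|` (modd t `\ None)%fset|)%N.

(** The exponents of alpha_0^{1/2} and x are integers, so they never obstruct divisibility. *)
Definition mdiv (u s : monomial) : bool :=
  (meven u `<=` meven s)%mset && (modd u `<=` modd s)%fset.
Definition msub (s u : monomial) : monomial :=
  Mono (malpha s - malpha u) (mx s - mx u) (meven s `\` meven u)%mset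
    (modd s `\` modd u)%fset.
Definition mdisj (s t : monomial) : bool := [disjoint modd s & modd t]%fset.

(* With the normalization [malpha t = wtB t] the powers of alpha_0 are
   determined by the other variables. *)
Definition isT (t : monomial) : bool :=
  [&& mx t == 0, None \notin modd t & malpha t == wtB t].
(** The power of alpha_0 is left free: this is all that is known of the monomials of Psi before its
    homogeneity is proved. *)
Definition isS (t : monomial) : bool := (mx t == 0) && (None \notin modd t).

Lemma isT_S t : isT t -> isS t.
Proof. by case/and3P=> x o _; rewrite /isS x o. Qed.

Lemma mono_eq (s t : monomial) :
  malpha s = malpha t -> mx s = mx t -> meven s = meven t -> modd s = modd t ->
  s = t.
Proof. by case: s t => [a x e o] [a' x' e' o'] /= -> -> -> ->. Qed.

Lemma evensumD f (A B : {mset nat + nat}%mset) :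
  evensum f (A `+` B)%mset = evensum f A + evensum f B.
Proof.
rewrite /evensum -big_cat; apply: perm_big; apply/allP => a _ /=.
by rewrite count_cat !count_mem_mset msetE2.
Qed.

Lemma perm_fsetU (T : choiceType) (A B : {fset T}%fset) :
  [disjoint A & B]%fset -> perm_eq (A `|` B)%fset (A ++ B).
Proof.
move=> dAB; apply: uniq_perm; first exact: fset_uniq.
  rewrite cat_uniq !fset_uniq andbT /=; apply/hasPn => a aB; apply/negP => aA.
  by move/fdisjointP: dAB => /(_ a aA); rewrite aB.
by move=> a; rewrite mem_cat in_fsetU.
Qed.

Lemma oddsumU g (A B : {fset oddvar}%fset) :
  [disjoint A & B]%fset -> oddsum g (A `|` B)%fset = oddsum g A + oddsum g B.
Proof. by move=> dAB; rewrite /oddsum -big_cat; apply/perm_big/perm_fsetU. Qed.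

Lemma wtM s t : mdisj s t -> wt (mono_mul s t) = wt s + wt t.
Proof.
move=> d; rewrite /wt/= evensumD oddsumU //.
by rewrite -!addrA; congr (_ + _); rewrite addrCA.
Qed.

Lemma wtBM s t : mdisj s t -> wtB (mono_mul s t) = wtB s + wtB t.
Proof.
move=> d; rewrite /wtB/= evensumD oddsumU //.
by rewrite -!addrA; congr (_ + _); rewrite addrCA.
Qed.

Lemma size_msetD (A B : {mset nat + nat}%mset) :
  size (A `+` B)%mset = (size A + size B)%N.
Proof.
rewrite -size_cat; apply: perm_size; apply/allP => a _ /=.
by rewrite count_cat !count_mem_mset msetE2.
Qed.

Lemma sdegM s t : mdisj s t -> sdeg (mono_mul s t) = (sdeg s + sdeg t)%N.
Proof.
move=> d; rewrite /sdeg/= size_msetD fsetDUl.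
have d' : [disjoint modd s `\ None & modd t `\ None]%fset.
  apply/fdisjointP => a; rewrite !inE => /andP[-> /= aS].
  by move/fdisjointP: d => /(_ _ aS).
by rewrite (perm_size (perm_fsetU d')) size_cat addnACA.
Qed.

Lemma mdivP u s : mdiv u s ->
  [/\ mono_mul u (msub s u) = s & mdisj u (msub s u)].
Proof.
case/andP=> e o; split; last first.
  by apply/fdisjointP => a au; rewrite /= !inE au.
apply: mono_eq => /=; [lia|lia| |].
  by rewrite msetBDKC.
by apply/fsetP => a; rewrite !inE; case: (boolP (a \in modd u)) => // /(fsubsetP o) ->.
Qed.

Lemma mdivM u v : mdiv u (mono_mul u v).
Proof.
by rewrite /mdiv fsubsetUl andbT; apply/msubsetP => a /=; rewrite msetE2 leq_addr.
Qed.

Lemma mdivMr u v : mdiv v (mono_mul u v).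
Proof.
by rewrite /mdiv fsubsetUr andbT; apply/msubsetP => a /=; rewrite msetE2 leq_addl.
Qed.

Lemma msubM u v : mdisj u v -> msub (mono_mul u v) u = v.
Proof.
move=> d; apply: mono_eq => /=; [lia|lia|exact: msetDKB|].
rewrite fsetDUl fsetDv fset0U; apply/fsetDidPl.
by rewrite fdisjoint_sym.
Qed.

Lemma msubMl s u v : msub s (mono_mul u v) = msub (msub s u) v.
Proof.
apply: mono_eq => /=; [lia|lia|exact: msetBDA|].
by rewrite fsetDDl.
Qed.

Lemma mono_mulC s t : mono_mul s t = mono_mul t s.
Proof. by apply: mono_eq => /=; [lia|lia|exact: msetDC|exact: fsetUC]. Qed.

Lemma mdisjC s t : mdisj s t = mdisj t s.
Proof. by rewrite /mdisj fdisjoint_sym. Qed.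

Lemma mdisjMl s t u : mdisj (mono_mul s t) u = mdisj s u && mdisj t u.
Proof. by rewrite /mdisj fdisjointUX. Qed.

Lemma mdisjMr s t u : mdisj s (mono_mul t u) = mdisj s t && mdisj s u.
Proof. by rewrite /mdisj fdisjointXU. Qed.

Lemma mdiv_trans t s u : mdiv s t -> mdiv t u -> mdiv s u.
Proof.
case/andP=> e o /andP[e' o']; rewrite /mdiv (msubset_trans e e') /=.
exact: fsubset_trans o o'.
Qed.

Lemma mdiv_mul u v s : mdisj u v ->
  mdiv (mono_mul u v) s = mdiv u s && mdiv v (msub s u).
Proof.
move=> d; apply/idP/andP => [uvs|[us vsu]].
  have us := mdiv_trans (mdivM u v) uvs; split=> //.
  case/andP: uvs => /msubsetP e o; apply/andP; split.
    apply/msubsetP => a; have := e a; rewrite /= !msetE2.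
    by move: (meven u a) (meven v a) (meven s a) => x y z; lia.
  apply/fsubsetP => a av; rewrite !inE.
  move/fsubsetP: o => /(_ a); rewrite !inE av orbT => ->//; rewrite andbT.
  by apply/negP => au; move/fdisjointP: d => /(_ a au); rewrite av.
case/andP: us => /msubsetP e o; case/andP: vsu => /msubsetP e' o'.
apply/andP; split.
  apply/msubsetP => a; have := e a; have := e' a; rewrite /= !msetE2.
  by move: (meven u a) (meven v a) (meven s a) => x y z; lia.
apply/fsubsetP => a; rewrite /= !inE => /orP[au|av]; first exact: (fsubsetP o).
by have := fsubsetP o' _ av; rewrite /= !inE => /andP[].
Qed.

Lemma mdiv_disj u v s : mdiv u s -> mdiv v (msub s u) -> mdisj u v.
Proof.
case/andP=> _ _ /andP[_ /fsubsetP o]; apply/fdisjointP => a au; apply/negP => av.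
by have := o _ av; rewrite /= !inE au.
Qed.

Lemma mdiv_sub t1 t s : mdiv t1 t -> mdiv t s -> mdiv (msub t t1) (msub s t1).
Proof.
move=> t1t ts; have [e d] := mdivP t1t.
by move: ts; rewrite -{1}e mdiv_mul // => /andP[].
Qed.

Lemma msub_sub t1 t s : mdiv t1 t -> msub (msub s t1) (msub t t1) = msub s t.
Proof. by move=> /mdivP[e d]; rewrite -msubMl e. Qed.

Lemma mdiv_subl t s : mdiv t s -> mdiv (msub s t) s.
Proof. by move=> /mdivP[e _]; rewrite -{2}e mdivMr. Qed.

Lemma msubK t s : mdiv t s -> msub s (msub s t) = t.
Proof. by move=> /mdivP[e d]; rewrite -{1}e mono_mulC msubM // mdisjC. Qed.

Lemma isTM s t : mdisj s t -> isT s -> isT t -> isT (mono_mul s t).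
Proof.
move=> d /and3P[/eqP xs os /eqP hs] /and3P[/eqP xt ot /eqP ht].
by rewrite /isT /= xs xt addr0 eqxx in_fsetU negb_or os ot wtBM // hs ht eqxx.
Qed.

Lemma isT_sub t s : mdiv t s -> isT t -> isT s -> isT (msub s t).
Proof.
move=> /mdivP[e d] /and3P[/eqP xs os /eqP hs] /and3P[/eqP xt ot /eqP ht].
have := wtBM d; rewrite e => wtBs.
rewrite /isT /= xt xs subrr eqxx /= !inE negb_and ot orbT /= hs ht wtBs.
by rewrite addrAC subrr add0r.
Qed.

(** * Normalized divisors *)

Definition submsets (e : {mset nat + nat}%mset) : seq {mset nat + nat}%mset :=
  undup [seq seq_mset (mask (val m) e) | m <- enum {: (size e).-tuple bool}].

Lemma mem_submsets (e e' : {mset nat + nat}%mset) : (e' \in submsets e) = (e' `<=` e)%mset.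
Proof.
rewrite mem_undup; apply/mapP/msubsetP => [[m _ ->] a|le].
  rewrite mset_seqE -count_mem_mset.
  exact/leq_count_subseq/mask_subseq.
have : forall x, (count_mem x (e' : {mset _}%mset) <= count_mem x e)%N.
  by move=> x; rewrite !count_mem_mset.
move=> /count_subseqP[s' /subseqP[m sm ->] p].
have sz : size m == size e by rewrite sm.
exists (Tuple sz); first by rewrite mem_enum.
by rewrite -[LHS]seq_mset_id; apply/eq_seq_msetP.
Qed.

Definition Tmono (e : {mset nat + nat}%mset) (o : {fset oddvar}%fset) : monomial :=
  Mono (wtB (Mono 0 0 e o)) 0 e o.

(** The normalized divisors of s. There are finitely many, since the variables of a divisor dictate
    its power of alpha_0; coefficients of products thus become finite sums. *)
Definition D (s : monomial) : seq monomial :=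
  [seq Tmono e o | e <- submsets (meven s), o <- fpowerset (modd s `\ None)%fset].

Lemma uniq_D s : uniq (D s).
Proof.
apply: allpairs_uniq; [exact: undup_uniq|exact: fset_uniq|].
by move=> [e o] [e' o'] _ _ [_ -> ->].
Qed.

Lemma mem_D s u : (u \in D s) = isT u && mdiv u s.
Proof.
apply/allpairsP/idP => [[[e o]] /= [eM oM ->]|].
  move: eM oM; rewrite mem_submsets fpowersetE => eM oM.
  rewrite /isT /mdiv /= eqxx eM /= -andbA; apply/and3P; split.
  - by apply/negP => /(fsubsetP oM); rewrite !inE.
  - by rewrite /wtB.
  - by apply: fsubset_trans oM _; rewrite fsubD1set.
case/andP=> /and3P[/eqP x n /eqP a] /andP[e o].
exists (meven u, modd u); split => /=.
- by rewrite mem_submsets.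
- rewrite fpowersetE; apply/fsubsetP => v vu; rewrite !inE (fsubsetP o _ vu) andbT.
  by apply: contraNneq n => <-.
- by apply: mono_eq => //=; rewrite a.
Qed.

Lemma D_isT s t : t \in D s -> isT t.
Proof. by rewrite mem_D => /andP[]. Qed.
Lemma D_mdiv s t : t \in D s -> mdiv t s.
Proof. by rewrite mem_D => /andP[]. Qed.

Lemma eq_D s s' : meven s = meven s' -> (modd s `\ None)%fset = (modd s' `\ None)%fset ->
  D s = D s'.
Proof. by rewrite /D => -> ->. Qed.

Lemma mono1_D s : mono1 \in D s.
Proof.
rewrite mem_D /mdiv msub0set fsub0set /isT /wtB /evensum /oddsum /=.
by rewrite enum_mset0 big_nil big_seq_fset0.
Qed.

Section BigD.
Variable V : nmodType.

(** Both sides run over the factorizations of s into t1, t2 and a rest; on the right they are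
    grouped by t = t1 t2. *)
Lemma sum_D_assoc (s : monomial) (F : monomial -> monomial -> V) :
  \sum_(t1 <- D s) \sum_(t2 <- D (msub s t1)) F t1 t2
  = \sum_(t <- D s) \sum_(t1 <- D t) F t1 (msub t t1).
Proof.
have E1 t1 : t1 \in D s -> \sum_(t2 <- D (msub s t1)) F t1 t2 =
    \sum_(t <- D s | t1 \in D t) F t1 (msub t t1).
  move=> t1s; have Tt1 := D_isT t1s; have t1s' := D_mdiv t1s.
  rewrite -[RHS]big_filter; pose h := mono_mul t1.
  have -> : \sum_(t2 <- D (msub s t1)) F t1 t2 =
      \sum_(t <- map h (D (msub s t1))) F t1 (msub t t1).
    rewrite big_map big_seq [RHS]big_seq; apply: eq_bigr => t2 t2s.
    by rewrite msubM //; apply: mdiv_disj t1s' (D_mdiv t2s).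
  apply: perm_big; apply: uniq_perm.
  - rewrite map_inj_in_uniq ?uniq_D // => a b aD bD /(congr1 (msub^~ t1)) /=.
    by rewrite !msubM //; [apply: mdiv_disj t1s' (D_mdiv bD)
                          |apply: mdiv_disj t1s' (D_mdiv aD)].
  - by rewrite filter_uniq // uniq_D.
  move=> t; rewrite mem_filter; apply/mapP/andP => [[t2 t2s ->]|[t1t ts]].
    have d := mdiv_disj t1s' (D_mdiv t2s).
    split; rewrite mem_D ?Tt1 ?mdivM // isTM // ?(D_isT t2s) //.
    by rewrite mdiv_mul // t1s' (D_mdiv t2s).
  exists (msub t t1); last by rewrite /h; case: (mdivP (D_mdiv t1t)).
  by rewrite mem_D isT_sub ?(D_mdiv t1t) ?(D_isT ts) //= mdiv_sub ?(D_mdiv t1t) ?(D_mdiv ts).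
rewrite (eq_big_seq _ E1).
rewrite (exchange_big_dep xpredT) //=.
rewrite big_seq [RHS]big_seq; apply: eq_bigr => t ts.
rewrite -[LHS]big_filter; apply: perm_big; apply: uniq_perm; rewrite ?filter_uniq ?uniq_D //.
move=> t1; rewrite mem_filter; apply: andb_idr => t1t.
by rewrite mem_D (D_isT t1t) (mdiv_trans (D_mdiv t1t) (D_mdiv ts)).
Qed.

(** For normalized t, taking the complementary divisor is an involution of [D t]. *)
Lemma sum_D_sym (t : monomial) (F : monomial -> monomial -> V) : isT t ->
  \sum_(t1 <- D t) F t1 (msub t t1) = \sum_(t1 <- D t) F (msub t t1) t1.
Proof.
move=> Tt.
have -> : \sum_(t1 <- D t) F (msub t t1) t1 =
    \sum_(t1 <- D t) F (msub t t1) (msub t (msub t t1)).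
  by rewrite big_seq [RHS]big_seq; apply: eq_bigr => t1 /D_mdiv h; rewrite msubK.
rewrite -(big_map (msub t) xpredT (fun u => F u (msub t u))).
apply: perm_big; apply: uniq_perm; rewrite ?uniq_D //.
  rewrite map_inj_in_uniq ?uniq_D // => a b aD bD /(congr1 (msub t)).
  by rewrite !msubK // ?(D_mdiv aD) ?(D_mdiv bD).
have sub u : u \in D t -> msub t u \in D t.
  by move=> uD; rewrite mem_D isT_sub ?(D_mdiv uD) ?(D_isT uD) // mdiv_subl ?(D_mdiv uD).
move=> u; apply/idP/mapP => [uD|[v vD ->]]; last exact: sub.
by exists (msub t u); [exact: sub|rewrite msubK // D_mdiv].
Qed.

Lemma sum_D_widen (s s' : monomial) (F : monomial -> V) : mdiv s s' ->
  (forall t, isT t -> ~~ mdiv t s -> F t = 0) ->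
  \sum_(t <- D s) F t = \sum_(t <- D s') F t.
Proof.
move=> ss' F0; rewrite [RHS](bigID (mem (D s))) /= [X in _ = _ + X]big1_seq.
  rewrite addr0 -[RHS]big_filter; apply: perm_big.
  apply: uniq_perm; rewrite ?filter_uniq ?uniq_D // => u.
  rewrite mem_filter; apply/esym/andb_idr => uD.
  by rewrite mem_D (D_isT uD) (mdiv_trans (D_mdiv uD) ss').
by move=> u /andP[uD uD']; apply: F0 (D_isT uD') _; move: uD; rewrite mem_D (D_isT uD').
Qed.

End BigD.

(** * Koszul signs *)

Definition inversions (o o' : {fset oddvar}%fset) : nat :=
  (\sum_(a <- o) \sum_(b <- o') (orank b < orank a))%N.

Lemma orank_inj : injective orank.
Proof.
move=> [[i|i]|] [[j|j]|] //= H; try (exfalso; lia).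
- by have -> : i = j by lia.
- by have -> : i = j by lia.
Qed.

Lemma inversionsUl (o1 o2 o : {fset oddvar}%fset) : [disjoint o1 & o2]%fset ->
  inversions (o1 `|` o2)%fset o = (inversions o1 o + inversions o2 o)%N.
Proof. by move=> d; rewrite /inversions -big_cat; apply/perm_big/perm_fsetU. Qed.

Lemma inversionsUr (o1 o2 o : {fset oddvar}%fset) : [disjoint o1 & o2]%fset ->
  inversions o (o1 `|` o2)%fset = (inversions o o1 + inversions o o2)%N.
Proof.
move=> d; rewrite /inversions -big_split /=; apply: eq_bigr => a _.
by rewrite -big_cat; apply/perm_big/perm_fsetU.
Qed.

Lemma inversionsC (o1 o2 : {fset oddvar}%fset) : [disjoint o1 & o2]%fset ->
  (inversions o1 o2 + inversions o2 o1 = #|` o1| * #|` o2|)%N.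
Proof.
move=> /fdisjointP d; rewrite /inversions [X in (_ + X)%N]exchange_big /= -big_split /=.
rewrite big_seq (eq_bigr (fun=> #|` o2|)); last first.
  move=> a ao1; rewrite -big_split /= big_seq (eq_bigr (fun=> 1%N)).
    by rewrite -big_seq sum1_size.
  move=> b bo2; case: ltngtP => // /orank_inj ba.
  by move: (d _ ao1); rewrite -ba bo2.
by rewrite -big_seq big_const_seq iter_addn_0 count_predT mulnC.
Qed.

Section Koszul.
Variable K : numFieldType.

Lemma koszulE s t : mdisj s t -> koszul K s t = (-1) ^+ inversions (modd s) (modd t).
Proof. by rewrite /koszul /mdisj => ->. Qed.

Lemma koszul0 s t : ~~ mdisj s t -> koszul K s t = 0.
Proof. by rewrite /koszul /mdisj => /negbTE ->. Qed.

(** Associativity of the product of series at the level of signs: both sides count the inversions of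
    the three pairs. *)
Lemma koszul_cocycle s t u :
  koszul K s t * koszul K (mono_mul s t) u = koszul K t u * koszul K s (mono_mul t u).
Proof.
have [st|st] := boolP (mdisj s t); last first.
  by rewrite !(koszul0 st) mul0r (@koszul0 s) ?mulr0 // mdisjMr (negbTE st).
have [tu|tu] := boolP (mdisj t u); last first.
  by rewrite !(koszul0 tu) mul0r (@koszul0 _ u) ?mulr0 // mdisjMl (negbTE tu) andbF.
have [su|su] := boolP (mdisj s u); last first.
  rewrite (@koszul0 _ u) ?mulr0; last by rewrite mdisjMl (negbTE su).
  by rewrite (@koszul0 s) ?mulr0 // mdisjMr (negbTE su) andbF.
rewrite !koszulE ?mdisjMr ?mdisjMl ?st ?tu ?su //= -!exprD.
by rewrite inversionsUl // inversionsUr //; congr (_ ^+ _); lia.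
Qed.

Lemma koszulC s t : koszul K t s = (-1) ^+ (#|` modd s| * #|` modd t|) * koszul K s t.
Proof.
have [d|d] := boolP (mdisj s t); last first.
  by rewrite !koszul0 ?mulr0 // mdisjC.
rewrite !koszulE ?(mdisjC t) // -inversionsC // exprD mulrAC -expr2.
by rewrite sqrr_sign mul1r.
Qed.

Lemma koszul_even s t : modd s = fset0 -> koszul K s t = 1.
Proof.
move=> s0; rewrite koszulE /mdisj s0 ?fdisjoint0X //.
by rewrite /inversions big_seq_fset0.
Qed.

Lemma koszul_evenr s t : modd t = fset0 -> koszul K s t = 1.
Proof. by move=> t0; rewrite koszulC (koszul_even s t0) t0 cardfs0 mul0n mul1r. Qed.

Lemma koszul_phi s t : modd s = [fset None]%fset -> mdisj s t -> koszul K s t = 1.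
Proof.
move=> s0 d; by rewrite koszulE // s0 /inversions big_seq_fset1 big1.
Qed.

Lemma koszul_sq s t : mdisj s t -> koszul K s t * koszul K s t = 1.
Proof. by move=> d; rewrite koszulE // -expr2 sqrr_sign. Qed.

End Koszul.

Lemma mdisj_even s t : modd s = fset0 -> mdisj s t.
Proof. by rewrite /mdisj => ->; rewrite fdisjoint0X. Qed.

Lemma mono_mul1 s : mono_mul mono1 s = s.
Proof. by apply: mono_eq => /=; rewrite ?add0r ?mset0D ?fset0U. Qed.

Definition oddz (k : int) : bool := odd `|k|%N.

Lemma oddzD a b : oddz (a + b) = oddz a (+) oddz b.
Proof. by rewrite /oddz; lia. Qed.
Lemma oddzN a : oddz (- a) = oddz a.
Proof. by rewrite /oddz abszN. Qed.

Lemma oddz_wt t : isS t -> oddz (wt t) = odd #|` modd t|.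
Proof.
case/andP=> _ n; rewrite /wt oddzD.
have -> : oddz (evensum weven (meven t)) = false.
  rewrite /evensum; elim: (meven t : seq _) => [|v l IH]; first by rewrite big_nil.
  by rewrite big_cons oddzD IH addbF; case: v => i; rewrite /oddz /= ?abszN /= odd_double.
have {n} : None \notin (modd t : seq _) by [].
rewrite addFb /oddsum; elim: (modd t : seq _) => [|v l IH]; first by rewrite big_nil.
rewrite inE negb_or big_cons oddzD => /andP[vn nl].
by rewrite IH //=; case: v vn => [[i|i]|] //= _; rewrite /oddz ?abszN /= odd_double.
Qed.

Section Pointwise.
Variables (I : Type) (K : numFieldType) (V : lmodType K).
Implicit Types u v : I -> V.

Lemma fDE u v s : (u + v) s = u s + v s. Proof. by []. Qed.
Lemma fNE u s : (- u) s = - u s. Proof. by []. Qed.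
Lemma fBE u v s : (u - v) s = u s - v s. Proof. by []. Qed.
Lemma f0E s : (0 : I -> V) s = 0. Proof. by []. Qed.
Lemma fZE (c : K) u s : (c *: u) s = c *: u s. Proof. by []. Qed.
Lemma fsumE J r (P : pred J) (F : J -> I -> V) s :
  (\sum_(i <- r | P i) F i) s = \sum_(i <- r | P i) F i s.
Proof.
by elim: r => [|a r IH]; rewrite ?big_nil // !big_cons; case: ifP => // _; rewrite fDE IH.
Qed.
End Pointwise.

(** * Multiplication by monomials, linear operators, the degree filtration *)

Section Act.
Variables (K : numFieldType) (V : lmodType K) (sg : {linear V -> V}).
Implicit Types (u v : monomial -> V).

Definition sgi (n : nat) (x : V) : V := iter n sg x.

Lemma sgi_lin n (c : K) x y : sgi n (c *: x + y) = c *: sgi n x + sgi n y.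
Proof. by elim: n => //= n IH; rewrite /sgi /= -!/(sgi n _) IH linearP. Qed.
Lemma sgi0 n : sgi n 0 = 0.
Proof. by elim: n => //= n IH; rewrite /sgi /= -!/(sgi n _) IH linear0. Qed.
Lemma sgiZ n (c : K) x : sgi n (c *: x) = c *: sgi n x.
Proof. by rewrite -[c *: x]addr0 sgi_lin sgi0 addr0. Qed.
Lemma sgiD n x y : sgi n (x + y) = sgi n x + sgi n y.
Proof. by rewrite -[x]scale1r sgi_lin !scale1r. Qed.
Lemma sgi_sum n I r (F : I -> V) : sgi n (\sum_(i <- r) F i) = \sum_(i <- r) sgi n (F i).
Proof. by elim: r => [|a r IH]; rewrite ?big_nil ?sgi0 // !big_cons sgiD IH. Qed.
Lemma sgi_add m n x : sgi (m + n) x = sgi m (sgi n x).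
Proof. by rewrite /sgi iterD. Qed.

(* The product t v, in which the coefficients of v are moved to the left of t. *)
Definition act (t : monomial) v : monomial -> V := fun s =>
  if mdiv t s then koszul K t (msub s t) *: sgi #|` modd t| (v (msub s t)) else 0.

Lemma act_lin t c u v : act t (c *: u + v) = c *: act t u + act t v.
Proof.
apply/funext => s; rewrite fDE fZE /act fDE fZE.
case: ifP => _; last by rewrite scaler0 addr0.
by rewrite sgi_lin scalerDr !scalerA mulrC.
Qed.

Lemma act0 t : act t 0 = 0.
Proof. by apply/funext => s; rewrite /act f0E sgi0 scaler0 if_same. Qed.
Lemma actZ t c u : act t (c *: u) = c *: act t u.
Proof. by rewrite -[c *: u]addr0 act_lin act0 addr0. Qed.
Lemma actD t u v : act t (u + v) = act t u + act t v.
Proof. by rewrite -[u]scale1r act_lin !scale1r. Qed.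

Lemma act_sum t I r (F : I -> monomial -> V) :
  act t (\sum_(i <- r) F i) = \sum_(i <- r) act t (F i).
Proof. by elim: r => [|a r IH]; rewrite ?big_nil ?act0 // !big_cons actD IH. Qed.

Lemma act_ext t u v s : (mdiv t s -> u (msub s t) = v (msub s t)) ->
  act t u s = act t v s.
Proof. by rewrite /act; case: ifP => // _ ->. Qed.

Lemma actM t1 t2 v : act t1 (act t2 v) = koszul K t1 t2 *: act (mono_mul t1 t2) v.
Proof.
apply/funext => s; rewrite fZE /act.
have [d|d] := boolP (mdisj t1 t2); last first.
  rewrite (koszul0 K d) scale0r; case: ifP => // h1; case: ifP => h2.
    by rewrite (mdiv_disj h1 h2) in d.
  by rewrite sgi0 scaler0.
rewrite mdiv_mul //; case: (boolP (mdiv t1 s)) => h1 /=; last by rewrite scaler0.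
case: (boolP (mdiv t2 _)) => h2 /=; last by rewrite sgi0 !scaler0.
rewrite sgiZ -sgi_add msubMl (perm_size (perm_fsetU d)) size_cat !scalerA.
congr (_ *: _); rewrite koszul_cocycle mulrC; congr (_ * koszul K _ _).
by case: (mdivP h2).
Qed.

Lemma actC t1 t2 v :
  act t1 (act t2 v) = (-1) ^+ (#|` modd t1| * #|` modd t2|) *: act t2 (act t1 v).
Proof.
by rewrite !actM scalerA (mono_mulC t2) (koszulC K t1 t2) mulrA -expr2 sqrr_sign mul1r.
Qed.

Lemma act1 v : act mono1 v = v.
Proof.
apply/funext => s; rewrite /act /mdiv msub0set fsub0set /= koszul_even // scale1r.
by congr (v _); apply: mono_eq; rewrite /= ?subr0 ?msetB0 ?fsetD0.
Qed.

End Act.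

Section Linear.
Variables (K : numFieldType) (V W : lmodType K).

Definition lin (O : (monomial -> V) -> monomial -> W) : Prop :=
  forall c u v, O (c *: u + v) = c *: O u + O v.

Variable O : (monomial -> V) -> monomial -> W.
Hypothesis linO : lin O.

Lemma lin0 : O 0 = 0.
Proof. by have := linO (-1) 0 0; rewrite scaler0 addr0 scaleN1r addNr. Qed.
Lemma linZ c u : O (c *: u) = c *: O u.
Proof. by rewrite -[c *: u]addr0 linO lin0 addr0. Qed.
Lemma linD u v : O (u + v) = O u + O v.
Proof. by rewrite -[u]scale1r linO !scale1r. Qed.
Lemma linN u : O (- u) = - O u.
Proof. by rewrite -!scaleN1r linZ. Qed.
Lemma linB u v : O (u - v) = O u - O v.
Proof. by rewrite linD linN. Qed.
Lemma lin_sum I r (P : pred I) (F : I -> monomial -> V) :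
  O (\sum_(i <- r | P i) F i) = \sum_(i <- r | P i) O (F i).
Proof.
elim: r => [|a r IH]; rewrite ?big_nil ?lin0 // !big_cons.
by case: ifP => // _; rewrite linD IH.
Qed.
End Linear.

Section Order.
Variables (K : numFieldType) (V : lmodType K).

Definition ord (n : nat) (v : monomial -> V) : Prop :=
  forall s, (sdeg s < n)%N -> v s = 0.

Lemma ord_le m n v : (m <= n)%N -> ord n v -> ord m v.
Proof. by move=> mn ov s sm; apply: ov; apply: leq_trans sm mn. Qed.
Lemma ord0 v : ord 0 v. Proof. by []. Qed.
Lemma ordD n u v : ord n u -> ord n v -> ord n (u + v).
Proof. by move=> ou ov s sn; rewrite fDE ou ?ov ?addr0. Qed.
Lemma ordZ n c u : ord n u -> ord n (c *: u).
Proof. by move=> ou s sn; rewrite fZE ou ?scaler0. Qed.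
Lemma ordN n u : ord n u -> ord n (- u).
Proof. by move=> ou s sn; rewrite fNE ou ?oppr0. Qed.
Lemma ordB n u v : ord n u -> ord n v -> ord n (u - v).
Proof. by move=> ou /ordN; apply: ordD. Qed.
Lemma ord_agree n u v s : ord n (u - v) -> (sdeg s < n)%N -> u s = v s.
Proof. by move=> o /o; rewrite fBE => /eqP; rewrite subr_eq0 => /eqP. Qed.
Lemma ord_eq0 v : (forall n, ord n v) -> v = 0.
Proof. by move=> ov; apply/funext => s; apply: (ov (sdeg s).+1). Qed.
End Order.

Section Raises.
Variables (K : numFieldType) (U V W : lmodType K).

Definition raises (k : nat) (O : (monomial -> V) -> monomial -> W) : Prop :=
  lin O /\ forall n v, ord n v -> ord (k + n) (O v).

Lemma raises_lin k O : raises k O -> lin O. Proof. by case. Qed.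

Lemma raisesD k O O' : raises k O -> raises k O' -> raises k (fun v => O v + O' v).
Proof.
move=> [l r] [l' r']; split=> [c u v|n v ov]; last by apply: ordD; [exact: r|exact: r'].
by rewrite l l' scalerDr addrACA.
Qed.

Lemma raisesN k O : raises k O -> raises k (fun v => - O v).
Proof.
move=> [l r]; split=> [c u v|n v ov]; last by apply: ordN; exact: r.
by rewrite l opprD scalerN.
Qed.

Lemma raisesB k O O' : raises k O -> raises k O' -> raises k (fun v => O v - O' v).
Proof. by move=> rO /raisesN; apply: raisesD. Qed.

Lemma raises_eq k O u v s : raises k O -> ord (sdeg s).+1 (u - v) -> O u s = O v s.
Proof.
move=> [l r] /r /(_ s (ltn_addl _ (ltnSn _))); rewrite (linB l) fBE => /eqP.
by rewrite subr_eq0 => /eqP.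
Qed.

End Raises.

Lemma raises_comp (K : numFieldType) (U V W : lmodType K) j k
    (O : (monomial -> V) -> monomial -> W) (O' : (monomial -> U) -> monomial -> V) :
  raises j O -> raises k O' -> raises (j + k) (fun v => O (O' v)).
Proof.
move=> [l r] [l' r']; split=> [c u v|n v ov]; first by rewrite l' l.
by rewrite -addnA; apply/r/r'.
Qed.

Lemma raises_idfun (K : numFieldType) (V : lmodType K) :
  raises 0 (fun v : monomial -> V => v).
Proof. by split. Qed.

Lemma sum_triangle (V : nmodType) (F : nat -> nat -> V) N :
  \sum_(n < N) \sum_(i < n.+1) F i (n - i)%N = \sum_(i < N) \sum_(m < N - i) F i m.
Proof.
elim: N => [|N IH]; first by rewrite !big_ord0.
rewrite big_ord_recr /= IH [in RHS]big_ord_recr /= subSnn big_ord1.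
rewrite [in LHS]big_ord_recr /= subnn addrA; congr (_ + _).
rewrite -big_split /=; apply: eq_bigr => i _.
by rewrite subSn ?big_ord_recr //= ltnW.
Qed.

Lemma sum_pascal (K : numFieldType) (V : lmodType K) (f : nat -> V) n :
  \sum_(i < n.+1) 'C(n, i)%:R *: f i.+1 + \sum_(i < n.+1) 'C(n, i)%:R *: f i
  = \sum_(i < n.+2) 'C(n.+1, i)%:R *: f i.
Proof.
have -> : \sum_(i < n.+1) 'C(n, i)%:R *: f i = \sum_(i < n.+2) 'C(n, i)%:R *: f i.
  by rewrite [RHS]big_ord_recr /= bin_small ?ltnSn // scale0r addr0.
rewrite [in RHS]big_ord_recl [X in _ + X]big_ord_recl !bin0 addrCA; congr (_ + _).
by rewrite -big_split; apply: eq_bigr => i _; rewrite lift0 binS natrD scalerDl addrC.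
Qed.

(** * Exponentials of operators raising the degree *)

Section Exponential.
Variables (K : numFieldType) (V : lmodType K).
Implicit Types (Y a : (monomial -> V) -> monomial -> V) (v : monomial -> V).

(* For [Y] raising degrees, the terms n > sdeg s of e^Y v vanish at s. *)
Definition Exp Y v : monomial -> V := fun s =>
  \sum_(n < (sdeg s).+1) (n`!%:R)^-1 *: iter n Y v s.

Definition ExpN N Y v : monomial -> V :=
  \sum_(n < N.+1) (n`!%:R)^-1 *: iter n Y v.

Lemma raises_iter n k Y : raises k Y -> raises (n * k) (iter n Y).
Proof. by move=> rY; elim: n => [|n IH]; [exact: raises_idfun|apply: raises_comp]. Qed.

Lemma iter_ord n Y v : raises 1 Y -> ord n (iter n Y v).
Proof. by move=> /(raises_iter n)[_ /(_ 0%N v (ord0 _))]; rewrite muln1 addn0. Qed.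

Lemma ExpE N Y v s : raises 1 Y -> (sdeg s <= N)%N ->
  Exp Y v s = \sum_(n < N.+1) (n`!%:R)^-1 *: iter n Y v s.
Proof.
move=> rY sN; rewrite /Exp.
rewrite (big_ord_widen N.+1 (fun n => (n`!%:R)^-1 *: iter n Y v s)) // big_mkcond.
apply: eq_bigr => i _; case: ltnP => // si.
by rewrite (iter_ord v rY) ?scaler0.
Qed.

Lemma ExpNE N Y v s : raises 1 Y -> (sdeg s <= N)%N -> Exp Y v s = ExpN N Y v s.
Proof. by move=> rY sN; rewrite (ExpE v rY sN) /ExpN fsumE. Qed.

Lemma Exp_ExpN N Y v : raises 1 Y -> ord N.+1 (Exp Y v - ExpN N Y v).
Proof. by move=> rY s sN; rewrite fBE (ExpNE _ rY sN) subrr. Qed.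

Lemma Exp_raises Y : raises 1 Y -> raises 0 (Exp Y).
Proof.
move=> rY; have ri n := raises_iter n rY; split=> [c u v|n v ov].
  apply/funext => s; rewrite fDE fZE /Exp scaler_sumr -big_split /=.
  apply: eq_bigr => n _; have [l _] := ri n.
  by rewrite l fDE fZE scalerDr !scalerA mulrC.
move=> s sn; rewrite /Exp big1 // => i _; have [_ r] := ri i.
by rewrite (r n) ?scaler0 //; apply: leq_trans sn _; rewrite leq_addl.
Qed.

Lemma Exp_raises1 Y : raises 1 Y -> raises 1 (fun v => Exp Y v - v).
Proof.
move=> rY; split=> [|n v ov s sn].
  by case: (raisesB (Exp_raises rY) (raises_idfun V)).
rewrite fBE /Exp big_ord_recl fact0 invr1 scale1r [LHS]addrC addKr.
rewrite big1 // => i _; have [_ r] := raises_iter (bump 0 i) rY.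
rewrite (r n _ ov) ?scaler0 //.
by rewrite muln1; apply: leq_trans sn _; rewrite leq_add2r.
Qed.

Lemma iter_oppE n Y v : lin Y -> iter n (fun v => - Y v) v = (-1) ^+ n *: iter n Y v.
Proof.
move=> lY; elim: n => [|n IH] /=; first by rewrite scale1r.
by rewrite IH (linZ lY) exprS -scalerA scaleN1r.
Qed.

(** Collecting the terms with k iterations of Y gives the coefficient (1 - 1)^k / k!. *)
Lemma Exp_oppK Y v : raises 1 Y -> Exp Y (Exp (fun v => - Y v) v) = v.
Proof.
move=> rY; have lY := raises_lin rY; apply/funext => s; set N := sdeg s.
have rN := raisesN rY.
have -> : Exp Y (Exp (fun v => - Y v) v) s = Exp Y (ExpN N (fun v => - Y v) v) s.
  by apply: (raises_eq (Exp_raises rY)); exact: Exp_ExpN.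
pose F n m : V := ((n`!%:R)^-1 * (m`!%:R)^-1 * (-1) ^+ m) *: iter (n + m) Y v s.
have -> : Exp Y (ExpN N (fun v => - Y v) v) s =
    \sum_(n < N.+1) \sum_(m < N.+1) F n m.
  apply: eq_bigr => n _; have [l _] := raises_iter n rY.
  rewrite /ExpN (lin_sum l) fsumE scaler_sumr; apply: eq_bigr => m _.
  by rewrite (linZ l) fZE iter_oppE // (linZ l) fZE !scalerA /F iterD mulrA.
(* More than N iterations raise the degree beyond that of s, so the square of indices can be cut
   down to a triangle. *)
have -> : \sum_(n < N.+1) \sum_(m < N.+1) F n m =
    \sum_(n < N.+1) \sum_(m < N.+1 - n) F n m.
  apply: eq_bigr => n _.
  rewrite [RHS](big_ord_widen N.+1 (F n)) ?leq_subr // [RHS]big_mkcond /=.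
  apply: eq_bigr => m _; case: ltnP => // nm.
  by rewrite /F (iter_ord v rY) ?scaler0 //; rewrite -/N; lia.
rewrite -sum_triangle big_ord_recl big_ord1 big1 ?addr0 => [|k _].
  by rewrite /F /= !fact0 invr1 !mul1r scale1r.
rewrite lift0; transitivity (((k.+1)`!%:R^-1 * (1 + -1) ^+ k.+1) *: iter k.+1 Y v s); last first.
  by rewrite subrr expr0n mulr0 scale0r.
rewrite addrC exprDn mulr_sumr scaler_suml; apply: eq_bigr => i _.
rewrite /F subnKC ?leq_ord //; congr (_ *: _).
have ik : (i <= k.+1)%N by rewrite -ltnS.
have h n : n`!%:R != 0 :> K by rewrite pnatr_eq0 -lt0n fact_gt0.
rewrite expr1n mulr1 -(bin_fact ik) !natrM -mulr_natr; field.
by rewrite !h /= pnatr_eq0 -lt0n bin_gt0.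
Qed.

Definition adop Y a v : monomial -> V := Y (a v) - a (Y v).

Lemma adop_raises k Y a : raises 1 Y -> raises k a -> raises k.+1 (adop Y a).
Proof.
move=> rY ra; apply: raisesB; first by rewrite -add1n; exact: raises_comp.
by rewrite -addn1; exact: raises_comp.
Qed.

Lemma iter_adop_raises i Y a : raises 1 Y -> raises 0 a -> raises i (iter i (adop Y) a).
Proof. by move=> rY ra; elim: i => //= i IH; exact: adop_raises. Qed.

(** The Leibniz rule for the powers of Y, by induction with Pascal's rule. *)
Lemma iter_adop n Y a v : raises 1 Y -> raises 0 a ->
  iter n Y (a v) = \sum_(i < n.+1) 'C(n, i)%:R *: iter i (adop Y) a (iter (n - i) Y v).
Proof.
move=> rY ra; have lY := raises_lin rY; elim: n => [|n IH].
  by rewrite big_ord1 /= bin0 scale1r.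
rewrite iterS IH (lin_sum lY).
have E (i : 'I_n.+1) : Y ('C(n, i)%:R *: iter i (adop Y) a (iter (n - i) Y v)) =
   'C(n, i)%:R *: iter i.+1 (adop Y) a (iter (n - i) Y v)
   + 'C(n, i)%:R *: iter i (adop Y) a (iter (n.+1 - i) Y v).
  rewrite (linZ lY) -scalerDr; congr (_ *: _).
  by rewrite iterS /adop subSn ?iterS ?subrK // -ltnS.
rewrite (eq_bigr _ (fun i _ => E i)) big_split /=.
by rewrite -(sum_pascal (fun i => iter i (adop Y) a (iter (n.+1 - i) Y v))).
Qed.

(** Hadamard's formula e^Y a = e^{ad Y}(a) e^Y, read at one monomial: divide the Leibniz rule by n!
    and reorder. *)
Lemma Exp_conj Y a v s : raises 1 Y -> raises 0 a ->
  Exp Y (a v) s =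
  \sum_(i < (sdeg s).+1) (i`!%:R)^-1 *: iter i (adop Y) a (Exp Y v) s.
Proof.
move=> rY ra; set N := sdeg s.
pose F i m : V := ((i`!%:R)^-1 * (m`!%:R)^-1) *: iter i (adop Y) a (iter m Y v) s.
have -> : Exp Y (a v) s = \sum_(n < N.+1) \sum_(i < n.+1) F i (n - i)%N.
  apply: eq_bigr => n _; rewrite iter_adop // fsumE scaler_sumr.
  apply: eq_bigr => i _; rewrite fZE scalerA /F; congr (_ *: _).
  have ik : (i <= n)%N by rewrite -ltnS.
  have h m : m`!%:R != 0 :> K by rewrite pnatr_eq0 -lt0n fact_gt0.
  rewrite -(bin_fact ik) !natrM; field.
  by rewrite !h /= pnatr_eq0 -lt0n bin_gt0.
rewrite sum_triangle; apply: eq_bigr => i _.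
have rA := iter_adop_raises i rY ra.
have -> : iter i (adop Y) a (Exp Y v) s = iter i (adop Y) a (ExpN N Y v) s.
  by apply: (raises_eq rA); exact: Exp_ExpN.
have [l r] := rA; rewrite /ExpN (lin_sum l) fsumE scaler_sumr.
rewrite (big_ord_widen N.+1 (F i)) ?leq_subr // big_mkcond /=.
apply: eq_bigr => m _; rewrite (linZ l) fZE scalerA.
case: ltnP => // mi; rewrite (r m) ?scaler0 //; first exact: iter_ord.
by rewrite -/N; lia.
Qed.

End Exponential.

(** * Operators of weight 0 with series coefficients *)

Definition sim (s s' : monomial) : Prop :=
  meven s = meven s' /\ (modd s `\ None)%fset = (modd s' `\ None)%fset.

Lemma sim_D s s' : sim s s' -> D s = D s'.
Proof. by case; exact: eq_D. Qed.
Lemma sim_sdeg s s' : sim s s' -> sdeg s = sdeg s'.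
Proof. by rewrite /sdeg => -[-> ->]. Qed.

Section Op.
Variables (K : numFieldType) (V : lmodType K) (sg : {linear V -> V}).
Local Notation M := (monomial -> V).
Local Notation act := (act sg).

Lemma signb_odd (m n : nat) : (-1) ^+ (m * n) = (-1) ^+ (odd m && odd n) :> K.
Proof. by rewrite -signr_odd oddM. Qed.

(** A form of continuity satisfied by the L_j and G_j, which change only the powers of x and phi.
    Similar monomials have the same normalized divisors and the same degree, so such operators
    respect the filtration and can be applied under the sums over [D]. *)
Definition simlocal (O : M -> M) : Prop :=
  forall s, exists S : seq monomial,
    (forall s', s' \in S -> sim s' s) /\
    forall u, (forall s', s' \in S -> u s' = 0) -> O u s = 0.

Lemma simlocal_eq O u v s : lin O -> simlocal O ->
  (forall s', sim s' s -> u s' = v s') -> O u s = O v s.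
Proof.
move=> l /(_ s)[S [sS S0]] uv; apply/eqP; rewrite -subr_eq0 -fBE -(linB l); apply/eqP.
by apply: S0 => s' /sS /uv; rewrite fBE => ->; rewrite subrr.
Qed.

Lemma simlocal_ord O n v : simlocal O -> ord n v -> ord n (O v).
Proof.
move=> lO ov s sn; have [S [sS S0]] := lO s; apply: S0 => s' /sS /sim_sdeg h.
by apply: ov; rewrite h.
Qed.

Section Family.
Variable U : lmodType K.

(* [E k p] is a homogeneous operator, of parity that of [k] shifted by [e],
   with coefficients [p]. *)
Record family (e : bool) (E : int -> U -> M -> M) : Prop := Family {
  fam_lin : forall k p, lin (E k p);
  fam_coef : forall k v c p q, E k (c *: p + q) v = c *: E k p v + E k q v;
  fam_local : forall k p, simlocal (E k p);
  fam_act : forall k p t v, isS t ->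
    E k p (act t v) = (-1) ^+ ((oddz k (+) e) && oddz (wt t)) *: act t (E k p v) }.

(** The sum over t of t E_{wt t}(x t). The weight of t selects the operator, so that one function x
    encodes all even and odd terms of an element of weight 0. *)
Definition Op (E : int -> U -> M -> M) (x : monomial -> U) (v : M) : M := fun s =>
  \sum_(t <- D s) act t (E (wt t) (x t) v) s.

Variables (e : bool) (E : int -> U -> M -> M).
Hypothesis EP : family e E.

Lemma fam_coef0 k v : E k 0 v = 0.
Proof. by have := fam_coef EP k v (-1) 0 0; rewrite scaler0 addr0 scaleN1r addNr. Qed.

Lemma Op_lin x : lin (Op E x).
Proof.
move=> c u v; apply/funext => s; rewrite fDE fZE /Op scaler_sumr -big_split /=.
by apply: eq_bigr => t _; rewrite (fam_lin EP) act_lin.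
Qed.

Lemma Op_coef c x y v : Op E (c *: x + y) v = c *: Op E x v + Op E y v.
Proof.
apply/funext => s; rewrite fDE fZE /Op scaler_sumr -big_split /=.
by apply: eq_bigr => t _; rewrite fDE fZE (fam_coef EP) act_lin.
Qed.

Lemma Op_coef0 v : Op E 0 v = 0.
Proof. by have := Op_coef (-1) 0 0 v; rewrite scaler0 addr0 scaleN1r addNr. Qed.
Lemma Op_coefZ c x v : Op E (c *: x) v = c *: Op E x v.
Proof. by rewrite -[c *: x]addr0 Op_coef Op_coef0 addr0. Qed.
Lemma Op_coefD x y v : Op E (x + y) v = Op E x v + Op E y v.
Proof. by rewrite -[x]scale1r Op_coef !scale1r. Qed.
Lemma Op_coefN x v : Op E (- x) v = - Op E x v.
Proof. by rewrite -!scaleN1r Op_coefZ. Qed.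
Lemma Op_coefB x y v : Op E (x - y) v = Op E x v - Op E y v.
Proof. by rewrite Op_coefD Op_coefN. Qed.

Lemma Op_coef_eq x y v s : (forall t, t \in D s -> x t = y t) -> Op E x v s = Op E y v s.
Proof.
by move=> xy; rewrite /Op big_seq [RHS]big_seq; apply: eq_bigr => t /xy ->.
Qed.

Lemma sdeg_sub t s : mdiv t s -> sdeg s = (sdeg t + sdeg (msub s t))%N.
Proof. by case/mdivP=> e1 d; rewrite -[in LHS]e1 sdegM. Qed.

Lemma D_sdeg t s : t \in D s -> (sdeg t <= sdeg s)%N.
Proof. by move=> /D_mdiv /sdeg_sub ->; rewrite leq_addr. Qed.

Lemma act_ord k n t v : (k <= sdeg t)%N -> ord n v -> ord (k + n) (act t v).
Proof.
move=> kt ov s sn; rewrite /act; case: ifP => // ts; rewrite ov ?sgi0 ?scaler0 //.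
by rewrite (sdeg_sub ts) in sn; lia.
Qed.

Lemma Op_raises k x : ord k x -> raises k (Op E x).
Proof.
move=> ox; split=> [|n v ov s sn]; first exact: Op_lin.
rewrite /Op big1 // => t _; have [tk|kt] := ltnP (sdeg t) k.
  by rewrite ox // fam_coef0 act0.
by apply: (act_ord kt _ sn); apply: simlocal_ord ov; exact: (fam_local EP).
Qed.

Lemma Op_sim x v s s' : sim s' s ->
  Op E x v s' = (\sum_(t <- D s) act t (E (wt t) (x t) v)) s'.
Proof. by move=> h; rewrite fsumE /Op (sim_D h). Qed.

End Family.

(** The product grouped by t = t1 t2. One sign orders the variables of t1 t2, the other one moves t2
    to the left past E. *)
Lemma Op_Op (U W : lmodType K) e f (E : int -> U -> M -> M) (F : int -> W -> M -> M)
    (EP : family e E) (FP : family f F) x y v s :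
  Op E x (Op F y v) s =
  \sum_(t <- D s) \sum_(t1 <- D t)
    (koszul K t1 (msub t t1)
     * (-1) ^+ ((oddz (wt t1) (+) e) && oddz (wt (msub t t1)))) *:
    act t (E (wt t1) (x t1) (F (wt (msub t t1)) (y (msub t t1)) v)) s.
Proof.
rewrite /Op big_seq.
under eq_bigr => t1 t1s.
  have -> : act t1 (E (wt t1) (x t1) (Op F y v)) s =
      \sum_(t2 <- D (msub s t1)) (koszul K t1 t2
         * (-1) ^+ ((oddz (wt t1) (+) e) && oddz (wt t2))) *:
        act (mono_mul t1 t2) (E (wt t1) (x t1) (F (wt t2) (y t2) v)) s.
    (* E only looks at monomials similar to the quotient by t1, and on these [Op F y v] is one and
       the same finite sum. *)
    rewrite (@act_ext _ _ _ _ _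
      (E (wt t1) (x t1) (\sum_(t2 <- D (msub s t1)) act t2 (F (wt t2) (y t2) v)))).
      rewrite (lin_sum (fam_lin EP _ _)) act_sum fsumE big_seq [RHS]big_seq.
      apply: eq_bigr => t2 t2s; rewrite (fam_act EP) ?isT_S ?(D_isT t2s) //.
      by rewrite actZ actM !fZE scalerA mulrC.
    move=> _; apply: simlocal_eq; [exact: (fam_lin EP)|exact: (fam_local EP)|].
    by move=> s' ss'; rewrite (Op_sim F _ _ ss').
  over.
rewrite -big_seq (sum_D_assoc s (fun t1 t2 => (koszul K t1 t2
  * (-1) ^+ ((oddz (wt t1) (+) e) && oddz (wt t2))) *:
  act (mono_mul t1 t2) (E (wt t1) (x t1) (F (wt t2) (y t2) v)) s)).
apply: eq_bigr => t _; rewrite big_seq [RHS]big_seq; apply: eq_bigr => t1 t1t.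
by case: (mdivP (D_mdiv t1t)) => ->.
Qed.

Section Bracket.
Variables (U W W' : lmodType K) (f : bool).
Variables (E : int -> U -> M -> M) (F : int -> W -> M -> M) (H : int -> W' -> M -> M).
Variable B : int -> int -> U -> W -> W'.
Hypotheses (EP : family false E) (FP : family f F) (HP : family f H).
Hypothesis commEF : forall k l p q v,
  E k p (F l q v) =
  (-1) ^+ (oddz k && (oddz l (+) f)) *: F l q (E k p v) + H (k + l) (B k l p q) v.

Definition brk (x : monomial -> U) (y : monomial -> W) : monomial -> W' := fun t =>
  \sum_(t1 <- D t) (koszul K t1 (msub t t1)
    * (-1) ^+ (oddz (wt t1) && oddz (wt (msub t t1)))) *:
    B (wt t1) (wt (msub t t1)) (x t1) (y (msub t t1)).

(** Each E_k comes with variables of its own parity, so [Op E x] is even and its superbracket with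
    [Op F y] is an ordinary commutator. The signs in [brk] arise as in the product formula
    [Op_Op]. *)
Lemma Op_comm x y v : Op E x (Op F y v) = Op F y (Op E x v) + Op H (brk x y) v.
Proof.
apply/funext => s; rewrite fDE (Op_Op EP FP) (Op_Op FP EP) /(Op H) -big_split /=.
rewrite big_seq [RHS]big_seq; apply: eq_bigr => t ts; have Tt := D_isT ts.
have -> : act t (H (wt t) (brk x y t) v) s =
    \sum_(t1 <- D t) (koszul K t1 (msub t t1)
      * (-1) ^+ (oddz (wt t1) && oddz (wt (msub t t1)))) *:
      act t (H (wt t) (B (wt t1) (wt (msub t t1)) (x t1) (y (msub t t1))) v) s.
  have -> : H (wt t) (brk x y t) v = \sum_(t1 <- D t) (koszul K t1 (msub t t1)
      * (-1) ^+ (oddz (wt t1) && oddz (wt (msub t t1)))) *: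
      H (wt t) (B (wt t1) (wt (msub t t1)) (x t1) (y (msub t t1))) v.
    rewrite /brk; elim: (D t) => [|a r IH]; first by rewrite !big_nil (fam_coef0 HP).
    by rewrite !big_cons (fam_coef HP) IH.
  by rewrite act_sum fsumE; apply: eq_bigr => t1 _; rewrite actZ fZE.
rewrite [X in _ = X + _](sum_D_sym (fun t1 t2 => (koszul K t1 t2
  * (-1) ^+ ((oddz (wt t1) (+) f) && oddz (wt t2))) *:
  act t (F (wt t1) (y t1) (E (wt t2) (x t2) v)) s)) //.
rewrite -big_split /= big_seq [RHS]big_seq; apply: eq_bigr => t1 t1t.
have [tE d] := mdivP (D_mdiv t1t); have T1 := D_isT t1t.
have T2 : isT (msub t t1) by rewrite isT_sub ?(D_mdiv t1t).
rewrite commEF actD actZ fDE fZE scalerDr scalerA addbF -wtM // tE.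
congr (_ *: _ + _); rewrite (koszulC K t1) signb_odd -!oddz_wt ?isT_S //.
by case: (oddz (wt t1)); case: (oddz (wt _)); case: f; rewrite /= ?expr0 ?expr1; ring.
Qed.

Hypothesis Blin : forall k l p c q q', B k l p (c *: q + q') = c *: B k l p q + B k l p q'.
Hypothesis B0 : forall k l q, B k l 0 q = 0.

Lemma brk_raises k x : ord k x -> raises k (brk x).
Proof.
move=> ox; split=> [c y z|n y oy t tn].
  apply/funext => t; rewrite fDE fZE /brk scaler_sumr -big_split /=.
  by apply: eq_bigr => t1 _; rewrite fDE fZE Blin scalerDr !scalerA mulrC.
have B0r k' l p : B k' l p 0 = 0.
  by have := Blin k' l p (-1) 0 0; rewrite scaler0 addr0 scaleN1r addNr.
rewrite /brk big1_seq // => t1 /andP[_ t1t].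
have [h|h] := ltnP (sdeg t1) k; first by rewrite ox // B0 scaler0.
rewrite oy ?B0r ?scaler0 //.
by have := sdeg_sub (D_mdiv t1t); lia.
Qed.

End Bracket.

Section ExpOp.
Variables (U W : lmodType K) (f : bool).
Variables (E : int -> U -> M -> M) (F : int -> W -> M -> M).
Variable B : int -> int -> U -> W -> W.
Hypotheses (EP : family false E) (FP : family f F).
Hypothesis commEF : forall k l p q v,
  E k p (F l q v) =
  (-1) ^+ (oddz k && (oddz l (+) f)) *: F l q (E k p v) + F (k + l) (B k l p q) v.
Hypothesis Blin : forall k l p c q q', B k l p (c *: q + q') = c *: B k l p q + B k l p q'.
Hypothesis B0 : forall k l q, B k l 0 q = 0.

Lemma iter_adop_Op i x y :
  iter i (adop (Op E x)) (Op F y) = Op F (iter i (brk B x) y).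
Proof.
elim: i => //= i ->; apply/funext => v.
by rewrite /adop (Op_comm EP FP FP commEF) addrC addKr.
Qed.

(** Hadamard's formula with e^{ad X}(Y) computed on coefficients: the data [Exp (brk B x) y] do not
    depend on the space on which the operators act. *)
Lemma Exp_Op x y v : ord 1 x ->
  Exp (Op E x) (Op F y v) = Op F (Exp (brk B x) y) (Exp (Op E x) v).
Proof.
move=> ox; have rE := Op_raises EP ox; have rB := brk_raises Blin B0 ox.
apply/funext => s; rewrite Exp_conj //; last by apply: (Op_raises FP); exact: ord0.
under eq_bigr => i _ do rewrite iter_adop_Op -fZE -(Op_coefZ FP).
have -> : Op F (Exp (brk B x) y) (Exp (Op E x) v) s =
    Op F (\sum_(i < (sdeg s).+1) (i`!%:R)^-1 *: iter i (brk B x) y) (Exp (Op E x) v) s.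
  by apply: Op_coef_eq => t /D_sdeg ts; rewrite (ExpNE _ rB ts).
elim: (index_enum _) => [|a r IH]; first by rewrite !big_nil (Op_coef0 FP).
by rewrite !big_cons (Op_coefD FP) fDE IH.
Qed.

End ExpOp.

(** The Euler derivation for the degree in A, B, M, N. *)
Definition Theta (U : lmodType K) (v : monomial -> U) : monomial -> U := fun s =>
  (sdeg s)%:R *: v s.

Lemma Theta_raises (U : lmodType K) : raises 0 (@Theta U).
Proof.
split=> [c u v|n v ov s sn]; last by rewrite /Theta ov ?scaler0.
by apply/funext => s; rewrite /Theta !(fDE, fZE) scalerDr !scalerA mulrC.
Qed.

Section ThetaOp.
Variables (U : lmodType K) (E : int -> U -> M -> M).
Hypothesis EP : family false E.

Lemma Theta_Op x v : Theta (Op E x v) = Op E (Theta x) v + Op E x (Theta v).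
Proof.
apply/funext => s; rewrite fDE /Theta /Op scaler_sumr -big_split /=.
rewrite big_seq [RHS]big_seq; apply: eq_bigr => t ts.
have tds := D_mdiv ts; rewrite (sdeg_sub tds) natrD scalerDl; congr (_ + _).
  rewrite -[_ *: x t]addr0 (fam_coef EP) (fam_coef0 EP) addr0.
  by rewrite actZ fZE.
rewrite -fZE -actZ -(linZ (fam_lin EP _ _)).
apply: act_ext => _; apply: simlocal_eq; [exact: (fam_lin EP)|exact: (fam_local EP)|].
by move=> s' /sim_sdeg h; rewrite fZE h.
Qed.

Variable B : int -> int -> U -> U -> U.
Hypothesis commE : forall k l p q v,
  E k p (E l q v) =
  (-1) ^+ (oddz k && oddz l) *: E l q (E k p v) + E (k + l) (B k l p q) v.
Hypothesis Blin : forall k l p c q q', B k l p (c *: q + q') = c *: B k l p q + B k l p q'.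
Hypothesis B0 : forall k l q, B k l 0 q = 0.

(* The logarithmic derivative of e^x with respect to [Theta]. *)
Definition eta (x : monomial -> U) : monomial -> U := fun t =>
  \sum_(i < sdeg t) (i.+1`!%:R)^-1 *: iter i (brk B x) (Theta x) t.

Lemma Theta_ord1 (x : monomial -> U) : ord 1 (Theta x).
Proof. by move=> s; rewrite ltnS leqn0 /Theta => /eqP ->; rewrite scale0r. Qed.

(** Since [X, Theta] = - Theta(X), Hadamard's formula for Theta reads Theta minus the sum of ad(X)^i
    (Theta X) / (i+1)!. The terms with i at least the degree of t vanish at t, as Theta X has no
    part of degree 0. *)
Lemma Exp_Theta x v : ord 1 x ->
  Exp (Op E x) (Theta v) = Theta (Exp (Op E x) v) - Op E (eta x) (Exp (Op E x) v).
Proof.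
move=> ox; have rE := Op_raises EP ox; have rB := brk_raises Blin B0 ox.
have commE' k l p q w : E k p (E l q w) =
  (-1) ^+ (oddz k && (oddz l (+) false)) *: E l q (E k p w) + E (k + l) (B k l p q) w.
  by rewrite addbF.
apply/funext => s; rewrite Exp_conj //; last exact: Theta_raises.
rewrite big_ord_recl fact0 invr1 scale1r fBE; congr (_ + _).
have ad : adop (Op E x) (@Theta V) = Op E (- Theta x).
  apply/funext => w; rewrite /adop Theta_Op (Op_coefN EP).
  by rewrite opprD addrCA addrN addr0.
have [lT _] := Theta_raises U.
have h i : i.+1`!%:R^-1 *: iter i.+1 (adop (Op E x)) (@Theta V) (Exp (Op E x) v) s =
    - Op E (i.+1`!%:R^-1 *: iter i (brk B x) (Theta x)) (Exp (Op E x) v) s.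
  rewrite iterSr ad (iter_adop_Op EP EP commE').
  have [l _] := raises_iter i rB; rewrite (linN l) (Op_coefN EP) fNE scalerN.
  by rewrite (Op_coefZ EP) fZE.
under eq_bigr => i _ do rewrite lift0 h.
rewrite sumrN; congr (- _).
have -> : Op E (eta x) (Exp (Op E x) v) s =
    Op E (\sum_(i < sdeg s) (i.+1`!%:R)^-1 *: iter i (brk B x) (Theta x))
      (Exp (Op E x) v) s.
  apply: Op_coef_eq => t /D_sdeg ts; rewrite /eta fsumE.
  rewrite (big_ord_widen (sdeg s)
    (fun i => (i.+1`!%:R)^-1 *: iter i (brk B x) (Theta x) t)) // big_mkcond /=.
  apply: eq_bigr => i _; case: ltnP => // ti; rewrite fZE.
  have [_ r] := raises_iter i rB; rewrite (r 1%N) ?scaler0 //; first exact: Theta_ord1.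
  by rewrite muln1 addn1 ltnS.
elim: (index_enum _) => [|a r IH]; first by rewrite !big_nil (Op_coef0 EP).
by rewrite !big_cons (Op_coefD EP) fDE IH.
Qed.

End ThetaOp.

End Op.

(** * Unipotent operators *)

Section Unipotent.
Variables (K : numFieldType) (V : lmodType K).
Local Notation M := (monomial -> V).

Definition unip (O : M -> M) : Prop := raises 0 O /\ raises 1 (fun v => O v - v).

Lemma unip_comp O O' : unip O -> unip O' -> unip (fun v => O (O' v)).
Proof.
move=> [r0 r1] [r0' r1']; split; first exact: (raises_comp r0 r0').
have -> : (fun v => O (O' v) - v) = (fun v => (O (O' v) - O' v) + (O' v - v)).
  by apply/funext => v; rewrite addrA subrK.
by apply: raisesD => //; exact: (raises_comp r1 r0').
Qed.

Lemma Exp_unip Y : raises 1 Y -> unip (Exp Y).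
Proof. by move=> rY; split; [exact: Exp_raises|exact: Exp_raises1]. Qed.

Lemma Exp_commute Y (a : M -> M) v : raises 1 Y -> raises 0 a ->
  (forall w, Y (a w) = a (Y w)) -> Exp Y (a v) = a (Exp Y v).
Proof.
move=> rY ra Ya; apply/funext => s; rewrite Exp_conj // big_ord_recl fact0 invr1 scale1r.
have a0 : adop Y a = fun=> 0 by apply/funext => w; rewrite /adop Ya subrr.
rewrite big1 ?addr0 // => i _; rewrite lift0 iterSr a0.
have -> : iter i (adop Y) (fun=> 0) = fun=> 0.
  elim: (i : nat) => //= j ->; apply/funext => w; rewrite /adop subr0.
  by rewrite (lin0 (raises_lin rY)).
by rewrite scaler0.
Qed.

(** O - 1 commutes with Theta and hence preserves the degree, while unipotency makes it raise the
    degree. So it kills every homogeneous part, and by continuity every series. *)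
Lemma unip_Theta O v : unip O -> (forall w, O (Theta w) = Theta (O w)) -> O v = v.
Proof.
move=> [_ rR] OT; set R := fun v => O v - v in rR; have lR := raises_lin rR.
suff: R v = 0 by rewrite /R => /eqP; rewrite subr_eq0 => /eqP.
have RT w : R (Theta w) = Theta (R w).
  by rewrite /R OT (linB (raises_lin (Theta_raises V))).
pose part m : M := fun s => if sdeg s == m then v s else 0.
have Rpart m : R (part m) = 0.
  have om : ord m (part m) by move=> s sm; rewrite /part ltn_eqF.
  have [_ /(_ _ _ om) oR] := rR.
  have : Theta (R (part m)) = m%:R *: R (part m).
    rewrite -RT -(linZ lR); congr R; apply/funext => s; rewrite /Theta fZE /part.
    by case: eqP => [->|_]; rewrite ?scaler0.
  move=> TR; apply/funext => s; have [sm|ms] := leqP (sdeg s) m; first exact: oR.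
  move/(congr1 (fun w : M => w s)): TR; rewrite /Theta fZE => /eqP.
  rewrite -subr_eq0 -scalerBl scaler_eq0 => /orP[|/eqP //].
  by rewrite subr_eq0 eqr_nat gtn_eqF.
apply/funext => s; pose N := sdeg s.
have -> : R v s = R (\sum_(m < N.+1) part m) s.
  apply: (raises_eq rR) => s' s's; rewrite fBE fsumE.
  rewrite (bigD1 (Ordinal s's)) //= /part eqxx big1 ?addr0 ?subrr // => i.
  by rewrite -val_eqE /= eq_sym => /negbTE ->.
by rewrite (lin_sum lR) big1.
Qed.

End Unipotent.

(** * The Neveu-Schwarz algebra with series coefficients, and its modules *)

Section NS.
Variable K : numFieldType.

(* [x t] is the pair of the coefficients of t ell_{wt t} and of t d. *)
Definition nsU : lmodType K := (K^o * K^o)%type.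

(* Structure constants for ell (2 m) = L_m and ell (2 m + 1) = G_{m+1/2}. *)
Definition nsB (k l : int) : K :=
  if oddz k then if oddz l then 2 else k%:~R / 2 - l%:~R / 4
  else if oddz l then k%:~R / 4 - l%:~R / 2 else (k%:~R - l%:~R) / 2.
Definition nsD (k : int) : K :=
  if oddz k then (k%:~R ^+ 2 - 1) / 12 else (k%:~R ^+ 3 - 4 * k%:~R) / 96.
Definition nsbr (k l : int) (p q : nsU) : nsU :=
  (p.1 * q.1 * nsB k l : K^o, (if k + l == 0 then p.1 * q.1 * nsD k else 0) : K^o).

Lemma nsbr_lin k l p c q q' : nsbr k l p (c *: q + q') = c *: nsbr k l p q + nsbr k l p q'.
Proof.
rewrite /nsbr; congr pair; rewrite /= /GRing.scale /=; first by ring.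
by case: ifP => _; [ring|rewrite mulr0 addr0].
Qed.
Lemma nsbr_linl k l q c p p' : nsbr k l (c *: p + p') q = c *: nsbr k l p q + nsbr k l p' q.
Proof.
rewrite /nsbr; congr pair; rewrite /= /GRing.scale /=; first by ring.
by case: ifP => _; [ring|rewrite mulr0 addr0].
Qed.
Lemma nsbr_central k l p q : p.1 = 0 \/ q.1 = 0 -> nsbr k l p q = 0.
Proof.
by move=> [] h; rewrite /nsbr h ?(mul0r, mulr0) ?mul0r; case: ifP.
Qed.
Lemma nsbr0 k l q : nsbr k l 0 q = 0.
Proof. by apply: nsbr_central; left. Qed.

Lemma nsbrN k l p q : nsbr k l (- p) q = - nsbr k l p q.
Proof. by rewrite -[- p]addr0 -scaleN1r nsbr_linl nsbr0 addr0 scaleN1r. Qed.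

Definition ad (x y : monomial -> nsU) : monomial -> nsU := brk nsbr x y.
Definition nseta (x : monomial -> nsU) : monomial -> nsU := eta nsbr x.

Lemma ad_raises k x : ord k x -> raises k (ad x).
Proof. by move=> ox; apply: brk_raises ox; [exact: nsbr_lin|exact: nsbr0]. Qed.

Lemma adN x y : ad (- x) y = - ad x y.
Proof.
apply/funext => t; rewrite fNE /ad /brk -sumrN; apply: eq_bigr => t1 _.
by rewrite -scalerN fNE nsbrN.
Qed.

Lemma ad_central x y t : (forall u, isT u -> (y u).1 = 0) -> isT t -> ad x y t = 0.
Proof.
move=> yc Tt; rewrite /ad /brk big1_seq // => t1 /andP[_ t1t].
rewrite nsbr_central ?scaler0 //; right; apply: yc.
by rewrite isT_sub ?(D_mdiv t1t) ?(D_isT t1t).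
Qed.

Lemma ad_centralr x y : (forall u, (y u).1 = 0) -> ad x y = 0.
Proof.
move=> yc; apply/funext => t; rewrite /ad /brk big1 // => t1 _.
by rewrite nsbr_central ?scaler0 //; right.
Qed.

Lemma ad_centrall x y : (forall u, (x u).1 = 0) -> ad x y = 0.
Proof.
move=> xc; apply/funext => t; rewrite /ad /brk big1 // => t1 _.
by rewrite nsbr_central ?scaler0 //; left.
Qed.

Lemma nseta_ord1 x : ord 1 (nseta x).
Proof.
by move=> t; rewrite ltnS leqn0 /nseta /eta => /eqP ->; rewrite big_ord0.
Qed.

Section Module.
Variables (V : lmodType K) (sg : {linear V -> V}).
Local Notation M := (monomial -> V).
Local Notation act := (act sg).

(** A representation on series that supercommutes with the scalar variables. Nothing is asked for x
    and phi, which the vector fields differentiate. *)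
Record nsmodule (ell : int -> M -> M) (dd : M -> M) : Prop := NsModule {
  ell_lin : forall k, lin (ell k);
  ell_local : forall k, simlocal (ell k);
  ell_act : forall k t v, isS t ->
    ell k (act t v) = (-1) ^+ (oddz k && oddz (wt t)) *: act t (ell k v);
  dd_lin : lin dd;
  dd_local : simlocal dd;
  dd_act : forall t v, isS t -> dd (act t v) = act t (dd v);
  ell_comm : forall k l v, ell k (ell l v) =
    (-1) ^+ (oddz k && oddz l) *: ell l (ell k v) + nsB k l *: ell (k + l) v
    + (if k + l == 0 then nsD k else 0) *: dd v;
  dd_comm : forall k v, dd (ell k v) = ell k (dd v) }.

Variables (ell : int -> M -> M) (dd : M -> M).
Hypothesis EM : nsmodule ell dd.

Definition nsE (k : int) (p : nsU) (v : M) : M :=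
  p.1 *: ell k v + (if k == 0 then p.2 else 0) *: dd v.

Lemma nsE_family : family sg false nsE.
Proof.
split=> [k p c u v|k v c p q|k p s|k p t v Tt].
- rewrite /nsE (ell_lin EM) (dd_lin EM) !scalerDr !scalerA addrACA.
  by congr (_ + _ + (_ + _)); congr (_ *: _); rewrite mulrC.
- rewrite /nsE scalerDr !scalerA addrACA -!scalerDl.
  by case: ifP => // _; rewrite !mulr0 addr0.
- have [S [sS S0]] := ell_local EM k s; have [S' [sS' S0']] := dd_local EM s.
  exists (S ++ S'); split=> [s'|u uS]; first by rewrite mem_cat => /orP[/sS|/sS'].
  rewrite /nsE fDE !fZE S0 ?S0' ?scaler0 ?addr0 // => s' h; apply: uS;
    by rewrite mem_cat h ?orbT.
- rewrite /nsE (ell_act EM) // (dd_act EM) // actD !actZ addbF scalerDr !scalerA.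
  congr (_ *: _ + _); first by rewrite mulrC.
  by case: eqP => [->|_]; rewrite /= ?mul1r ?mulr0.
Qed.

Lemma nsE_comm k l p q v :
  nsE k p (nsE l q v) =
  (-1) ^+ (oddz k && (oddz l (+) false)) *: nsE l q (nsE k p v) + nsE (k + l) (nsbr k l p q) v.
Proof.
rewrite addbF /nsE !(linD (ell_lin EM _), linZ (ell_lin EM _)).
rewrite !(linD (dd_lin EM), linZ (dd_lin EM)) !(dd_comm EM) (ell_comm EM k l) /=.
set e := (-1) ^+ _; rewrite !scalerDr !scalerA.
set a := ell l (ell k v); set b := ell (k + l) v; set d := dd v; set dl := ell l d.
set dk := ell k d; set c := dd d.
(* The coefficients of d enter only in weight 0, where the sign e is trivial. *)
have sk : k = 0 -> e = 1 by move=> k0; rewrite /e k0.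
have sl : l = 0 -> e = 1 by move=> l0; rewrite /e l0 /oddz /= andbF.
set pk := if k == 0 then _ else _; set ql := if l == 0 then _ else _.
have E1 : e * (q.1 * pk) = pk * q.1 :> K.
  by rewrite /pk; case: eqP => [/sk ->|_]; [ring|rewrite mul0r !mulr0].
have E2 : e * (ql * p.1) = p.1 * ql :> K.
  by rewrite /ql; case: eqP => [/sl ->|_]; [ring|rewrite mul0r !mulr0].
have E3 : e * (ql * pk) = pk * ql :> K.
  by rewrite /pk; case: eqP => [/sk ->|_]; [ring|rewrite mul0r !mulr0].
rewrite [RHS](AC (2*2*2) ((1*5*6)*3*(2*4))) /= -!mulrA E1 E2 E3.
congr (_ *: _ + _ + _ *: _ + _ + _); first by ring.
by case: ifP => _; ring.
Qed.

End Module.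
End NS.

Section NSOp.
Variables (K : numFieldType) (V : lmodType K) (sg : {linear V -> V}).
Local Notation M := (monomial -> V).
Variables (ell : int -> M -> M) (dd : M -> M).
Hypothesis EM : nsmodule sg ell dd.
Local Notation EP := (nsE_family EM).
Implicit Types x y : monomial -> nsU K.

Definition nsOp x (v : M) : M := Op sg (nsE ell dd) x v.
Definition nsExp x (v : M) : M := Exp (nsOp x) v.

Lemma nsOp_raises k x : ord k x -> raises k (nsOp x).
Proof. exact: (Op_raises EP). Qed.

Lemma nsOpN x v : nsOp (- x) v = - nsOp x v.
Proof. exact: (Op_coefN EP). Qed.

Lemma nsExp_unip x : ord 1 x -> unip (nsExp x).
Proof. by move=> ox; apply: Exp_unip; exact: nsOp_raises. Qed.

Lemma nsExp_lin x : ord 1 x -> lin (nsExp x).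
Proof. by case/nsExp_unip => [[]]. Qed.

Lemma nsExpK x v : ord 1 x -> nsExp x (nsExp (- x) v) = v.
Proof.
move=> ox; rewrite /nsExp -[RHS](Exp_oppK v (nsOp_raises ox)).
by congr (Exp _ (Exp _ _)); apply/funext => w; rewrite nsOpN.
Qed.

Lemma nsExpNK x v : ord 1 x -> nsExp (- x) (nsExp x v) = v.
Proof. by move=> /ordN oN; have := nsExpK v oN; rewrite opprK. Qed.

Lemma nsExp_Op x y v : ord 1 x -> nsExp x (nsOp y v) = nsOp (Exp (ad x) y) (nsExp x v).
Proof. exact: (Exp_Op EP EP (nsE_comm EM) (@nsbr_lin K) (@nsbr0 K)). Qed.

Lemma nsExp_Theta x v : ord 1 x ->
  nsExp x (Theta v) = Theta (nsExp x v) - nsOp (nseta x) (nsExp x v).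
Proof.
move=> ox; apply: (Exp_Theta EP _ (@nsbr_lin K) (@nsbr0 K) _ ox) => k l p q w.
by have := nsE_comm EM k l p q w; rewrite addbF.
Qed.

Lemma nsOp_central x z v : (forall t, (z t).1 = 0) -> nsOp x (nsOp z v) = nsOp z (nsOp x v).
Proof.
move=> zc; rewrite /nsOp (Op_comm EP EP EP (nsE_comm EM)).
by rewrite (_ : brk _ _ _ = 0) ?(Op_coef0 EP) ?addr0 //; exact: ad_centralr.
Qed.

Lemma nsExp_Op_central x z v : (forall t, (z t).1 = 0) -> ord 1 x ->
  nsExp x (nsOp z v) = nsOp z (nsExp x v).
Proof.
move=> zc ox; apply: Exp_commute; first exact: nsOp_raises.
  exact: nsOp_raises (ord0 _).
by move=> w; apply: nsOp_central.
Qed.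

Lemma nsExp_central x z v : (forall t, (z t).1 = 0) -> ord 1 z -> ord 1 x ->
  nsExp z (nsExp x v) = nsExp x (nsExp z v).
Proof.
move=> zc oz ox; apply: Exp_commute; first exact: nsOp_raises.
  by case: (nsExp_unip ox).
by move=> w; rewrite nsExp_Op_central.
Qed.

(** The product rule for logarithmic derivatives: that of e^x T is eta(x) + Ad(x)(tau). *)
Lemma Theta_step (T : M -> M) tau x v : ord 1 x ->
  (forall v, T (Theta v) = Theta (T v) - nsOp tau (T v)) ->
  nsExp x (T (Theta v)) =
  Theta (nsExp x (T v)) - nsOp (nseta x + Exp (ad x) tau) (nsExp x (T v)).
Proof.
move=> ox HT; rewrite HT (linB (nsExp_lin ox)) nsExp_Theta // nsExp_Op //.
by rewrite /nsOp (Op_coefD EP) opprD addrA.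
Qed.

End NSOp.

(** * The factorization in an arbitrary module *)

Section Factorization.
Variable K : numFieldType.
Implicit Types x y : monomial -> nsU K.
Variables xA xB y0 yp ym : monomial -> nsU K.
Hypotheses (oxA : ord 1 xA) (oxB : ord 1 xB) (oy0 : ord 1 y0) (oyp : ord 1 yp)
  (oym : ord 1 ym).

Let Ad x y : monomial -> nsU K := Exp (ad x) y.

(* The logarithmic derivative of e^{xA} e^{xB} e^{-y0} e^{-yp}. *)
Definition logder : monomial -> nsU K :=
  nseta xA + Ad xA (nseta xB + Ad xB (nseta (- y0) + Ad (- y0) (nseta (- yp)))).

Definition defect : monomial -> nsU K := logder - nseta ym.

(** This is already the series Gamma, the antiderivative for Theta of the central part of the
    defect. In degree 0 the inverse of 0 is 0 by convention, in accordance with the vanishing of the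
    defect there. *)
Definition gamma (t : monomial) : K :=
  if isT t && (wt t == 0) then (sdeg t)%:R^-1 * (defect t).2 else 0.
Definition gdata : monomial -> nsU K := fun t => (0, gamma t : K^o).

Lemma Ad_ord x y n : ord 1 x -> ord n y -> ord n (Ad x y).
Proof. by move=> ox oy; have [_ /(_ _ _ oy)] := Exp_raises (ad_raises ox). Qed.

Lemma logder_ord1 : ord 1 logder.
Proof.
have oy0' := ordN oy0; have oyp' := ordN oyp.
apply: ordD; first exact: nseta_ord1.
apply: Ad_ord => //; apply: ordD; first exact: nseta_ord1.
apply: Ad_ord => //; apply: ordD; first exact: nseta_ord1.
by apply: Ad_ord => //; exact: nseta_ord1.
Qed.

Lemma defect_ord1 : ord 1 defect.
Proof. by apply: ordB; [exact: logder_ord1|exact: nseta_ord1]. Qed.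

Lemma gdata_ord1 : ord 1 gdata.
Proof.
move=> t t0; rewrite /gdata /gamma defect_ord1 //=.
by case: ifP; rewrite ?mulr0.
Qed.

Section Module.
Variables (V : lmodType K) (sg : {linear V -> V}).
Local Notation M := (monomial -> V).
Variables (ell : int -> M -> M) (dd : M -> M).
Hypothesis EM : nsmodule sg ell dd.
Local Notation EP := (nsE_family EM).
Local Notation nsExp := (nsExp sg ell dd).
Local Notation nsOp := (nsOp sg ell dd).

Definition lhsop (v : M) : M := nsExp xA (nsExp xB (nsExp (- y0) (nsExp (- yp) v))).

Lemma lhsop_Theta v : lhsop (Theta v) = Theta (lhsop v) - nsOp logder (lhsop v).
Proof.
have oy0' := ordN oy0; have oyp' := ordN oyp.
apply: (Theta_step (T := fun v => nsExp xB (nsExp (- y0) (nsExp (- yp) v))) EM) => //.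
move=> {}v; apply: (Theta_step (T := fun v => nsExp (- y0) (nsExp (- yp) v)) EM) => //.
move=> {}v; apply: (Theta_step (T := nsExp (- yp)) EM) => //.
by move=> {}v; exact: (nsExp_Theta EM v oyp').
Qed.

(** As Theta kills p, both logarithmic derivatives send the common vector e^{ym} p to its image
    under Theta; so their difference kills this vector. The vector x of the module of vector fields
    will serve as p. *)
Lemma defect_central (p : M) : Theta p = 0 ->
  (forall x, nsOp x p = 0 -> forall t, isT t -> (x t).1 = 0) ->
  nsExp ym p = lhsop p -> forall t, isT t -> (defect t).1 = 0.
Proof.
move=> Tp faith E; have oymN := ordN oym.
have E1 : nsOp (nseta ym) (nsExp ym p) = Theta (nsExp ym p).
  have := nsExp_Theta EM p oym; rewrite Tp (lin0 (nsExp_lin EM oym)) => /esym/eqP.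
  by rewrite subr_eq0 => /eqP.
have E2 : nsOp logder (nsExp ym p) = Theta (nsExp ym p).
  have := lhsop_Theta p; rewrite Tp -E.
  have -> : lhsop 0 = 0.
    by rewrite /lhsop !(lin0 (nsExp_lin EM _)) //; exact: ordN.
  by move=> /esym/eqP; rewrite subr_eq0 => /eqP.
have E3 : nsOp defect (nsExp ym p) = 0.
  by rewrite /nsOp (Op_coefB EP) -!/(nsOp _ _) E1 E2 subrr.
(* Conjugation by e^{-ym} gives an element that kills p itself, to which [faith] applies. *)
have := congr1 (nsExp (- ym)) E3; rewrite (nsExp_Op EM) // (nsExpNK EM) //.
rewrite (lin0 (nsExp_lin EM oymN)) => /faith; rewrite -/(Ad _ _) => c t Tt.
have -> : defect t = Ad ym (Ad (- ym) defect) t.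
  rewrite /Ad; have := Exp_oppK defect (ad_raises oym); move=> {1}<-.
  by congr (Exp _ (Exp _ _) _); apply/funext => y; rewrite adN.
(* Conjugating back by e^{ym} changes nothing: the brackets with an element whose first component
   vanishes are 0. *)
rewrite /Ad /Exp big_ord_recl fact0 invr1 scale1r big1 ?addr0 ?c // => i _.
rewrite lift0; suff : forall u, isT u -> iter i.+1 (ad ym) (Exp (ad (- ym)) defect) u = 0.
  by move=> ->; rewrite ?scaler0.
elim: (i : nat) => [|j IH] u Tu; first by apply: ad_central c Tu.
rewrite iterS; apply: ad_central Tu => w /IH.
by move=> ->.
Qed.

Hypothesis defc : forall t, isT t -> (defect t).1 = 0.

(** Theta undoes the division by the degree, and the coefficient of d is only read at normalized
    monomials of weight 0. *)
Lemma nsOp_defect v : nsOp defect v = nsOp (Theta gdata) v.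
Proof.
apply/funext => s; rewrite /nsOp /Op big_seq [RHS]big_seq; apply: eq_bigr => t ts.
congr (act _ _ _ _); rewrite /nsE (defc (D_isT ts)) /Theta /gdata /gamma (D_isT ts).
move: (defect t) (@defect_ord1 t) => z oz; rewrite /= scaler0; congr (_ + _ *: _); case: eqP => // _; rewrite /GRing.scale /=.
have [t0|t0] := posnP (sdeg t); first by rewrite oz ?t0 ?mul0r.
by rewrite mulrA mulfV ?mul1r // pnatr_eq0 -lt0n.
Qed.

Lemma nseta_gdata : nseta gdata = Theta gdata.
Proof.
apply/funext => t; rewrite /nseta /eta; case E : (sdeg t) => [|n].
  by rewrite big_ord0 /Theta E scale0r.
rewrite big_ord_recl factS fact0 muln1 invr1 scale1r big1 ?addr0 // => i _.
by rewrite lift0 iterS -/(ad gdata _) ad_centrall ?scaler0.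
Qed.

Lemma factorization v :
  nsExp xA (nsExp xB v) = nsExp ym (nsExp yp (nsExp y0 (nsExp gdata v))).
Proof.
have og := gdata_ord1; have gc u : (gdata u).1 = 0 by [].
have ogN := ordN og; have oymN := ordN oym.
have gNc u : ((- gdata) u).1 = 0 by rewrite fNE /= oppr0.
have Tgc u : (Theta gdata u).1 = 0 by rewrite /Theta /= scaler0.
pose O v := nsExp (- gdata) (nsExp (- ym) (lhsop v)).
have OE w : O w = w.
  apply: (unip_Theta (O := O)).
    have u x : ord 1 x -> unip (nsExp x) := @nsExp_unip _ _ _ _ _ EM x.
    apply: (unip_comp (O := nsExp _)); first exact: u.
    apply: (unip_comp (O := nsExp _)); first exact: u.
    apply: (unip_comp (O := nsExp _)); first exact: u.
    apply: (unip_comp (O := nsExp _)); first exact: u.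
    by apply: unip_comp; apply: u; exact: ordN.
  move=> {}w; rewrite /O lhsop_Theta; set a := lhsop w.
  (* [logder] is eta(ym) plus the defect. Conjugating Theta by e^{ym} accounts for the first
     summand, and conjugating it by e^{gdata} for the second. *)
  have -> : Theta a - nsOp logder a = nsExp ym (Theta (nsExp (- ym) a)) - nsOp defect a.
    rewrite (nsExp_Theta EM _ oym) (nsExpK EM) // /defect.
    by rewrite /nsOp (Op_coefB EP) opprB addrA subrK.
  rewrite nsOp_defect (linB (nsExp_lin EM oymN)) (nsExpNK EM) //.
  rewrite (nsExp_Op_central EM _ Tgc) //; set b := nsExp (- ym) a.
  have -> : Theta b - nsOp (Theta gdata) b = nsExp gdata (Theta (nsExp (- gdata) b)).
    by rewrite (nsExp_Theta EM) // (nsExpK EM) // nseta_gdata.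
  by rewrite (nsExpNK EM).
have TE w : lhsop w = nsExp ym (nsExp gdata w).
  by rewrite -[in RHS](OE w) /O (nsExpK EM) // (nsExpK EM).
have := TE (nsExp yp (nsExp y0 v)); rewrite /lhsop !(nsExpNK EM) // => ->.
by rewrite !(nsExp_central EM _ gc) // (nsExp_central EM (nsExp y0 v) gc).
Qed.

End Module.
End Factorization.

(** * Finitely supported sums *)

Lemma fsum_seq (V : nmodType) (T : choiceType) (r : seq T) (F : T -> V) : uniq r ->
  (forall i, i \notin r -> F i = 0) ->
  \sum_(i \in [set: T]%classic) F i = \sum_(i <- r) F i.
Proof.
move=> ur F0; rewrite (fsbigE r) //; last by move=> i _; exact: F0.
by apply: eq_bigl => i; rewrite in_setT.
Qed.

Lemma fsum_ord (V : nmodType) (F : nat -> V) N : (forall i, (N <= i)%N -> F i = 0) ->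
  \sum_(i \in [set: nat]%classic) F i = \sum_(i < N) F i.
Proof.
move=> F0; rewrite (fsum_seq (iota_uniq 0 N)).
  by rewrite -(big_mkord xpredT F) /index_iota subn0.
by move=> i; rewrite mem_iota add0n -leqNgt => /F0.
Qed.

Lemma fsum_reindex (V : nmodType) (T T' : choiceType) (h : T -> T') (g : T' -> T)
    (P : pred T) (Q : pred T') (A : set T') (F : T' -> V) :
  (forall w, A w -> ~~ Q w -> F w = 0) ->
  (forall v, P v -> [/\ A (h v), Q (h v) & g (h v) = v]) ->
  (forall w, A w -> Q w -> P (g w) /\ h (g w) = w) ->
  \sum_(w \in A) F w = \sum_(v \in [set: T]%classic) (if P v then F (h v) else 0).
Proof.
move=> F0 hP gQ.
have E1 : \sum_(w \in [set w | A w /\ Q w]%classic) F w = \sum_(w \in A) F w.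
  by apply: fsbig_widen => w /= [] // Aw /not_andP[//|/negP]; exact: F0.
rewrite -{}E1 (reindex_fsbig h [set v | P v]%classic); last first.
  split=> [v /= /hP[]//|v w|w /= [/gQ Aw /Aw[Pg e]]].
    by rewrite !inE /= => /hP[_ _ {2}<-] /hP[_ _ {2}<-] ->.
  by exists (g w).
rewrite fsbig_mkcond; apply: eq_fsbigr => u _; rewrite /patch.
by rewrite (_ : (u \in _) = P u) //; apply/idP/idP => e; [rewrite inE in e|rewrite inE].
Qed.

(** Among the pairs of product t, those without a common odd variable are determined by their first
    member. *)
Lemma sum_splits (V : nmodType) (F : monomial * monomial -> V) t :
  (forall p, ~~ mdisj p.1 p.2 -> F p = 0) ->
  \sum_(p \in [set p | mono_mul p.1 p.2 = t]%classic) F p =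
  \sum_(u \in [set: monomial]%classic) (if mdiv u t then F (u, msub t u) else 0).
Proof.
move=> F0; apply: (fsum_reindex (h := fun u => (u, msub t u)) (g := fst)
  (P := fun u => mdiv u t) (Q := fun p => mdisj p.1 p.2)) => [p _|u /mdivP[]|[u v] /= <- d] //.
  exact: F0.
by rewrite mdivM msubM.
Qed.

Section Series.
Variable K : numFieldType.
Local Notation M := (monomial -> K^o).
Local Notation sgK := (idfun : {linear K^o -> K^o}).
Local Notation actK := (act sgK).

Lemma sgi_idfun n (x : K^o) : sgi sgK n x = x.
Proof. by elim: n => //= n IH; rewrite /sgi /= -/(sgi _ _ _) IH. Qed.

Lemma smul_act (f g : M) t :
  smul f g t = \sum_(u \in [set: monomial]%classic) f u * actK u g t.
Proof.
rewrite /smul (sum_splits (F := fun p => koszul K p.1 p.2 * f p.1 * g p.2)).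
  apply: eq_fsbigr => u _; rewrite /act sgi_idfun; case: ifP; rewrite ?mulr0 //= => _.
  by rewrite mulrAC mulrC /GRing.scale.
by move=> p /(koszul0 K) ->; rewrite !mul0r.
Qed.

Lemma smul_smonol u (g : M) : smul (smono K u) g = actK u g.
Proof.
apply/funext => t; rewrite smul_act (fsum_seq (r := [:: u])) //.
  by rewrite big_seq1 /smono eqxx mul1r.
by move=> i; rewrite inE /smono => /negbTE ->; rewrite mul0r.
Qed.

Lemma smul_D (f g : M) t : (forall u, f u != 0 -> isT u) ->
  smul f g t = \sum_(u <- D t) f u * actK u g t.
Proof.
move=> fT; rewrite smul_act (fsum_seq (uniq_D t)) // => u.
rewrite mem_D negb_and => /orP[uT|ut].
  by have [->|/fT] := eqVneq (f u) 0; rewrite ?mul0r // (negbTE uT).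
by rewrite /act (negbTE ut) mulr0.
Qed.

Lemma act_smono u v : mdisj u v ->
  actK u (smono K v) = koszul K u v *: (smono K (mono_mul u v) : M).
Proof.
move=> d; apply/funext => s; rewrite fZE /act sgi_idfun /smono.
case: ifP => h.
  have [e d'] := mdivP h; have [->|ne] := eqVneq s (mono_mul u v).
    by rewrite msubM // eqxx.
  case: eqP => [e'|_]; last by rewrite !scaler0.
  by rewrite -e' e eqxx in ne.
by case: eqP => [e|_]; rewrite ?scaler0 //; rewrite e mdivM in h.
Qed.

(** * The Neveu-Schwarz module of series *)

Definition mk (a x : int) e (o : {fset oddvar}%fset) (b : bool) : monomial :=
  Mono a x e (if b then (None |` o)%fset else o).

Lemma mkE t : t = mk (malpha t) (mx t) (meven t) (modd t `\ None)%fset (None \in modd t).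
Proof.
apply: mono_eq => //=; case: ifPn => h; first by rewrite fsetD1K.
by apply/esym/fsetDidPl; rewrite fdisjointX1.
Qed.

Lemma mk_ind (Q : monomial -> Prop) :
  (forall a x e o b, None \notin o -> Q (mk a x e o b)) -> forall t, Q t.
Proof. by move=> H t; rewrite (mkE t); apply: H; rewrite !inE. Qed.

Lemma None_mk a x e o b : None \notin o -> (None \in modd (mk a x e o b)) = b.
Proof. by move=> no; rewrite /mk; case: b; rewrite /= ?inE ?eqxx ?(negbTE no). Qed.

Definition half (k : int) : int := (k %/ 2)%Z.
Lemma half_even k : ~~ oddz k -> k = half k * 2.
Proof. by rewrite /oddz /half => h; rewrite {1}(divz_eq k 2); lia. Qed.
Lemma half_odd k : oddz k -> k = half k * 2 + 1.
Proof. by rewrite /oddz /half => h; rewrite {1}(divz_eq k 2); lia. Qed.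

Definition ellS (k : int) (f : M) : M :=
  if oddz k then Gop (half k) f else Lop (half k) f.

Lemma act_even a j e (f : M) t (u := Mono a j e fset0) :
  actK u f t = if mdiv u t then f (msub t u) else 0.
Proof. by rewrite /act sgi_idfun koszul_even // scale1r. Qed.

Lemma act_x j (f : M) a x e o b :
  actK (Mono 0 j mset0 fset0) f (mk a x e o b) = f (mk a (x - j) e o b).
Proof.
rewrite act_even /mdiv msub0set fsub0set /=; congr f.
by apply: mono_eq => //=; rewrite ?subr0 ?msetB0 ?fsetD0.
Qed.

Lemma act_phix j (f : M) a x e o b : None \notin o ->
  actK (Mono 0 j mset0 [fset None]%fset) f (mk a x e o b) =
  if b then f (mk a (x - j) e o false) else 0.
Proof.
move=> no; rewrite /act sgi_idfun /mdiv msub0set fsub1set None_mk //=.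
case: b => //; rewrite koszul_phi ?scale1r //; last first.
  by rewrite /mdisj /= fdisjointX0 || rewrite /mdisj /= fdisjoint1X !inE eqxx.
congr f; apply: mono_eq => //=; rewrite ?subr0 ?msetB0 //.
by rewrite fsetU1K.
Qed.

Lemma Lop_mk j (f : M) a x e o b : None \notin o ->
  Lop j f (mk a x e o b) =
  - ((x - j)%:~R + b%:R * ((j + 1)%:~R / 2)) * f (mk a (x - j) e o b).
Proof.
move=> no; rewrite /Lop fNE fDE mulNr; congr (- _).
have -> : smul (xpow K (j + 1)) (dx f) (mk a x e o b) = (x - j)%:~R * f (mk a (x - j) e o b).
  rewrite smul_smonol act_x /dx /=; congr (_%:~R * f _); first lia.
  by apply: mono_eq => //=; lia.
have -> : smul (phi K) (xpow K j) = smono K (Mono 0 j mset0 [fset None]%fset).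
  rewrite smul_smonol act_smono; last by rewrite mdisjC mdisj_even.
  rewrite koszul_evenr // scale1r; congr smono.
  by apply: mono_eq => /=; rewrite ?add0r ?mset0D ?fsetU0.
rewrite /sscale smul_smonol act_phix //.
case: b; rewrite ?mul0r ?mulr0 ?addr0 // mul1r mulrDl; congr (_ + _ * _).
rewrite /dphi None_mk //; congr f; exact: mono_eq.
Qed.

Lemma Gop_mk m (f : M) a x e o b : None \notin o ->
  Gop m f (mk a x e o b) =
  if b then (x - m)%:~R * f (mk a (x - m) e o false) else - f (mk a (x - m - 1) e o true).
Proof.
move=> no; rewrite /Gop fNE smul_smonol act_x fBE.
rewrite {1}/dphi None_mk // smul_smonol.
rewrite act_phix //; case: b; last first.
  by rewrite subr0; congr (- f _); apply: mono_eq => //=; lia.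
rewrite sub0r opprK /dx /=; congr (_%:~R * f _); first lia.
by apply: mono_eq => //=; lia.
Qed.

Lemma ellS_mk k (f : M) a x e o b : None \notin o -> let h := half k in
  ellS k f (mk a x e o b) =
  if oddz k then
    if b then (x - h)%:~R * f (mk a (x - h) e o false) else - f (mk a (x - h - 1) e o true)
  else - ((x - h)%:~R + b%:R * ((h + 1)%:~R / 2)) * f (mk a (x - h) e o b).
Proof.
by move=> no h; rewrite /ellS; case: ifP => _; rewrite ?Gop_mk ?Lop_mk.
Qed.

End Series.

Lemma halfD k l : half (k + l) = half k + half l + (oddz k && oddz l)%:Z.
Proof. by rewrite /half /oddz; lia. Qed.

Section SeriesModule.
Variable K : numFieldType.
Local Notation M := (monomial -> K^o).
Local Notation sgK := (idfun : {linear K^o -> K^o}).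
Local Notation actK := (act sgK).
Local Notation ellS := (@ellS K).

Lemma ellS_lin k : lin (ellS k).
Proof.
move=> c u v; apply/funext; elim/mk_ind => a x e o b no; rewrite fDE fZE !ellS_mk //.
case: oddz; last by rewrite fDE fZE /GRing.scale /=; ring.
by case: b; rewrite fDE fZE /GRing.scale /=; ring.
Qed.

Lemma sim_mk a x a' x' e o b b' : None \notin o -> sim (mk a x e o b) (mk a' x' e o b').
Proof.
move=> no; split=> //; rewrite /mk; have D0 : (o `\ None)%fset = o.
  by apply/fsetDidPl; rewrite fdisjointX1.
by case: b; case: b'; rewrite /= ?fsetU1K // D0.
Qed.

Lemma ellS_local k : simlocal (ellS k).
Proof.
elim/mk_ind => a x e o b no; set h := half k.
exists [:: mk a (x - h) e o b; mk a (x - h) e o false; mk a (x - h - 1) e o true].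
split=> [s'|u u0]; first by rewrite !inE => /or3P[] /eqP ->; apply: sim_mk.
rewrite ellS_mk // -/h; case: oddz; last by rewrite u0 ?mulr0 // !inE eqxx.
by case: b u0 => u0; rewrite u0 ?mulr0 ?oppr0 // !inE eqxx ?orbT.
Qed.

(** phi has the smallest rank, so it is inverted with every element of o. *)
Lemma inversions_phi o o' : None \notin o -> None \notin o' ->
  inversions o (None |` o')%fset = (#|` o| + inversions o o')%N.
Proof.
move=> no no'; rewrite inversionsUr ?fdisjoint1X //; congr (_ + _)%N.
rewrite /inversions big_seq (eq_bigr (fun=> 1%N)); first by rewrite -big_seq sum1_size.
by move=> [v|] vo; [rewrite big_seq_fset1; case: v {vo}|rewrite vo in no].
Qed.

Lemma act_mk t (v : M) a x e o b : None \notin o -> isS t ->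
  actK t v (mk a x e o b) =
  if mdiv t (mk 0 0 e o false) then
    (-1) ^+ (b && odd #|` modd t|) * (-1) ^+ inversions (modd t) (o `\` modd t)%fset
    * v (mk (a - malpha t) x (e `\` meven t)%mset (o `\` modd t)%fset b)
  else 0.
Proof.
move=> no /andP[/eqP tx tn].
have -> : mdiv t (mk 0 0 e o false) = mdiv t (mk a x e o b).
  rewrite /mdiv /=; case: b => //=; congr (_ && _).
  apply/idP/idP => [/fsubset_trans|/fsubsetP h]; first by apply; exact: fsubsetUr.
  apply/fsubsetP => u ut; have := h u ut; rewrite !inE => /orP[/eqP ue|//].
  by rewrite -ue ut in tn.
rewrite /act sgi_idfun; case: ifP => // td; have [_ d] := mdivP td.
have no' : None \notin (o `\` modd t)%fset by rewrite inE (negbTE no) andbF.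
have mE : msub (mk a x e o b) t =
    mk (a - malpha t) x (e `\` meven t)%mset (o `\` modd t)%fset b.
  apply: mono_eq => //=; first by rewrite tx subr0.
  case: b {td d} => //=; apply/fsetP => u; rewrite !inE andb_orr; congr (_ || _).
  by case: eqP => [->|]; rewrite ?andbF // tn.
rewrite koszulE // mE /mk; case: b {td d mE} => //=; last by rewrite expr0 mul1r.
by rewrite inversions_phi // exprD signr_odd.
Qed.

Lemma ellS_act k t v : isS t ->
  ellS k (actK t v) = (-1) ^+ (oddz k && oddz (wt t)) *: actK t (ellS k v).
Proof.
move=> Tt; apply/funext; elim/mk_ind => a x e o b no.
have no' : None \notin (o `\` modd t)%fset by rewrite inE (negbTE no) andbF.
rewrite fZE ellS_mk // (act_mk (ellS k v)) // ellS_mk // !(act_mk v) // oddz_wt //.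
case: oddz; case: (mdiv _ _); rewrite /GRing.scale /= ?mulr0 ?oppr0 ?if_same //.
  by case: b; case: (odd _); rewrite /= ?expr0 ?expr1;
    move: (_ ^+ inversions _ _) (v _) => c w; ring.
by move: (_ ^+ inversions _ _) (_ ^+ (b && _)) (v _) (- (_ + _)) => c c' w i; ring.
Qed.

Lemma ellS_comm k l v : ellS k (ellS l v) =
  (-1) ^+ (oddz k && oddz l) *: ellS l (ellS k v) + nsB K k l *: ellS (k + l) v.
Proof.
apply/funext; elim/mk_ind => a x e o b no; rewrite fDE !fZE.
rewrite !ellS_mk //.
rewrite oddzD halfD /nsB.
set hk := half k; set hl := half l.
have kE : k = hk * 2 + (oddz k)%:Z.
  by case: (boolP (oddz k)) => [/half_odd|/half_even] ->; rewrite ?addr0.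
have lE : l = hl * 2 + (oddz l)%:Z.
  by case: (boolP (oddz l)) => [/half_odd|/half_even] ->; rewrite ?addr0.
have kR : k%:~R = hk%:~R * 2 + (oddz k)%:R :> K.
  by rewrite [in LHS]kE rmorphD rmorphM /= pmulrn.
have lR : l%:~R = hl%:~R * 2 + (oddz l)%:R :> K.
  by rewrite [in LHS]lE rmorphD rmorphM /= pmulrn.
rewrite kR lR.
have E1 : x - hk - hl = x - (hk + hl) by lia.
have E2 : x - hl - hk = x - (hk + hl) by lia.
have E3 : x - hk - 1 - hl = x - (hk + hl) - 1 by lia.
have E4 : x - hl - 1 - hk = x - (hk + hl) - 1 by lia.
have E5 : x - (hk + hl) - 1 - 1 = x - (hk + hl) - 2 by lia.
have E6 : x - (hk + hl + 1) = x - (hk + hl) - 1 by lia.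
have E7 : x - hk - hl - 1 = x - (hk + hl) - 1 by lia.
have E8 : x - hl - hk - 1 = x - (hk + hl) - 1 by lia.
case: (oddz k); case: (oddz l); case: b; rewrite /= ?expr0 ?expr1 ?addr0
  ?E7 ?E8 ?E3 ?E4 ?E6 ?E1 ?E2 ?E5 /GRing.scale /=;
  rewrite ?(rmorphD, rmorphB, rmorphN) /=;
  move: (v _) (hk%:~R : K) (hl%:~R : K) (x%:~R : K) => F hk' hl' x'.
all: by field.
Qed.

Lemma ellS_module : nsmodule sgK ellS (fun=> 0).
Proof.
split=> [k|k|k t v|c u v|s|t v _|k l v|k v].
- exact: ellS_lin.
- exact: ellS_local.
- exact: ellS_act.
- by rewrite scaler0 addr0.
- by exists [::].
- by rewrite act0.
- by rewrite ellS_comm scaler0 addr0.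
- by rewrite (lin0 (@ellS_lin k)).
Qed.

End SeriesModule.

(** * Continuity of operators *)

Section Locality.
Variables (K : numFieldType) (V : lmodType K) (sg : {linear V -> V}).
Local Notation M := (monomial -> V).

(** Weaker than [simlocal]: the finitely many monomials may have another degree than s, as needed
    for multiplications by variables and for exponentials. *)
Definition loc (O : M -> M) : Prop :=
  forall s, exists S : seq monomial, forall u, (forall s', s' \in S -> u s' = 0) -> O u s = 0.

Lemma simlocal_loc O : simlocal O -> loc O.
Proof. by move=> lO s; have [S [_ h]] := lO s; exists S. Qed.

Lemma loc_seq (O : M -> M) (r : seq monomial) : loc O -> exists S : seq monomial,
  forall u, (forall s', s' \in S -> u s' = 0) -> forall s, s \in r -> O u s = 0.
Proof.
move=> lO; elim: r => [|s r [S IH]]; first by exists [::].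
have [S' h] := lO s; exists (S' ++ S) => u uS s1; rewrite inE => /orP[/eqP ->|sr].
  by apply: h => s' s'S; apply: uS; rewrite mem_cat s'S.
by apply: IH sr => s' s'S; apply: uS; rewrite mem_cat s'S orbT.
Qed.

Lemma loc_comp O O' : loc O -> loc O' -> loc (fun v => O (O' v)).
Proof.
move=> lO lO' s; have [S h] := lO s; have [S' h'] := loc_seq S lO'.
by exists S' => u uS'; apply: h; exact: h'.
Qed.

Lemma loc_id : loc (fun v => v).
Proof. by move=> s; exists [:: s] => u; apply; rewrite inE. Qed.

Lemma loc_sum I (r : seq I) (F : I -> M -> M) (s : monomial) :
  (forall i, loc (F i)) -> exists S : seq monomial,
  forall u, (forall s', s' \in S -> u s' = 0) -> \sum_(i <- r) F i u s = 0.
Proof.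
move=> lF; elim: r => [|i r [S IH]]; first by exists [::] => u _; rewrite big_nil.
have [S' h] := lF i s; exists (S' ++ S) => u uS; rewrite big_cons h ?add0r.
  by apply: IH => s' s'S; apply: uS; rewrite mem_cat s'S orbT.
by move=> s' s'S; apply: uS; rewrite mem_cat s'S.
Qed.

Lemma loc_act t : loc (act sg t).
Proof.
move=> s; exists [:: msub s t] => u us; rewrite /act us ?inE // sgi0 scaler0.
by rewrite if_same.
Qed.

Lemma loc_Exp Y : loc Y -> loc (Exp Y).
Proof.
move=> lY s; have li n : loc (iter n Y).
  by elim: n => [|n IH]; [exact: loc_id|exact: (loc_comp lY IH)].
have lF (i : 'I_(sdeg s).+1) : loc (fun v => (i`!%:R)^-1 *: iter i Y v).
  move=> s'; have [S h] := li i s'; exists S => u uS.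
  by rewrite fZE h ?scaler0.
have [S h] := loc_sum (index_enum 'I_(sdeg s).+1) s lF.
by exists S => u uS; rewrite /Exp; have := h u uS.
Qed.

Lemma loc_Op (U : lmodType K) e (E : int -> U -> M -> M) x : family sg e E ->
  loc (Op sg E x).
Proof.
move=> EP s; have [S h] := loc_sum (D s) s
  (fun t => loc_comp (loc_act t) (simlocal_loc (fam_local EP (wt t) (x t)))).
by exists S => u uS; rewrite /Op; have := h u uS.
Qed.

End Locality.

(* alpha_0^{a/2} x^n phi^b with L = 2 n + b. *)
Definition emono (a L : int) : monomial :=
  Mono a (half L) mset0 (if oddz L then [fset None] else fset0)%fset.

(** * Multiplication operators and the Leibniz rule *)

Section Multiplication.
Variables (K : numFieldType) (V : lmodType K) (sg : {linear V -> V}).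
Local Notation M := (monomial -> V).

(** Multiplication operators in the form of a family, so that [Exp_Op] applies to them. A
    coefficient monomial of weight k is paired with x^n phi^b, 2n + b = k + L, which makes the
    product homogeneous. *)
Definition emulE (a L : int) (k : int) (q : K^o) (v : M) : M :=
  (q : K) *: act sg (emono a (k + L)) v.

Lemma emulE_family a L : family sg (oddz L) (emulE a L).
Proof.
split=> [k p c u v|k v c p q|k p s|k p t v St].
- by rewrite /emulE act_lin scalerDr !scalerA mulrC.
- by rewrite /emulE scalerDl scalerA.
- exists [:: msub s (emono a (k + L))]; split=> [s'|u us].
    rewrite inE => /eqP ->; split; first by rewrite /= msetB0.
    apply/fsetP => w; rewrite /= !inE; case: eqP => //= /eqP wn.
    by case: oddz; rewrite !inE ?(negbTE wn).
  by rewrite /emulE fZE /act us ?inE // sgi0 scaler0 if_same scaler0.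
- rewrite /emulE actZ actC signb_odd -(oddz_wt St) !scalerA mulrC; congr (_ * _ *: _).
  congr (_ ^+ (_ && _)); by rewrite -oddzD /emono; case: (oddz (k + L)); rewrite /= ?cardfs1 ?cardfs0.
Qed.

End Multiplication.

Section Multiplicative.
Variable K : numFieldType.
Local Notation M := (monomial -> K^o).
Local Notation sgK := (idfun : {linear K^o -> K^o}).
Local Notation actK := (act sgK).
Local Notation ellS := (@ellS K).
Local Notation mono := (smono K : monomial -> M).
Local Notation EM := (ellS_module K).
Local Notation nsOpS := (nsOp sgK ellS (fun=> 0)).
Local Notation nsExpS := (nsExp sgK ellS (fun=> 0)).

(** A continuous linear operator is determined by its values on monomials. This brings it to the
    form in which [subst] is defined. *)
Lemma lin_loc_sum (O : M -> M) (F : M) t : lin O -> loc O ->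
  O F t = \sum_(s \in [set: monomial]%classic) F s * O (mono s) t.
Proof.
move=> lO /(_ t)[S h]; pose r := undup S.
rewrite (fsum_seq (r := r)) ?undup_uniq //; last first.
  move=> s; rewrite mem_undup => sS; rewrite h ?mulr0 // => s' s'S.
  by rewrite /smono; case: eqP => // e; rewrite -e s'S in sS.
have -> : O F t = O (\sum_(s <- r) F s *: mono s) t.
  apply/eqP; rewrite -subr_eq0 -fBE -(linB lO); apply/eqP/h => s' s'S.
  rewrite fBE fsumE (bigD1_seq s') ?undup_uniq ?mem_undup //= big1 ?addr0.
    by rewrite fZE /smono eqxx /GRing.scale /= mulr1 subrr.
  by move=> s; rewrite fZE /smono eq_sym => /negbTE ->; rewrite scaler0.
by rewrite (lin_sum lO) fsumE; apply: eq_bigr => s _; rewrite (linZ lO).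
Qed.

Lemma smul_smonor (f : M) u w : smul f (mono u) w =
  if mdiv u w then f (msub w u) * koszul K (msub w u) u else 0.
Proof.
rewrite smul_act; case: ifP => uw.
  have [e d] := mdivP uw; rewrite mdisjC in d.
  rewrite (fsum_seq (r := [:: msub w u])) // ?big_seq1.
    rewrite act_smono // fZE (mono_mulC _ u) e /smono eqxx.
    by rewrite /GRing.scale /= mulr1.
  move=> v; rewrite inE => vu; rewrite /act sgi_idfun.
  case: ifP => [vw|]; last by rewrite mulr0.
  rewrite /smono; case: eqP => [e'|_]; last by rewrite scaler0 mulr0.
  by move: vu; rewrite -e' msubK // eqxx.
rewrite fsbig1 // => v _; rewrite /act sgi_idfun.
case: ifP => [vw|]; last by rewrite mulr0.
rewrite /smono; case: eqP => [e'|_]; last by rewrite scaler0 mulr0.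
by move: uw; rewrite -e' mdiv_subl.
Qed.

Lemma smul_smul_smono (f : M) u (g : M) :
  smul (smul f (mono u)) g = smul f (actK u g).
Proof.
apply/funext => t; rewrite [LHS]smul_act [RHS]smul_act.
apply: etrans (fsum_reindex (h := fun v => mono_mul v u) (g := fun w => msub w u)
  (P := fun v => mdisj v u) (Q := mdiv u)
  (F := fun w => smul f (mono u) w * actK w g t) _ _ _) _; last first.
- apply: eq_fsbigr => v _; case: ifP => d; last by rewrite actM koszul0 ?d // scale0r mulr0.
  rewrite smul_smonor mdivMr (mono_mulC v u) msubM ?(mdisjC u) // actM fZE (mono_mulC v u).
  by rewrite -mulrA.
- by move=> w _ uw; have [e d] := mdivP uw; rewrite mdisjC mono_mulC.
- by move=> v d; rewrite mdivMr (mono_mulC v u) msubM // mdisjC.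
- by move=> w _ h; rewrite smul_smonor (negbTE h) mul0r.
Qed.

Lemma emono_act a L (v : M) al x e o b : None \notin o ->
  actK (emono a L) v (mk al x e o b) =
  if oddz L then if b then v (mk (al - a) (x - half L) e o false) else 0
  else v (mk (al - a) (x - half L) e o b).
Proof.
move=> no; rewrite /emono; case: (oddz L).
  rewrite /act sgi_idfun /mdiv msub0set fsub1set None_mk //=; case: b => //.
  rewrite koszul_phi ?scale1r //; last by rewrite /mdisj /= fdisjoint1X !inE eqxx.
  congr v; apply: mono_eq => //=; first by rewrite msetB0.
  by rewrite fsetU1K.
rewrite act_even /mdiv msub0set fsub0set /=; congr v.
by apply: mono_eq => //=; rewrite ?msetB0 ?fsetD0.
Qed.

(** The scalar in ell_k (x^n phi^b) with L = 2n + b, the result being a multiple of the monomial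
    with parameter k + L. *)
Definition emulC (k L : int) : K :=
  if oddz k then if oddz L then -1 else (half L)%:~R
  else - ((half L)%:~R + (oddz L)%:R * ((half k + 1)%:~R / 2)).

Lemma ellS_emono k a L v : ellS k (actK (emono a L) v) =
  (-1) ^+ (oddz k && oddz L) *: actK (emono a L) (ellS k v)
  + emulC k L *: actK (emono a (k + L)) v.
Proof.
apply/funext; elim/mk_ind => al x e o b no; rewrite fDE !fZE /emulC.
rewrite !(emono_act, ellS_mk) // oddzD halfD.
set hk := half k; set hL := half L.
have E1 : x - hk - hL = x - (hk + hL) by lia.
have E2 : x - hL - hk = x - (hk + hL) by lia.
have E3 : x - (hk + hL + 1) = x - hk - hL - 1 by lia.
have E4 : x - hk - 1 - hL = x - hk - hL - 1 by lia.
have E5 : x - hL - hk - 1 = x - hk - hL - 1 by lia.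
case: (oddz k); case: (oddz L); case: b;
  rewrite /= ?expr0 ?expr1 ?addr0 ?mulr0 ?oppr0 ?E3 ?E4 ?E5 ?E1 ?E2 /GRing.scale /=;
  rewrite ?(rmorphD, rmorphB, rmorphN) /=.
all: try (move: (v _) (hk%:~R : K) (hL%:~R : K) (x%:~R : K) => F hk' hL' x').
all: by field.
Qed.

Definition emulbr (L : int) (k l : int) (p : nsU K) (q : K^o) : K^o :=
  p.1 * q * emulC k (l + L).

Lemma emulbr_lin L k l p c q q' :
  emulbr L k l p (c *: q + q') = c *: emulbr L k l p q + emulbr L k l p q'.
Proof. by rewrite /emulbr /GRing.scale /=; ring. Qed.
Lemma emulbr0 L k l q : emulbr L k l 0 q = 0.
Proof. by rewrite /emulbr /= !mul0r. Qed.

Lemma emulE_comm a L k l p q v :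
  nsE ellS (fun=> 0) k p (emulE sgK a L l q v) =
  (-1) ^+ (oddz k && (oddz l (+) oddz L)) *: emulE sgK a L l q (nsE ellS (fun=> 0) k p v)
  + emulE sgK a L (k + l) (emulbr L k l p q) v.
Proof.
rewrite /nsE /emulE !scaler0 !addr0 (linZ (ellS_lin k)) ellS_emono oddzD actZ.
apply/funext => s; rewrite !(fDE, fZE) addrA /emulbr /GRing.scale /=; ring.
Qed.

Local Notation MOp a L y := (Op sgK (emulE sgK a L) y).

Definition delta1 : M := mono mono1.

Lemma MOp_delta1 a L v : MOp a L delta1 v = actK (emono a L) v.
Proof.
apply/funext => s; rewrite /Op (bigD1_seq mono1) ?mono1_D ?uniq_D //= big1 ?addr0.
  rewrite act1 /emulE /delta1 /smono eqxx scale1r.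
  rewrite (_ : wt mono1 = 0) ?add0r //.
  by rewrite /wt /evensum /oddsum enum_mset0 big_nil big_seq_fset0.
by move=> t t1; rewrite /delta1 /smono (negbTE t1) /emulE scale0r act0.
Qed.

Lemma wt1 : wt mono1 = 0.
Proof. by rewrite /wt /evensum /oddsum enum_mset0 big_nil big_seq_fset0. Qed.

(** The members of the family are multiplications, hence multiplication by their value at 1. *)
Lemma MOp_smul a L y v : MOp a L y v = smul (MOp a L y (sone K)) v.
Proof.
apply/funext => s; rewrite [RHS]smul_act.
pose em t := emono a (wt t + L); pose c t : K := y t * koszul K t (em t).
have f1 u : MOp a L y (sone K) u = \sum_(t <- D u) c t * mono (mono_mul t (em t)) u.
  rewrite /Op; apply: eq_bigr => t _; rewrite /emulE actZ fZE.
  have -> : actK (emono a (wt t + L)) (sone K) = mono (em t).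
    rewrite /sone act_smono; last by rewrite mdisjC mdisj_even.
    rewrite koszul_evenr // scale1r; congr smono.
    by rewrite mono_mulC mono_mul1.
  have [d|d] := boolP (mdisj t (em t)); first by rewrite act_smono // fZE /c /GRing.scale /= mulrA.
  rewrite /c koszul0 // mulr0 mul0r /act; case: ifP => h; rewrite ?scaler0 //.
  rewrite /smono; case: eqP => [e|]; rewrite ?sgi0 ?scaler0 //.
  by move: (mdivP h) => [_]; rewrite e => h'; rewrite h' in d.
rewrite (fsum_seq (r := undup [seq mono_mul t (em t) | t <- D s])) ?undup_uniq //.
  have -> : \sum_(u <- undup [seq mono_mul t (em t) | t <- D s])
      MOp a L y (sone K) u * actK u v s =
    \sum_(u <- undup [seq mono_mul t (em t) | t <- D s]) \sum_(t <- D s)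
      c t * mono (mono_mul t (em t)) u * actK u v s.
    apply: eq_bigr => u _; rewrite f1 mulr_suml.
    have [us|us] := boolP (mdiv u s); last first.
      by rewrite /act (negbTE us) !big1 // => t _; rewrite mulr0.
    apply: sum_D_widen => // t _ tu; rewrite /smono; case: eqP => [e|]; last first.
      by rewrite mulr0 mul0r.
    by rewrite e mdivM in tu.
  rewrite exchange_big /=; rewrite /Op big_seq [RHS]big_seq; apply: eq_bigr => t ts.
  rewrite (bigD1_seq (mono_mul t (em t))) ?undup_uniq ?mem_undup ?(map_f (fun t => mono_mul t (em t)) ts) //=.
  rewrite big1 ?addr0 => [|u ut]; last first.
    by rewrite /smono (negbTE ut) mulr0 mul0r.
  by rewrite /smono eqxx mulr1 /emulE actZ fZE actM fZE /c /GRing.scale /= mulrA.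
move=> u; rewrite mem_undup => uD.
have [us|us] := boolP (mdiv u s); last by rewrite /act (negbTE us) mulr0.
rewrite f1 big1_seq ?mul0r // => t /andP[_ tu]; rewrite /smono.
case: eqP => [e|]; last by rewrite mulr0.
suff ts : t \in D s by rewrite e (map_f (fun t => mono_mul t (em t)) ts) in uD.
by rewrite mem_D (D_isT tu) (mdiv_trans (D_mdiv tu) us).
Qed.

End Multiplicative.

Lemma Op_act (K : numFieldType) (V : lmodType K) (sg : {linear V -> V}) (U : lmodType K)
    (E : int -> U -> (monomial -> V) -> monomial -> V) x u v :
  (forall t p, isT t ->
    act sg t (E (wt t) p (act sg u v)) = act sg u (act sg t (E (wt t) p v))) ->
  Op sg E x (act sg u v) = act sg u (Op sg E x v).
Proof.
move=> Eu; apply/funext => s; rewrite /Op.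
have -> : \sum_(t <- D s) act sg t (E (wt t) (x t) (act sg u v)) s =
    \sum_(t <- D s) act sg u (act sg t (E (wt t) (x t) v)) s.
  by rewrite big_seq [RHS]big_seq; apply: eq_bigr => t ts; rewrite Eu ?(D_isT ts).
rewrite [RHS]/act; case: ifPn => us; last first.
  by rewrite big1 // => t _; rewrite /(act sg u) (negbTE us).
rewrite sgi_sum scaler_sumr.
under eq_bigr => t _ do rewrite /(act sg u) us.
apply/esym/sum_D_widen; first exact: mdiv_subl.
by move=> t _ tn; rewrite /(act sg t) (negbTE tn) sgi0 scaler0.
Qed.

Lemma Op_act_scalar (K : numFieldType) (V : lmodType K) (sg : {linear V -> V})
    (U : lmodType K) (E : int -> U -> (monomial -> V) -> monomial -> V) x u v :
  family sg false E -> isS u -> Op sg E x (act sg u v) = act sg u (Op sg E x v).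
Proof.
move=> EP Su; apply: Op_act => t p Tt; rewrite (fam_act EP) // actZ actC scalerA.
by rewrite signb_odd -(oddz_wt Su) -(oddz_wt (isT_S Tt)) addbF -expr2 sqrr_sign scale1r.
Qed.

(** * Exponentials of vector fields as substitutions *)

Section GroupLike.
Variable K : numFieldType.
Local Notation M := (monomial -> K^o).
Local Notation sgK := (idfun : {linear K^o -> K^o}).
Local Notation actK := (act sgK).
Local Notation ellS := (@ellS K).
Local Notation mono := (smono K : monomial -> M).
Local Notation EM := (ellS_module K).
Local Notation nsOpS := (nsOp sgK ellS (fun=> 0)).
Local Notation nsExpS := (nsExp sgK ellS (fun=> 0)).
Local Notation MOp a L y := (Op sgK (emulE sgK a L) y).

(* The automorphisms of the algebra of series which are the identity on the
   scalars and modulo terms of positive degree. *)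
Record grouplike (G : M -> M) : Prop := GroupLike {
  gl_unip : unip G;
  gl_loc : loc G;
  gl_one : G (sone K) = sone K;
  gl_act : forall t v, isS t -> G (actK t v) = actK t (G v);
  gl_mul : forall a L y, exists y', ord 1 (y' - y) /\
    forall v, G (MOp a L y v) = MOp a L y' (G v) }.

Lemma gl_comp G G' : grouplike G -> grouplike G' -> grouplike (fun v => G (G' v)).
Proof.
move=> [u l o s m] [u' l' o' s' m']; split.
- exact: unip_comp.
- exact: loc_comp.
- by rewrite o'.
- by move=> t v St; rewrite s' // s.
- move=> a L y; have [y1 [o1 h1]] := m' a L y; have [y2 [o2 h2]] := m a L y1.
  exists y2; split; last by move=> v; rewrite h1 h2.
  by rewrite -(subrK y1 y2) -addrA; apply: ordD.
Qed.

Lemma ellS_one k : ellS k (sone K) = 0.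
Proof.
apply/funext; elim/mk_ind => a z e o b no; rewrite ellS_mk //.
have one y c : c || (y != 0) -> sone K (mk a y e o c) = 0.
  rewrite /sone /smono; have [h|//] := eqVneq (mk a y e o c) mono1.
  have -> : y = 0 by have := congr1 mx h.
  by have := None_mk a y e c no; rewrite h => <-; rewrite eqxx (in_fset0 None).
case: oddz; case: b; rewrite ?(one _ true) ?mulr0 ?oppr0 //.
  by have [->|h] := eqVneq (z - half k) 0; rewrite ?mul0r ?one ?mulr0.
have [->|h] := eqVneq (z - half k) 0; last by rewrite one ?mulr0.
by rewrite mul0r addr0 oppr0 mul0r.
Qed.

Lemma nsOp_one x : nsOpS x (sone K) = 0.
Proof.
apply/funext => s; rewrite /nsOp /Op big1 // => t _.
by rewrite /nsE ellS_one !scaler0 addr0 act0.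
Qed.

(** The exponential of an even derivation is an automorphism: by [Exp_Op], conjugation by it sends
    multiplications to multiplications. *)
Lemma gl_exp x : ord 1 x -> grouplike (nsExpS x).
Proof.
move=> ox; have rx := nsOp_raises EM ox; split.
- exact: nsExp_unip EM _ ox.
- by apply: loc_Exp; apply: loc_Op; exact: nsE_family EM.
- apply/funext => s; rewrite /nsExp /Exp big_ord_recl fact0 invr1 scale1r.
  rewrite big1 ?addr0 // => i _; rewrite lift0 iterSr nsOp_one.
  by rewrite (lin0 (raises_lin (raises_iter i rx))) scaler0.
- move=> t v St; apply: Exp_commute => //.
    split=> [c u w|n w ow]; first exact: act_lin.
    exact: (act_ord _ (leq0n _)).
  by move=> w; apply: Op_act_scalar => //; exact: nsE_family EM.
- move=> a L y; exists (Exp (brk (emulbr L) x) y); split.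
    have [_ /(_ 0%N y (ord0 _))] := Exp_raises1
      (brk_raises (@emulbr_lin K L) (@emulbr0 K L) ox).
    by [].
  move=> v; apply: (Exp_Op (nsE_family EM) (emulE_family sgK a L)) => //.
  + exact: emulE_comm.
  + exact: emulbr_lin.
  + exact: emulbr0.
Qed.

Lemma act_one u : actK u (sone K) = mono u.
Proof.
rewrite /sone act_smono; last by rewrite mdisjC mdisj_even.
by rewrite koszul_evenr // scale1r mono_mulC mono_mul1.
Qed.

Lemma gl_mulE G a L v : grouplike G ->
  G (actK (emono a L) v) = smul (G (mono (emono a L))) (G v).
Proof.
move=> gG; have [y [_ h]] := gl_mul gG a L (delta1 K).
rewrite -[in LHS]MOp_delta1 h MOp_smul; congr smul.
by rewrite -[in LHS](gl_one gG) -h MOp_delta1 act_one.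
Qed.

Lemma gl_lin G : grouplike G -> lin G.
Proof. by move=> [[[]]]. Qed.

Section Zpow.
Variable y : monomial -> K^o.
Hypothesis oy : ord 1 (y - delta1 K).

(** The power (alpha_0 x)^n. *)
Definition pmono (n : int) : monomial := Mono (n *+ 2) n mset0 fset0.

Let f : M := MOp 2 2 y (sone K).
Let R : M -> M := MOp 2 2 (y - delta1 K).

Let rR : raises 1 R.
Proof. exact: (Op_raises (emulE_family sgK 2 2) oy). Qed.

Lemma emono22 : emono 2 2 = pmono 1. Proof. by []. Qed.

Lemma leadE : lead K = mono (pmono 1).
Proof.
rewrite /lead smul_smonol act_smono; last by rewrite mdisj_even.
by rewrite koszul_even // scale1r; congr smono; apply: mono_eq => /=; rewrite ?mset0D ?fset0U.
Qed.

Lemma pmono_mul m n : mono_mul (pmono m) (pmono n) = pmono (m + n).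
Proof. by apply: mono_eq => /=; rewrite ?mulrnDl ?mset0D ?fset0U. Qed.

Lemma act_pmono m n (v : M) : actK (pmono m) (actK (pmono n) v) = actK (pmono (m + n)) v.
Proof. by rewrite actM koszul_even // scale1r pmono_mul. Qed.

Lemma spow_lead k : spow (f - lead K) k = iter k R (sone K).
Proof.
have E : smul (f - lead K) =1 R.
  move=> v; rewrite /R [RHS]MOp_smul; congr smul.
  rewrite /f (Op_coefB (emulE_family sgK 2 2)) MOp_delta1 act_one.
  by rewrite leadE.
by rewrite /spow; elim: k => //= k ->; rewrite E.
Qed.

Let pterm n k : M := actK (pmono (n - k%:Z)) (iter k R (sone K)).

Let pterm_ord n k : ord k (pterm n k).
Proof. by apply: (act_ord sgK (k := 0)) => //; exact: iter_ord. Qed.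

Lemma zpowE n s N : (sdeg s <= N)%N ->
  zpow f n s = \sum_(k < N.+1) zbinom K n k * pterm n k s.
Proof.
move=> sN; have pE k : smul (apow K ((n - k%:Z) *+ 2)) (xpow K (n - k%:Z)) =
    mono (pmono (n - k%:Z)).
  rewrite smul_smonol act_smono; last by rewrite mdisj_even.
  rewrite koszul_even // scale1r; congr smono.
  by apply: mono_eq => /=; rewrite ?addr0 ?add0r ?mset0D ?fset0U.
rewrite /zpow (fsum_ord (N := N.+1)) => [|k kN]; rewrite ?spow_lead ?pE ?smul_smonol.
  by apply: eq_bigr => k _; rewrite spow_lead pE smul_smonol.
by have := @pterm_ord n k s (leq_ltn_trans sN kN); rewrite /pterm => ->; rewrite mulr0.
Qed.

Lemma zbinom_pascal n k : zbinom K (n + 1) k.+1 = zbinom K n k.+1 + zbinom K n k.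
Proof.
rewrite /zbinom big_ord_recl /= subr0 [X in _ = X / _ + _]big_ord_recr /= factS natrM.
have -> : \prod_(i < k) ((n + 1)%:~R - (bump 0 i)%:R) = \prod_(i < k) (n%:~R - i%:R) :> K.
  by apply: eq_bigr => i _; rewrite /bump /= add1n -natr1 rmorphD /=; ring.
have k1 : k.+1%:R != 0 :> K by rewrite pnatr_eq0.
have kf : k`!%:R != 0 :> K by rewrite pnatr_eq0 -lt0n fact_gt0.
rewrite rmorphD /= -!natr1 in k1 *; move: (\prod_(i < k) _) k1 kf => p.
move: (k`!%:R) => q k1 q0; field.
by rewrite k1 q0.
Qed.

(** With f = alpha_0 x + (f - alpha_0 x), this is Pascal's rule for the binomial coefficients of an
    arbitrary integer n. *)
Lemma zpow_rec n : smul f (zpow f n) = zpow f (n + 1).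
Proof.
apply/funext => s; set N := sdeg s; rewrite /f -MOp_smul.
have yE : y = delta1 K + (y - delta1 K) by rewrite addrC subrK.
rewrite {1}yE (Op_coefD (emulE_family sgK 2 2)) MOp_delta1 emono22 fDE -/R.
rewrite -/f -/R; pose Z : M := \sum_(k < N.+1) zbinom K n k *: pterm n k.
have oZ : ord N.+1 (zpow f n - Z).
  move=> s' sN'; rewrite fBE (zpowE _ (N := N)) // /Z fsumE.
  by apply/eqP; rewrite subr_eq0.
have rE : raises 0 (actK (pmono 1)).
  split=> [c u w|m w ow]; first exact: act_lin.
  exact: (act_ord _ (leq0n _)).
rewrite (raises_eq rE oZ) (raises_eq rR oZ) /Z.
rewrite (lin_sum (raises_lin rE)) (lin_sum (raises_lin rR)) !fsumE.
rewrite (zpowE _ (leqnn N)).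
have E1 k : actK (pmono 1) (zbinom K n k *: pterm n k) s = zbinom K n k * pterm (n + 1) k s.
  rewrite actZ fZE /pterm act_pmono.
  by rewrite (_ : 1 + (n - k%:Z) = n + 1 - k%:Z) //; lia.
have E2 k : R (zbinom K n k *: pterm n k) s = zbinom K n k * pterm (n + 1) k.+1 s.
  rewrite (linZ (raises_lin rR)) fZE /pterm.
  rewrite /R Op_act -/R; last first.
    move=> t p Tt; rewrite /emulE !actZ (actC _ _ (pmono _)) cardfs0 muln0 scale1r.
    by rewrite (actC _ t (pmono _)) cardfs0 muln0 scale1r.
  by rewrite (_ : n + 1 - k.+1%:Z = n - k%:Z) //; lia.
rewrite (eq_bigr _ (fun (k : 'I_N.+1) _ => E1 k)) (eq_bigr _ (fun (k : 'I_N.+1) _ => E2 k)).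
rewrite [RHS]big_ord_recl big_ord_recl -addrA; congr (_ + _).
  by rewrite /zbinom !big_ord0.
rewrite [X in _ + X]big_ord_recr /= [X in _ + (_ + X)](_ : _ = 0).
  rewrite addr0 -big_split; apply: eq_bigr => k _ /=.
  by rewrite zbinom_pascal mulrDl.
by rewrite (@pterm_ord (n + 1) N.+1) ?mulr0.
Qed.

Lemma zpow0 : zpow f 0 = sone K.
Proof.
apply/funext => s; rewrite (zpowE _ (leqnn _)) big_ord_recl big1 => [|k _].
  rewrite addr0 /zbinom big_ord0 fact0 divr1 mul1r /pterm /=.
  by rewrite (_ : pmono _ = mono1) ?act1.
rewrite /zbinom lift0; have -> : \prod_(i < k.+1) (0%:~R - i%:R) = 0 :> K.
  by rewrite big_ord_recl (_ : _ - _ = 0) ?mul0r // mulr0z subrr.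
by rewrite !mul0r.
Qed.

End Zpow.

(* A [grouplike] automorphism is the substitution of the images of alpha_0 x
   and alpha_0^{1/2} phi; zpow is determined by zpow_rec since f is invertible. *)
Lemma gl_zpow G n : grouplike G ->
  G (mono (pmono n)) = zpow (G (mono (pmono 1))) n.
Proof.
move=> gG; have [y [oy h]] := gl_mul gG 2 2 (delta1 K).
have fE : G (mono (pmono 1)) = MOp 2 2 y (sone K).
  by rewrite -[in RHS](gl_one gG) -h MOp_delta1 act_one.
set f := G (mono (pmono 1)) in fE *.
have step (v : M) : G (actK (pmono 1) v) = smul f (G v) by exact: (gl_mulE 2 2 v gG).
have rec m : smul f (G (mono (pmono m))) = G (mono (pmono (m + 1))).
  rewrite -step; congr G; rewrite -!act_one act_pmono addrC //.
have recz m : smul f (zpow f m) = zpow f (m + 1) by rewrite fE; exact: zpow_rec.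
(* Multiplication by alpha_0 x is invertible and the rest of f raises the degree, so a series killed
   by f lies in every step of the filtration. *)
have inj (u v : M) : smul f u = smul f v -> u = v.
  have rR := Op_raises (emulE_family sgK 2 2) oy.
  have fE2 w : smul f w = actK (pmono 1) w + MOp 2 2 (y - delta1 K) w.
    rewrite fE -MOp_smul -emono22 -MOp_delta1 -(Op_coefD (emulE_family sgK 2 2)).
    by rewrite addrC subrK.
  rewrite !fE2 => e.
  have {}e : actK (pmono 1) (u - v) = - MOp 2 2 (y - delta1 K) (u - v).
    apply/eqP; rewrite -addr_eq0 (linB (raises_lin rR)).
    rewrite (linB (O := actK (pmono 1))); last by move=> c w w'; exact: act_lin.
    by rewrite addrACA -opprD subr_eq0 e.
  apply/eqP; rewrite -subr_eq0; apply/eqP; apply: (@ord_eq0 K) => n'.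
  elim: n' => [|n' IH]; first exact: ord0.
  have [_ /(_ _ _ IH) o1] := rR.
  have -> : u - v = actK (pmono (-1)) (actK (pmono 1) (u - v)).
    by rewrite act_pmono (_ : pmono _ = mono1) ?act1.
  by rewrite e; apply: (act_ord _ (k := 0)) => //; apply: ordN.
have z0 : G (mono (pmono 0)) = zpow f 0.
  rewrite fE zpow0 // -(gl_one gG); congr G.
have up (k : nat) : G (mono (pmono k)) = zpow f k.
  elim: k => [|k IH]; first exact: z0.
  by rewrite -addn1 PoszD -rec IH recz.
have down (k : nat) : G (mono (pmono (- k%:Z))) = zpow f (- k%:Z).
  elim: k => [|k IH]; first exact: z0.
  apply: inj; rewrite rec recz; have -> : - k.+1%:Z + 1 = - k%:Z by lia.
  exact: IH.
by case: (n) => k; [exact: up|rewrite NegzE; exact: down].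
Qed.

Lemma S_lin h : lin (@alphaL0op K h : M -> M).
Proof. by []. Qed.

Lemma S_loc h : loc (@alphaL0op K h : M -> M).
Proof. by move=> s; eexists [:: _] => u us; rewrite /alphaL0op us // inE. Qed.

Lemma S_mono s : alphaL0op (-1) (mono s) =
  mono (Mono (malpha s + (mx s *+ 2 + (None \in modd s)%:R)) (mx s) (meven s) (modd s)).
Proof.
apply/funext => t; rewrite /alphaL0op /smono; congr (_%:R); congr nat_of_bool.
apply/eqP/eqP => [<-|->]; apply: mono_eq => //=; lia.
Qed.

(** [alphaL0op (-1)] replaces x and phi by alpha_0 x and alpha_0^{1/2} phi, and the automorphism G
    then sends these to the series being substituted. On monomials this is multiplicativity;
    continuity does the rest. *)
Lemma subst_gl G (F : M) : grouplike G ->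
  subst F (G (mono (pmono 1))) (G (mono (emono 1 1))) = G (alphaL0op (-1) F).
Proof.
move=> gG; apply/funext => t; have lG := gl_lin gG.
have lGS : lin (fun v : M => G (alphaL0op (-1) v)) by move=> c u v; rewrite S_lin lG.
rewrite (lin_loc_sum F t lGS (loc_comp (gl_loc gG) (@S_loc (-1)))) /subst.
apply: eq_fsbigr => s _; congr (_ * _).
rewrite -gl_zpow // smul_smul_smono.
set t' := Mono (malpha s) 0 (meven s) (modd s `\ None)%fset.
have St' : isS t' by rewrite /isS /= !inE.
rewrite -gl_act // S_mono.
have E0 : actK t' (mono (pmono (mx s))) =
    mono (Mono (malpha s + mx s *+ 2) (mx s) (meven s) (modd s `\ None)%fset).
  rewrite act_smono; last by rewrite mdisjC mdisj_even.
  rewrite koszul_evenr // scale1r; congr smono.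
  by apply: mono_eq; rewrite /= ?add0r ?msetD0 ?fsetU0.
rewrite E0; case: ifPn => b; last first.
  rewrite -[sone K]/(mono mono1) smul_smonol act1; congr (G (mono _) _).
  by apply: mono_eq => /=; rewrite ?addr0 //; apply/fsetDidPl; rewrite fdisjointX1.
rewrite -gl_mulE // act_smono; last by rewrite /mdisj /= fdisjoint1X !inE.
rewrite koszul_phi ?scale1r //; last by rewrite /mdisj /= fdisjoint1X !inE.
congr (G (mono _) _); apply: mono_eq; rewrite /= ?add0r ?mset0D ?fsetD1K //; lia.
Qed.

End GroupLike.

(** The indices 2j and 2j - 1 with j >= 1 run exactly once over the positive integers, so a sum over
    j of an L-term and a G-term is a sum over positive doubled weights. *)
Lemma sum_pos_weights (V : nmodType) (G : int -> V) (w : int) N : (`|w| < N)%N ->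
  (forall k, k != w -> G k = 0) ->
  \sum_(i < N) (G (i.+1.*2)%:Z + G (i.*2.+1)%:Z) = if 0 < w then G w else 0.
Proof.
move=> wN G0; case: ltP => w0; last first.
  by rewrite big1 // => i _; rewrite !G0 ?addr0 //; lia.
have iN : (`|w - 1|./2 < N)%N by lia.
rewrite (bigD1 (Ordinal iN)) //= big1 ?addr0 => [|i ii].
  have [o|e] := boolP (odd `|w|%N).
    by rewrite G0 ?add0r; [congr G|]; lia.
  by rewrite [X in _ + X]G0 ?addr0; [congr G|]; lia.
have {}ii : (i : nat) <> `|w - 1|./2 by move=> h; case/eqP: ii; exact: val_inj.
by rewrite !G0 ?addr0 //; lia.
Qed.

(** * From families of series to coefficient data *)

Section Conversion.
Variable K : numFieldType.
Local Notation M := (monomial -> K^o).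
Local Notation sgK := (idfun : {linear K^o -> K^o}).
Local Notation actK := (act sgK).
Local Notation ellS := (@ellS K).
Local Notation mono := (smono K : monomial -> M).
Local Notation EM := (ellS_module K).
Local Notation nsOpS := (nsOp sgK ellS (fun=> 0)).
Local Notation nsExpS := (nsExp sgK ellS (fun=> 0)).

(** Since t can occur in c_k for k = wt t only, the whole family can be packed into one function of
    t. *)
Definition homfam (c : int -> M) : Prop := forall k t, c k t != 0 -> isT t /\ wt t = k.

Definition posdata (c : int -> M) : monomial -> nsU K := fun t =>
  (if 0 < wt t then c (wt t) t else 0, 0).
Definition negdata (c : int -> M) : monomial -> nsU K := fun t =>
  (if wt t < 0 then c (wt t) t else 0, 0).

Lemma homfam_smul c k f s : homfam c ->
  smul (c k) f s = \sum_(u <- D s) c k u * actK u f s.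
Proof. by move=> hc; apply: smul_D => u /hc[]. Qed.

Lemma homfam0 c k t : homfam c -> k != wt t -> c k t = 0.
Proof.
by move=> hc kt; apply/eqP; apply: contraNT kt => /hc[_ ->].
Qed.

Lemma half_double (i : nat) : half (i.*2)%:Z = i%:Z.
Proof. by rewrite /half; lia. Qed.
Lemma half_Sdouble (i : nat) : half (i.*2.+1)%:Z = i%:Z.
Proof. by rewrite /half; lia. Qed.
Lemma half_Ndouble (i : nat) : half (- (i.*2)%:Z) = - i%:Z.
Proof. by rewrite /half; lia. Qed.
Lemma half_NSdouble (i : nat) : half (- (i.*2.+1)%:Z) = - i.+1%:Z.
Proof. by rewrite /half; lia. Qed.

Lemma ellS_pos (i : nat) : ellS (i.+1.*2)%:Z = @Lop K i.+1 /\ ellS (i.*2.+1)%:Z = @Gop K i.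
Proof.
by rewrite /ellS half_double half_Sdouble /oddz /= odd_double.
Qed.

Lemma ellS_neg (i : nat) : ellS (- (i.+1.*2)%:Z) = @Lop K (- i.+1%:Z) /\
  ellS (- (i.*2.+1)%:Z) = @Gop K (- i.+1%:Z).
Proof.
by rewrite /ellS half_Ndouble half_NSdouble !oddzN /oddz /= odd_double.
Qed.

Lemma sum_D_weights (c : int -> M) (sgn : bool) f s N : homfam c ->
  (forall u, u \in D s -> (`|wt u| < N)%N) ->
  let e k := if sgn then - k else k in
  \sum_(i < N) (smul (c (e (i.+1.*2)%:Z)) (ellS (e (i.+1.*2)%:Z) f) s
    + smul (c (e (i.*2.+1)%:Z)) (ellS (e (i.*2.+1)%:Z) f) s) =
  \sum_(u <- D s) (if 0 < e (wt u) then c (wt u) u * actK u (ellS (wt u) f) s else 0).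
Proof.
move=> hc uN e; under eq_bigr => i _ do rewrite !homfam_smul // -big_split.
rewrite exchange_big big_seq [RHS]big_seq; apply: eq_bigr => u us.
have ee k : e (e k) = k by rewrite /e; case: (sgn); rewrite ?opprK.
rewrite (sum_pos_weights (G := fun k => c (e k) u * actK u (ellS (e k) f) s) (w := e (wt u))).
- by rewrite ee.
- by have := uN u us; rewrite /e; case: (sgn); lia.
move=> k ku; rewrite homfam0 ?mul0r //; apply: contraNneq ku => h.
by rewrite -h ee.
Qed.

Lemma weight_bound s : exists N, forall u, u \in D s -> (`|wt u| < N)%N.
Proof.
exists (\sum_(u <- D s) `|wt u|).+1%N => u us; rewrite ltnS.
by rewrite (bigD1_seq u) ?uniq_D //= leq_addr.
Qed.

Lemma nsOp_fst x f s : (forall u, (x u).2 = 0) ->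
  nsOpS x f s = \sum_(u <- D s) (x u).1 * actK u (ellS (wt u) f) s.
Proof.
move=> x2; rewrite /nsOp /Op; apply: eq_bigr => u _.
by rewrite /nsE scaler0 addr0 actZ fZE.
Qed.

Lemma ssum_finite (F : nat -> M) s N : (forall i, (N <= i)%N -> F i s = 0) ->
  ssum F s = \sum_(i < N) F i s.
Proof. exact: fsum_ord. Qed.

Lemma smul_homfam0 c k f s : homfam c -> (forall u, u \in D s -> wt u != k) ->
  smul (c k) f s = 0.
Proof.
move=> hc ku; rewrite homfam_smul // big1_seq // => u /andP[_ /ku h].
by rewrite homfam0 ?mul0r // eq_sym.
Qed.

Lemma posop_nsOp (c : int -> M) f : homfam c ->
  posop (fun i => c (i.+1.*2)%:Z) (fun i => c (i.*2.+1)%:Z) f = nsOpS (posdata c) f.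
Proof.
move=> hc; apply/funext => s; have [N uN] := weight_bound s.
rewrite nsOp_fst // /posop (ssum_finite (N := N)).
  rewrite (eq_bigr (fun u => if 0 < wt u then c (wt u) u * actK u (ellS (wt u) f) s else 0)).
    rewrite -(sum_D_weights false f hc uN); apply: eq_bigr => i _.
    by case: (ellS_pos i) => -> ->.
  by move=> u _ /=; case: ifP; rewrite ?mul0r.
by move=> i Ni; rewrite fDE !smul_homfam0 ?addr0 // => u /uN; lia.
Qed.

Lemma negop_nsOp (c : int -> M) f : homfam c ->
  negop (fun i => c (- (i.+1.*2)%:Z)) (fun i => c (- (i.*2.+1)%:Z)) f = nsOpS (negdata c) f.
Proof.
move=> hc; apply/funext => s; have [N uN] := weight_bound s.
rewrite nsOp_fst // /negop (ssum_finite (N := N)).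
  rewrite (eq_bigr (fun u => if 0 < - wt u then c (wt u) u * actK u (ellS (wt u) f) s else 0)).
    rewrite -(sum_D_weights true f hc uN); apply: eq_bigr => i _.
    by case: (ellS_neg i) => -> ->.
  by move=> u _ /=; rewrite oppr_gt0; case: ifP; rewrite ?mul0r.
by move=> i Ni; rewrite fDE !smul_homfam0 ?addr0 // => u /uN; lia.
Qed.

Lemma expop_Exp (Y : M -> M) f : raises 1 Y -> expop Y f = Exp Y f.
Proof.
move=> rY; apply/funext => s; rewrite /expop (fsum_ord (N := (sdeg s).+1)) // => i si.
by rewrite (iter_ord f rY) ?mulr0.
Qed.

(** * Gradings *)

(** Both components are preserved by the operators of Lie algebra elements. The first extends the
    weight by -2 for x and -1 for phi; the second measures the deviation from the normalization of
    alpha_0. *)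
Definition grade (t : monomial) : int * int :=
  (wt t - (mx t *+ 2 + (None \in modd t)%:Z), malpha t - wtB t).

Definition Hom (b : int * int) (v : M) : Prop := forall t, v t != 0 -> grade t = b.

Lemma wt_mk a x e o b : None \notin o -> wt (mk a x e o b) = wt (mk 0 0 e o false).
Proof.
move=> no; rewrite /wt /mk /=; case: b => //; congr (_ + _).
by rewrite oddsumU ?fdisjoint1X // /oddsum big_seq_fset1 add0r.
Qed.

Lemma wtB_mk a x e o b : None \notin o -> wtB (mk a x e o b) = wtB (mk 0 0 e o false).
Proof.
move=> no; rewrite /wtB /mk /=; case: b => //; congr (_ + _).
by rewrite oddsumU ?fdisjoint1X // /oddsum big_seq_fset1 add0r.
Qed.

Lemma grade_mk a x e o b : None \notin o ->
  grade (mk a x e o b) =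
  (wt (mk 0 0 e o false) - (x *+ 2 + b%:Z), a - wtB (mk 0 0 e o false)).
Proof. by move=> no; rewrite /grade None_mk // wt_mk // wtB_mk. Qed.

Lemma Hom_sum b I (r : seq I) (F : I -> M) s c :
  (forall i, Hom b (F i)) -> \sum_(i <- r) c i *: F i s != 0 -> grade s = b.
Proof.
move=> hF; have [//|/eqP h] := boolP (grade s == b); first by move/eqP.
rewrite big1 ?eqxx // => i _; apply/eqP; rewrite scaler_eq0; apply/orP; right.
by apply/negPn/negP => /hF.
Qed.

Lemma Hom_act b t v : isS t -> Hom b v ->
  Hom (b.1 + wt t, b.2 + malpha t - wtB t) (actK t v).
Proof.
move=> /andP[/eqP tx tn] hv s; rewrite /act sgi_idfun; case: ifP; last by rewrite eqxx.
move=> ts; have [e d] := mdivP ts.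
have [->|/hv <- _] := eqVneq (v (msub s t)) 0; first by rewrite scaler0 eqxx.
rewrite /grade /= !inE tx tn /=.
have := wtM d; have := wtBM d; rewrite e => -> ->.
by congr pair; lia.
Qed.

Lemma Hom_ellS b k v : Hom b v -> Hom (b.1 - k, b.2) (ellS k v).
Proof.
move=> hv; elim/mk_ind => a x e o c no; rewrite ellS_mk //.
have h y c' : v (mk a y e o c') != 0 ->
    (wt (mk 0 0 e o false) - (y *+ 2 + c'%:Z), a - wtB (mk 0 0 e o false)) = b.
  by move=> /hv <-; rewrite grade_mk.
have kE : k = half k * 2 + (oddz k)%:Z.
  by case: (boolP (oddz k)) => [/half_odd|/half_even] {1}->; rewrite ?addr0.
rewrite grade_mk //; case: (boolP (oddz k)) => [ok|/negbTE ok]; rewrite ok in kE.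
  case: c => /=.
    have [->|/h <- _] := eqVneq (v (mk a (x - half k) e o false)) 0.
      by rewrite mulr0 eqxx.
    by congr pair; move: kE => /=; lia.
  have [->|/h <- _] := eqVneq (v (mk a (x - half k - 1) e o true)) 0.
    by rewrite oppr0 eqxx.
  by congr pair; move: kE => /=; lia.
have [->|/h <- _] := eqVneq (v (mk a (x - half k) e o c)) 0.
  by rewrite mulr0 eqxx.
by congr pair; move: kE => /=; lia.
Qed.

Lemma Hom_nsOp b x v : Hom b v -> Hom b (nsOpS x v).
Proof.
move=> hv s; rewrite /nsOp /Op; have [//|/eqP h] := boolP (grade s == b); first by move/eqP.
rewrite big1_seq ?eqxx // => t /andP[_ ts]; rewrite /nsE scaler0 addr0 actZ fZE.
apply/eqP; rewrite scaler_eq0; apply/orP; right; apply/negPn/negP.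
move/(Hom_act (isT_S (D_isT ts)) (Hom_ellS (k := wt t) hv)) => /= e.
apply: h; rewrite e; case/and3P: (D_isT ts) => _ _ /eqP ->.
by case: (b) => b1 b2 /=; congr pair; lia.
Qed.

Lemma Hom_Exp b Y v : (forall w, Hom b w -> Hom b (Y w)) -> Hom b v -> Hom b (Exp Y v).
Proof.
move=> hY hv s; rewrite /Exp; apply: (Hom_sum (F := fun i : 'I_(sdeg s).+1 => iter i Y v)) => i.
by elim: (i : nat) => //= n; exact: hY.
Qed.

Lemma Hom_nsExp b x v : Hom b v -> Hom b (nsExpS x v).
Proof. by apply: Hom_Exp => w; exact: Hom_nsOp. Qed.

Lemma Hom_mono t : Hom (grade t) (mono t).
Proof. by move=> s; rewrite /smono; have [->|_] := eqVneq s t; rewrite ?eqxx. Qed.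

End Conversion.

(* The variable of doubled weight k, normalized as in isT; gen 0 is junk. *)
Definition gen (k : int) : monomial :=
  match k with
  | Posz n => if odd n then Mono 0 0 mset0 [fset Some (inl n./2)]%fset
              else Mono 0 0 [mset inl n./2.-1]%mset fset0
  | Negz n => if odd n then Mono k 0 [mset inr n./2]%mset fset0
              else Mono k 0 mset0 [fset Some (inr n./2)]%fset
  end.

Lemma wt_evenvar a x v : wt (Mono a x [mset v]%mset fset0) = weven v.
Proof. by rewrite /wt /evensum /oddsum enum_msetn big_seq1 big_seq_fset0 addr0. Qed.
Lemma wt_oddvar a x v : wt (Mono a x mset0 [fset v]%fset) = wodd v.
Proof. by rewrite /wt /evensum /oddsum enum_mset0 big_nil big_seq_fset1 add0r. Qed.
Lemma wtB_evenvar a x v : wtB (Mono a x [mset v]%mset fset0) = wevenB v.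
Proof. by rewrite /wtB /evensum /oddsum enum_msetn big_seq1 big_seq_fset0 addr0. Qed.
Lemma wtB_oddvar a x v : wtB (Mono a x mset0 [fset v]%fset) = woddB v.
Proof. by rewrite /wtB /evensum /oddsum enum_mset0 big_nil big_seq_fset1 add0r. Qed.

Lemma wt_gen k : k != 0 -> wt (gen k) = k.
Proof.
case: k => n nz /=; case: ifP => on; rewrite ?wt_evenvar ?wt_oddvar /=; lia.
Qed.

Lemma isT_gen k : k != 0 -> isT (gen k).
Proof.
case: k => n nz /=; rewrite /isT; case: ifP => on /=;
  rewrite ?wtB_evenvar ?wtB_oddvar ?in_fset1 ?in_fset0 //=; lia.
Qed.

Lemma sdeg_gen k : sdeg (gen k) = 1%N.
Proof.
have ev a x (v : nat + nat) : sdeg (Mono a x [mset v]%mset fset0) = 1%N.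
  by rewrite /sdeg /= enum_msetn fset0D cardfs0.
have ov a x (v : nat + nat) : sdeg (Mono a x mset0 [fset Some v]%fset) = 1%N.
  rewrite /sdeg /= enum_mset0 (_ : (_ `\ None)%fset = [fset Some v]%fset) ?cardfs1 //.
  by apply/fsetDidPl; rewrite fdisjointX1 in_fset1.
by case: k => n /=; case: ifP => _; rewrite ?ev ?ov.
Qed.

Lemma sdeg0_wt t : sdeg t = 0%N -> wt t = 0.
Proof.
move/eqP; rewrite /sdeg addn_eq0 size_mset_eq0 cardfs_eq0 => /andP[/eqP e /eqP o].
rewrite (mkE t) o e wt_mk ?in_fset0 // /mk /wt /evensum /oddsum /= enum_mset0.
by rewrite big_nil big_seq_fset0.
Qed.

(** * Composition with K o H *)

Section HK.
Variable K : numFieldType.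
Local Notation M := (monomial -> K^o).
Local Notation sgK := (idfun : {linear K^o -> K^o}).
Local Notation actK := (act sgK).
Local Notation ellS := (@ellS K).
Local Notation mono := (smono K : monomial -> M).
Local Notation EM := (ellS_module K).
Local Notation nsOpS := (nsOp sgK ellS (fun=> 0)).
Local Notation nsExpS := (nsExp sgK ellS (fun=> 0)).

(** For k < 0 these are alpha_0^{-j} B_j and alpha_0^{-j+1/2} N_{j-1/2}, which B_j and N_{j-1/2}
    become when alpha_0^{-L_0} is moved past them. *)
Definition genfam (k : int) : M := if k == 0 then 0 else mono (gen k).

Lemma genfam_hom : homfam genfam.
Proof.
move=> k t; rewrite /genfam; case: ifPn => [_|k0]; first by rewrite f0E eqxx.
rewrite /smono; have [->|] := eqVneq t (gen k); last by rewrite eqxx.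
by rewrite isT_gen // wt_gen.
Qed.

Definition xA : monomial -> nsU K := - posdata genfam.
Definition xB : monomial -> nsU K := - negdata genfam.

Lemma posdata_ord1 (c : int -> M) : ord 1 (posdata c).
Proof.
by move=> t; rewrite ltnS leqn0 => /eqP /sdeg0_wt h; rewrite /posdata h ltxx.
Qed.
Lemma negdata_ord1 (c : int -> M) : ord 1 (negdata c).
Proof.
by move=> t; rewrite ltnS leqn0 => /eqP /sdeg0_wt h; rewrite /negdata h ltxx.
Qed.
Lemma xA_ord1 : ord 1 xA. Proof. exact: ordN (@posdata_ord1 _). Qed.
Lemma xB_ord1 : ord 1 xB. Proof. exact: ordN (@negdata_ord1 _). Qed.

Lemma varA_gen (i : nat) : varA K i = genfam (i.+1.*2)%:Z.
Proof.
rewrite /genfam /varA /gen /= odd_double.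
by congr (smono K (Mono _ _ [mset inl _]%mset _)); lia.
Qed.
Lemma varM_gen (i : nat) : varM K i = genfam (i.*2.+1)%:Z.
Proof.
rewrite /genfam /varM /gen /= odd_double /=.
by congr (smono K (Mono _ _ _ [fset Some (inl _)]%fset)); lia.
Qed.

(* Substituting alpha_0^{-k/2} v for the variable v of weight k *)
Definition ash (s : monomial) (a : int) : monomial :=
  Mono (malpha s + a) (mx s) (meven s) (modd s).
Definition rl (v : M) : M := fun s => v (ash s (wt s)).

Lemma rl_gen k : k != 0 ->
  rl (genfam k) = mono (Mono (malpha (gen k) - k) 0 (meven (gen k)) (modd (gen k))).
Proof.
move=> k0; apply/funext => s; rewrite /rl /genfam (negbTE k0) /smono.
congr (_%:R); congr nat_of_bool.
have gx : mx (gen k) = 0 by case: (k) => n /=; case: ifP.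
apply/eqP/eqP => [h|->]; last first.
  have wk := wt_gen k0; move: (gen k) gx wk => g gx wk.
  apply: mono_eq => //=.
  by rewrite -[wt _]/(wt g) wk subrK.
have wk : wt s = k by rewrite -[in RHS](wt_gen k0) -h.
apply: mono_eq => /=; rewrite -?h //=; first by rewrite wk addrK.
by rewrite -gx -h.
Qed.

(** In weight -2j, [rl] multiplies by alpha_0^j and so cancels the normalization of [gen]. *)
Lemma varB_gen (i : nat) : varB K i = rl (genfam (- (i.+1.*2)%:Z)).
Proof.
rewrite rl_gen; last lia.
have -> : - (i.+1.*2)%:Z = Negz (i.*2.+1) by lia.
rewrite /gen /= odd_double /= /varB subrr.
by congr (smono K (Mono _ _ [mset inr _]%mset _)); lia.
Qed.
Lemma varN_gen (i : nat) : varN K i = rl (genfam (- (i.*2.+1)%:Z)).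
Proof.
rewrite rl_gen; last lia.
have -> : - (i.*2.+1)%:Z = Negz (i.*2) by lia.
rewrite /gen /= odd_double /= /varN subrr.
by congr (smono K (Mono _ _ _ [fset Some (inr _)]%fset)); lia.
Qed.

Lemma rl_smul (f g : M) : rl (smul f g) = smul (rl f) (rl g).
Proof.
apply/funext => s; rewrite /rl [LHS]smul_act [RHS]smul_act.
apply: etrans (fsum_reindex (h := fun u => ash u (wt u)) (g := fun u => ash u (- wt u))
  (P := xpredT) (Q := xpredT) (F := fun u => f u * actK u g (ash s (wt s))) _ _ _) _.
- by [].
- by move=> u _; split=> //; apply: mono_eq => //=; rewrite addrK.
- by move=> u _ _; split=> //; apply: mono_eq => //=; rewrite subrK.
apply: eq_fsbigr => u _; congr (_ * _); rewrite /act !sgi_idfun.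
rewrite -[mdiv _ _]/(mdiv u s); case: ifP => // us.
have [e d] := mdivP us; congr (_ *: g _).
apply: mono_eq => //=; have := wtM d; rewrite e => ->; lia.
Qed.

Lemma rl_ellS k (f : M) : rl (ellS k f) = ellS k (rl f).
Proof.
apply/funext; elim/mk_ind => a x e o b no; rewrite /rl.
have E a' x' b' : ash (mk a' x' e o b') (wt (mk a' x' e o b')) =
    mk (a' + wt (mk 0 0 e o false)) x' e o b'.
  by rewrite (wt_mk _ _ _ _ no).
by rewrite E !ellS_mk // !E.
Qed.

Lemma rl_negop a m (f : M) :
  rl (negop a m f) = negop (fun i => rl (a i)) (fun i => rl (m i)) (rl f).
Proof.
apply/funext => s; rewrite /negop {1}/rl; apply: eq_fsbigr => i _.
rewrite -[LHS]/((rl (smul (a i) (Lop (- i.+1%:Z) f)) + rl (smul (m i) (Gop (- i.+1%:Z) f))) s).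
have [hL hG] := ellS_neg K i.
by rewrite !rl_smul -hL -hG !rl_ellS.
Qed.

Lemma negopB_rl f : negop (varB K) (varN K) (rl f) = rl (nsOpS (negdata genfam) f).
Proof.
rewrite -negop_nsOp; last exact: genfam_hom.
rewrite rl_negop.
have -> : varB K = fun i => rl (genfam (- (i.+1.*2)%:Z)) by apply/funext => i; exact: varB_gen.
by have -> : varN K = fun i => rl (genfam (- (i.*2.+1)%:Z))
  by apply/funext => i; exact: varN_gen.
Qed.

Lemma expop_rl f :
  expop (fun g => - negop (varB K) (varN K) g) (rl f) = rl (nsExpS xB f).
Proof.
rewrite /nsExp -expop_Exp; last exact: nsOp_raises EM _ _ xB_ord1.
apply/funext => s; rewrite /expop {2}/rl; apply: eq_fsbigr => k _; congr (_ * _).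
rewrite -[RHS]/(rl (iter k (nsOpS xB) f) s); congr (_ s).
elim: (k : nat) => //= j ->; rewrite negopB_rl /xB.
by rewrite (nsOpN EM).
Qed.

(** The power of alpha_0 contributed by [rl] depends on the scalar variables, that of alpha_0^{-L_0}
    on x and phi; together they depend only on the total weight, which is constant on v. *)
Lemma S_rl b (v : M) : Hom b v ->
  alphaL0op (-1) (rl v) = actK (Mono (- b.1) 0 mset0 fset0) v.
Proof.
move=> hv; apply/funext => s; rewrite act_even /mdiv msub0set fsub0set /=.
rewrite /alphaL0op /rl /=; set u := ash _ _; set u' := msub _ _.
have gu : (grade u).1 = (grade s).1 by [].
have gu' : (grade u').1 = (grade s).1.
  by rewrite /grade /= /wt /= subr0 msetB0 fsetD0.
have [h|h] := eqVneq (grade s).1 b.1.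
  congr v; apply: mono_eq => //=; rewrite ?subr0 ?msetB0 ?fsetD0 //.
  by move: h; rewrite /grade /= /wt /=; lia.
have -> : v u = 0.
  by apply/eqP; apply: contraNT h => /hv <-; rewrite gu.
by apply/esym/eqP; apply: contraNT h => /hv <-; rewrite gu'.
Qed.

Lemma wtB1 : wtB mono1 = 0.
Proof. by rewrite /wtB /evensum /oddsum enum_mset0 big_nil big_seq_fset0. Qed.

Lemma grade_x : grade (Mono 0 1 mset0 fset0) = (-2, 0).
Proof. by rewrite /grade -[wt _]/(wt mono1) -[wtB _]/(wtB mono1) wt1 wtB1 in_fset0. Qed.
Lemma rl_x : rl (xpow K 1) = xpow K 1.
Proof.
apply/funext => s; rewrite /rl /xpow /smono; congr (_%:R); congr nat_of_bool.
apply/eqP/eqP => [h|->].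
  have ws : wt s = 0.
    have -> : wt s = wt (Mono 0 1 mset0 fset0) by rewrite -h.
    exact: wt1.
  by rewrite -h; apply: mono_eq => //=; rewrite ws addr0.
by apply: mono_eq => //=; rewrite -[wt _]/(wt mono1) wt1.
Qed.

Lemma rl_phi : rl (phi K) = phi K.
Proof.
apply/funext => s; rewrite /rl /phi /smono; congr (_%:R); congr nat_of_bool.
apply/eqP/eqP => [h|->].
  have ws : wt s = 0.
    have -> : wt s = wt (Mono 0 0 mset0 [fset None]%fset) by rewrite -h.
    exact: wt_oddvar.
  by rewrite -h; apply: mono_eq => //=; rewrite ws addr0.
by apply: mono_eq => //=; rewrite wt_oddvar.
Qed.

Lemma S_x : alphaL0op (-1) (xpow K 1) = mono (pmono 1).
Proof. by rewrite /xpow S_mono; congr smono; apply: mono_eq => //=; rewrite in_fset0. Qed.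
Lemma S_phi : alphaL0op (-1) (phi K) = mono (emono 1 1).
Proof. by rewrite /phi S_mono; congr smono; apply: mono_eq => //=; rewrite in_fset1 eqxx. Qed.

(** Moving alpha_0^{-L_0} past the exponential replaces B and N by their normalized versions, those
    of [xB]. *)
Lemma S_expop_B b v : rl v = v -> Hom b v ->
  alphaL0op (-1) (expop (fun g => - negop (varB K) (varN K) g) v)
  = nsExpS xB (alphaL0op (-1) v).
Proof.
move=> rv hv; rewrite -[in LHS]rv -[in RHS]rv expop_rl.
rewrite (S_rl (Hom_nsExp (x := xB) hv)) (S_rl hv).
by rewrite (gl_act (gl_exp xB_ord1)) // /isS /= in_fset0.
Qed.

Lemma expop_A v : expop (fun g => - posop (varA K) (varM K) g) v = nsExpS xA v.
Proof.
have -> : (fun g => - posop (varA K) (varM K) g) = nsOpS xA.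
  apply/funext => g; rewrite /xA (nsOpN EM) -posop_nsOp; last exact: genfam_hom.
  have -> : varA K = fun i => genfam (i.+1.*2)%:Z by apply/funext => i; exact: varA_gen.
  by have -> : varM K = fun i => genfam (i.*2.+1)%:Z by apply/funext => i; exact: varM_gen.
by rewrite expop_Exp //; exact: nsOp_raises EM _ _ xA_ord1.
Qed.

(* Composition with K o H is e^{-X_+} alpha_0^{-L_0} e^{-X_-}, with alpha_0
   moved to the right. *)
Lemma comp_KH (F : series K * series K) :
  (Defs.comp F (Defs.comp (Kbar K) (Hbar K))).1 = nsExpS xA (nsExpS xB (alphaL0op (-1) F.1)).
Proof.
have glA := gl_exp xA_ord1; have glB := gl_exp xB_ord1.
have HE : Hbar K = (nsExpS xA (mono (pmono 1)), nsExpS xA (mono (emono 1 1))).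
  by rewrite /Hbar /mapp /= !expop_A S_x S_phi.
have KHE : Defs.comp (Kbar K) (Hbar K) =
    (nsExpS xA (nsExpS xB (mono (pmono 1))), nsExpS xA (nsExpS xB (mono (emono 1 1)))).
  rewrite HE /Defs.comp /= !(subst_gl _ glA) /Kbar /mapp /=.
  rewrite (S_expop_B rl_x (@Hom_mono K _)) (S_expop_B rl_phi (@Hom_mono K _)).
  by rewrite S_x S_phi.
rewrite KHE /Defs.comp /=; exact: (subst_gl _ (gl_comp glA glB)).
Qed.

End HK.

(** * Homogeneity of Psi *)

Section Perturbation.
Variable K : numFieldType.
Local Notation M := (monomial -> K^o).
Variable n : nat.

(* [D] and [D'] have the same coefficients below degree n. *)
Record perturbation (D D' : M -> M) : Prop := Perturbation {
  per_ord : forall i v, ord i v -> ord i.+1 (D v);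
  per_ord' : forall i v, ord i v -> ord i.+1 (D' v);
  per_agree : forall i j v v', ord i v -> ord i v' -> ord j (v - v') ->
    ord (minn j.+1 (n + i)) (D v - D' v') }.

Lemma perturbation_opp D D' : perturbation D D' ->
  perturbation (fun v => - D v) (fun v => - D' v).
Proof.
move=> [o o' a]; split=> [i v /o|i v /o'|i j v v' iv iv' jv]; try exact: ordN.
by rewrite -opprD; apply: ordN; exact: a.
Qed.

(** In degree n the change is felt only by the terms of exponents 0 and 1: from D^2 on, a change of
    degree at least n has been multiplied by a coefficient of positive degree. *)
Lemma expop_perturbation D D' v v' s : perturbation D D' -> ord n (v - v') ->
  sdeg s = n ->
  expop D v s - expop D' v' s = (v s - v' s) + (D v s - D' v' s).
Proof.
move=> [o o' a] ov sn.
have oi k : ord k (iter k D v) /\ ord k (iter k D' v').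
  by elim: k => [|k [h h']]; split; rewrite ?iterS; [exact: ord0|exact: ord0|exact: o|exact: o'].
have o1 : ord n (D v - D' v').
  have := a 0%N n v v' (ord0 _) (ord0 _) ov; rewrite addn0.
  by apply: ord_le; rewrite leq_min leqnSn leqnn.
have o2 k : ord n.+1 (iter k.+2 D v - iter k.+2 D' v').
  elim: k => [|k IH].
    have [h h'] := oi 1%N; have := a _ _ _ _ h h' o1.
    by apply: ord_le; rewrite leq_min leqnn addn1 leqnn.
  have [h h'] := oi k.+2; have := a _ _ _ _ h h' IH; rewrite -!iterS.
  by apply: ord_le; rewrite leq_min leqnSn -addn1 leq_add2l.
have E (D0 : M -> M) (w : M) : (forall k, ord k (iter k D0 w)) ->
    expop D0 w s = w s + D0 w s + \sum_(k < n) (k.+2`!%:R)^-1 * iter k.+2 D0 w s.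
  move=> h; rewrite /expop (fsum_ord (N := n.+2)) => [|k kn].
    rewrite !big_ord_recl !lift0 /= fact0 !factS fact0 !muln1 !invr1 !mul1r addrA.
    congr (_ + _).
  by rewrite h ?mulr0 // sn; exact: leq_trans _ kn.
rewrite !E => [|k|k]; try by case: (oi k).
have -> : \sum_(k < n) (k.+2`!%:R)^-1 * iter k.+2 D v s =
    \sum_(k < n) (k.+2`!%:R)^-1 * iter k.+2 D' v' s :> K.
  by apply: eq_bigr => k _; congr (_ * _); apply: ord_agree (o2 k) _; rewrite sn.
ring.
Qed.

Lemma expop_agree D D' v v' : perturbation D D' -> ord n (v - v') ->
  ord n (expop D v - expop D' v').
Proof.
move=> [o o' a] ov.
have oi k : [/\ ord k (iter k D v), ord k (iter k D' v') &
    ord n (iter k D v - iter k D' v')].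
  elim: k => [|k [h h' h'']]; first by split; [exact: ord0|exact: ord0|].
  split; rewrite ?iterS; [exact: o|exact: o'|].
  by have := a _ _ _ _ h h' h''; apply: ord_le; rewrite leq_min leqnSn leq_addr.
move=> s sn; rewrite fBE; apply/eqP; rewrite subr_eq0; apply/eqP.
rewrite /expop; apply: eq_fsbigr => k _; congr (_ * _).
by have [_ _ h] := oi k; exact: ord_agree h sn.
Qed.

Lemma act_ord' i w u s (a : K) : (0 < sdeg u)%N -> ord i w -> (sdeg s < i.+1)%N ->
  a * act (idfun : {linear K^o -> K^o}) u w s = 0.
Proof.
move=> u0 ow si; rewrite /act; case: ifP => us; rewrite ?mulr0 // ow ?sgi0 ?scaler0 ?mulr0 //.
by move: si; rewrite (sdeg_sub us); lia.
Qed.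

Lemma ord1_sdeg (a : M) u : ord 1 a -> a u != 0 -> (0 < sdeg u)%N.
Proof. by move=> oa; apply: contraNT; rewrite -leqNgt leqn0 => /eqP h; rewrite oa ?h. Qed.

Lemma smul_ord i (a w : M) : ord 1 a -> ord i w -> ord i.+1 (smul a w).
Proof.
move=> oa ow s si; rewrite smul_act fsbig1 // => u _.
have [->|/(ord1_sdeg oa) u0] := eqVneq (a u) 0; first by rewrite mul0r.
exact: act_ord' ow si.
Qed.

Lemma smul_agree i j (a a' w w' : M) s : ord 1 a -> ord 1 a' -> ord n (a - a') ->
  ord i w -> ord i w' -> ord j (w - w') -> (sdeg s < minn j.+1 (n + i))%N ->
  smul a w s = smul a' w' s.
Proof.
move=> oa oa' oaa ow ow' oww; rewrite leq_min => /andP[sj sn].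
rewrite [LHS]smul_act [RHS]smul_act; apply: eq_fsbigr => u _.
rewrite /act; case: ifP => us; last by rewrite !mulr0.
have sd := sdeg_sub us; have [u0|u0] := posnP (sdeg u); first by rewrite oa ?oa' ?u0 // !mul0r.
have -> : w (msub s u) = w' (msub s u).
  by apply: ord_agree oww _; lia.
have [un|un] := ltnP (sdeg u) n.
  by congr (_ * _); exact: ord_agree oaa un.
by rewrite ow' ?sgi0 ?scaler0 ?mulr0 //; lia.
Qed.

(* The common form of [posop] and [negop] *)
Definition sumop (a m : nat -> M) (P Q : nat -> M -> M) (f : M) : M :=
  ssum (fun i => smul (a i) (P i f) + smul (m i) (Q i f)).

Lemma perturbation_sumop a m a' m' P Q :
  (forall i, [/\ lin (P i), simlocal (P i), lin (Q i) & simlocal (Q i)]) ->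
  (forall i, [/\ ord 1 (a i), ord 1 (m i), ord 1 (a' i) & ord 1 (m' i)]) ->
  (forall i, ord n (a i - a' i) /\ ord n (m i - m' i)) ->
  perturbation (sumop a m P Q) (sumop a' m' P Q).
Proof.
move=> PQ o1 on; split=> [i v ov s si|i v ov s si|i j v v' ov ov' ovv s si].
- rewrite /sumop /ssum fsbig1 // => l _; have [oa om _ _] := o1 l.
  have [lP sP lQ sQ] := PQ l.
  by rewrite fDE !(@smul_ord i) ?addr0 //; exact: simlocal_ord.
- rewrite /sumop /ssum fsbig1 // => l _; have [_ _ oa om] := o1 l.
  have [lP sP lQ sQ] := PQ l.
  by rewrite fDE !(@smul_ord i) ?addr0 //; exact: simlocal_ord.
rewrite fBE; apply/eqP; rewrite subr_eq0; apply/eqP.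
rewrite /sumop /ssum; apply: eq_fsbigr => l _; rewrite !fDE.
have [oa om oa' om'] := o1 l; have [lP sP lQ sQ] := PQ l; have [na nm] := on l.
congr (_ + _); apply: (smul_agree (i := i) (j := j)) => //;
  try (exact: simlocal_ord); rewrite -linB //; exact: simlocal_ord.
Qed.

End Perturbation.

Section Homogeneity.
Variable K : numFieldType.
Local Notation M := (monomial -> K^o).
Local Notation sgK := (idfun : {linear K^o -> K^o}).
Local Notation actK := (act sgK).
Local Notation ellS := (@ellS K).
Local Notation mono := (smono K : monomial -> M).
Local Notation EM := (ellS_module K).
Local Notation nsOpS := (nsOp sgK ellS (fun=> 0)).
Local Notation nsExpS := (nsExp sgK ellS (fun=> 0)).
Local Notation sx := (xpow K 1 : M).

Lemma smulZr (a : M) (c : K) (g : M) : smul a (c *: g) = c *: smul a g.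
Proof.
apply/funext => s; rewrite fZE ![smul _ _ s]smul_act /GRing.scale /= mulr_fsumr.
by apply: eq_fsbigr => u _; rewrite actZ fZE /GRing.scale /= mulrCA.
Qed.

Lemma ellS_x j : ellS j sx = emulC K j 2 *: mono (emono 0 (j + 2)).
Proof.
have -> : sx = actK (emono 0 2) (sone K) by rewrite act_one.
by rewrite ellS_emono ellS_one (act0 sgK) scaler0 add0r act_one.
Qed.

Definition scalar (a : M) : Prop := forall u, a u != 0 -> isS u.

Lemma mdisj_emono t a L : isS t -> mdisj t (emono a L).
Proof.
case/andP=> _ tn; rewrite /mdisj /emono; case: oddz => /=; last by rewrite fdisjointX0.
by rewrite fdisjointX1.
Qed.

(** The powers of x and phi in ell_j x determine j, so the coefficient at t times the monomial of
    ell_k x isolates the index k. *)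
Lemma smul_ellS_x (a : M) j k t : scalar a -> isS t ->
  smul a (ellS j sx) (mono_mul t (emono 0 (k + 2))) =
  if j == k then emulC K k 2 * koszul K t (emono 0 (k + 2)) * a t else 0.
Proof.
move=> sa St; rewrite ellS_x smulZr fZE smul_smonor; set s := mono_mul _ _.
have d := mdisj_emono 0 (k + 2) St.
case: eqP => [->|jk].
  by rewrite mdivMr /s mono_mulC msubM 1?mdisjC // /GRing.scale /= mulrA mulrAC.
case: ifP => ds; last by rewrite scaler0.
have [->|/sa/andP[/eqP xs ns]] := eqVneq (a (msub s (emono 0 (j + 2)))) 0.
  by rewrite mul0r scaler0.
have jk2 : oddz (j + 2) = oddz (k + 2).
  case/andP: St => _ tn; case/andP: ds => _ /fsubsetP ds.
  move: ns ds; rewrite /s /emono /= !inE; case: (oddz (k + 2)); case: (oddz (j + 2)) => //.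
    by rewrite in_fset1 eqxx in_fset0 orbT.
  move=> _ /(_ None); rewrite in_fset1 eqxx in_fsetU in_fset0 (negbTE tn) => h.
  by have := h erefl.
have h2 : half (j + 2) = half (k + 2).
  by move: xs; case/andP: St => /eqP tx _; rewrite /s /= tx; lia.
by case: jk; move: jk2 h2; rewrite /oddz /half; lia.
Qed.

Lemma posop_x (c : int -> M) k t : (forall j, scalar (c j)) -> isS t ->
  let s := mono_mul t (emono 0 (k + 2)) in
  posop (fun i => c (i.+1.*2)%:Z) (fun i => c (i.*2.+1)%:Z) sx s =
  if 0 < k then emulC K k 2 * koszul K t (emono 0 (k + 2)) * c k t else 0.
Proof.
move=> sc St s; pose G j : K := smul (c j) (ellS j sx) s.
have G0 j : j != k -> G j = 0 by move=> jk; rewrite /G smul_ellS_x // (negbTE jk).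
rewrite /posop (ssum_finite (N := `|k|.+1)) => [|i ki].
  rewrite -[RHS]/(if 0 < k then _ else _).
  have -> : emulC K k 2 * koszul K t (emono 0 (k + 2)) * c k t = G k.
    by rewrite /G smul_ellS_x // eqxx.
  rewrite -(sum_pos_weights (ltnSn _) G0); apply: eq_bigr => i _.
  by rewrite /G; case: (ellS_pos K i) => -> ->.
case: (ellS_pos K i) => <- <-; rewrite fDE -!/(G _).
by rewrite !G0 ?addr0 //; lia.
Qed.

Lemma negop_x (c : int -> M) k t : (forall j, scalar (c j)) -> isS t ->
  let s := mono_mul t (emono 0 (k + 2)) in
  negop (fun i => c (- (i.+1.*2)%:Z)) (fun i => c (- (i.*2.+1)%:Z)) sx s =
  if k < 0 then emulC K k 2 * koszul K t (emono 0 (k + 2)) * c k t else 0.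
Proof.
move=> sc St s; pose G j : K := smul (c (- j)) (ellS (- j) sx) s.
have G0 j : j != - k -> G j = 0.
  by move=> jk; rewrite /G smul_ellS_x //; case: eqP => // h; move: jk; rewrite -h opprK eqxx.
rewrite /negop (ssum_finite (N := `|- k|.+1)) => [|i ki].
  have -> : emulC K k 2 * koszul K t (emono 0 (k + 2)) * c k t = G (- k).
    by rewrite /G opprK smul_ellS_x // eqxx.
  rewrite -oppr_gt0 -(sum_pos_weights (ltnSn _) G0); apply: eq_bigr => i _.
  by rewrite /G; case: (ellS_neg K i) => -> ->.
case: (ellS_neg K i) => <- <-; rewrite fDE -!/(G _).
by rewrite !G0 ?addr0 //; lia.
Qed.

Definition zerop (a : M) (f : M) : M := - (2%:R *:s smul a (Lop 0 f)).
Definition zerodata (c : int -> M) : monomial -> nsU K := fun t =>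
  (if wt t == 0 then 2 * c 0 t else 0, 0).

Lemma Lop0 : @Lop K 0 = ellS 0. Proof. by []. Qed.

Lemma zerop_nsOp (c : int -> M) f : homfam c -> zerop (c 0) f = nsOpS (- zerodata c) f.
Proof.
move=> hc; apply/funext => s; rewrite (nsOpN EM) fNE nsOp_fst // /zerop fNE /sscale.
rewrite Lop0 homfam_smul // mulr_sumr; congr (- _); apply: eq_bigr => u _ /=.
case: eqP => [-> |/eqP h]; first by rewrite mulrA.
by rewrite homfam0 1?eq_sym // !mul0r mulr0.
Qed.

Lemma zerodata_ord1 (c : int -> M) : ord 1 (c 0) -> ord 1 (zerodata c).
Proof. by move=> oc t t0; rewrite /zerodata oc // mulr0 if_same. Qed.

Lemma S_smul_scalar (a w : M) : scalar a ->
  alphaL0op (-1) (smul a w) = smul a (alphaL0op (-1) w).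
Proof.
move=> sa; apply/funext => s; rewrite /alphaL0op [LHS]smul_act [RHS]smul_act.
apply: eq_fsbigr => u _.
have [->|/sa/andP[/eqP ux un]] := eqVneq (a u) 0; first by rewrite !mul0r.
congr (_ * _); rewrite /act !sgi_idfun -[mdiv _ _]/(mdiv u s); case: ifP => // us.
congr (_ *: w _); apply: mono_eq => //=.
by rewrite !inE un /= ux subr0; lia.
Qed.

Lemma S_Lop0 (f : M) : alphaL0op (-1) (Lop 0 f) = Lop 0 (alphaL0op (-1) f).
Proof.
apply/funext; elim/mk_ind => a x e o b no; rewrite Lop_mk // /alphaL0op.
rewrite -[Mono _ _ _ _]/(mk (a + (-1) * (x *+ 2 + (None \in modd (mk a x e o b))%:R)) x e o b).
rewrite Lop_mk //; congr (_ * f _); apply: mono_eq => //=.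
by rewrite subr0 !None_mk.
Qed.

(** L_0 commutes with alpha_0^{-L_0}. The latter thus reaches the factor alpha_0^{L_0} of F^(2) and
    cancels it. *)
Lemma S_expop_zerop (a f : M) : scalar a ->
  alphaL0op (-1) (expop (zerop a) f) = expop (zerop a) (alphaL0op (-1) f).
Proof.
move=> sa; apply/funext => s; rewrite /expop {1}/alphaL0op.
apply: eq_fsbigr => k _; congr (_ * _).
rewrite -[LHS]/(alphaL0op (-1) (iter k (zerop a) f) s); congr (_ s).
elim: (k : nat) => //= j <-; rewrite /zerop.
by rewrite -S_Lop0 -S_smul_scalar.
Qed.

Lemma S_S (f : M) : alphaL0op (-1) (alphaL0op 1 f) = f.
Proof.
apply/funext => s; rewrite /alphaL0op /=; congr f; apply: mono_eq => //=; lia.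
Qed.

Variable Psi : int -> M.
Hypotheses (scPsi : forall k, scalar (Psi k)) (oPsi : forall k, ord 1 (Psi k)).
Hypothesis eqPsi : Fbar1 Psi = Defs.comp (Fbar2 Psi) (Defs.comp (Kbar K) (Hbar K)).

(** The part of Psi_k of the expected weight and normalization. An induction on the degree shows
    that there is no other part. *)
Definition trunc (k : int) : M := fun t => if isT t && (wt t == k) then Psi k t else 0.

Lemma trunc_hom : homfam trunc.
Proof.
move=> k t; rewrite /trunc; case: ifP => [/andP[Tt /eqP] //|]; by rewrite eqxx.
Qed.

Lemma trunc_scalar k : scalar (trunc k).
Proof. by move=> t /trunc_hom[/isT_S]. Qed.
Lemma trunc_ord1 k : ord 1 (trunc k).
Proof. by move=> t t0; rewrite /trunc oPsi // if_same. Qed.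

Lemma ellS_pieces (i : nat) (e : bool) : let s (k : int) := if e then - k else k in
  [/\ lin (ellS (s (i.+1.*2)%:Z)), simlocal (ellS (s (i.+1.*2)%:Z)),
      lin (ellS (s (i.*2.+1)%:Z)) & simlocal (ellS (s (i.*2.+1)%:Z))].
Proof. by split; first [exact: ellS_lin|exact: ellS_local]. Qed.

Section Step.
Variable n : nat.
Hypothesis n0 : (0 < n)%N.
Hypothesis IH : forall k, ord n (Psi k - trunc k).

Lemma negop_perturbation : perturbation n
  (negop (Psi_neg_even Psi) (Psi_neg_odd Psi))
  (negop (fun i => trunc (- (i.+1.*2)%:Z)) (fun i => trunc (- (i.*2.+1)%:Z))).
Proof.
apply: perturbation_sumop => i; last by split; exact: IH.
  by have := ellS_pieces i true; case: (ellS_neg K i) => /= -> ->.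
by split; first [exact: oPsi|exact: trunc_ord1].
Qed.

Lemma posop_perturbation : perturbation n
  (posop (Psi_pos_even Psi) (Psi_pos_odd Psi))
  (posop (fun i => trunc (i.+1.*2)%:Z) (fun i => trunc (i.*2.+1)%:Z)).
Proof.
apply: perturbation_sumop => i; last by split; exact: IH.
  by have := ellS_pieces i false; case: (ellS_pos K i) => /= -> ->.
by split; first [exact: oPsi|exact: trunc_ord1].
Qed.

Lemma zerop_perturbation : perturbation n (zerop (Psi 0)) (zerop (trunc 0)).
Proof.
have lL := @ellS_lin K 0; have sL := @ellS_local K 0.
split=> [i v ov|i v ov|i j v v' ov ov' ovv s si].
- by apply: ordN; apply: (ordZ (2%:R)); apply: smul_ord => //; exact: simlocal_ord.
- apply: ordN; apply: (ordZ (2%:R)); apply: smul_ord; first exact: trunc_ord1.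
  exact: simlocal_ord.
rewrite fBE /zerop !fNE /sscale (@smul_agree K n i j _ (trunc 0) _ (Lop 0 v')) ?subrr //;
  try (exact: simlocal_ord); first exact: trunc_ord1.
by rewrite -(linB lL); exact: simlocal_ord.
Qed.

(** In degree n, the difference a - a', of order n, only meets the part of degree 0 of w, which is
    that of L_0 x. *)
Lemma smul_top (a a' w w' : M) k t (s := mono_mul t (emono 0 (k + 2))) :
  isS t -> sdeg s = n -> ord 1 a -> (forall u, a' u != 0 -> isT u) -> ord 1 a' ->
  ord n (a - a') -> ord 1 (w - ellS 0 sx) -> ord n (w - w') ->
  smul a w s = smul a' w' s + smul (a - a') (ellS 0 sx) s.
Proof.
move=> St sn oa Ta' oa' oaa ow ww'; set w0 := ellS 0 sx.
have T u : a u * actK u w s = a' u * actK u w' s + (a - a') u * actK u w0 s.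
  rewrite /act; case: ifP => us; last by rewrite !mulr0 addr0.
  have sd := sdeg_sub us; rewrite sn in sd.
  have [u0|u0] := posnP (sdeg u); first by rewrite fBE oa ?oa' ?u0 // subrr !mul0r addr0.
  have [un|un] := ltnP (sdeg u) n.
    rewrite (ord_agree oaa un) fBE (ord_agree oaa un) subrr mul0r addr0.
    by congr (_ * (_ *: sgi _ _ _)); apply: ord_agree ww' _; lia.
  have m0 : sdeg (msub s u) = 0%N by lia.
  have -> : w' (msub s u) = w (msub s u).
    by apply/esym; apply: ord_agree ww' _; rewrite m0.
  have -> : w0 (msub s u) = w (msub s u).
    by apply/esym; apply: ord_agree ow _; rewrite m0.
  by rewrite -mulrDl fBE addrC subrK.
(* Since a need not be normalized, one more left factor can contribute: s divided by the monomial of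
   L_0 x. *)
pose r := undup (msub s (emono 0 (0 + 2)) :: D s).
have r1 u : u \notin r -> a' u * actK u w' s = 0.
  rewrite mem_undup inE negb_or mem_D negb_and => /andP[_ /orP[uT|us]].
    by have [->|/Ta'] := eqVneq (a' u) 0; rewrite ?mul0r // (negbTE uT).
  by rewrite /act (negbTE us) mulr0.
have r2 u : u \notin r -> (a - a') u * actK u w0 s = 0.
  rewrite mem_undup inE negb_or => /andP[ue _]; rewrite /w0 ellS_x actZ fZE /act.
  case: ifP => us; rewrite ?scaler0 ?mulr0 // /smono; case: eqP => [h|_].
    by move: ue; rewrite -h msubK // eqxx.
  by rewrite sgi0 !scaler0 mulr0.
rewrite ![smul _ _ s]smul_act !(fsum_seq (r := r)) ?undup_uniq //.
  by rewrite -big_split; apply: eq_bigr => u _; exact: T.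
by move=> u ur; rewrite T r1 ?r2 ?addr0.
Qed.

(** Truncating Psi changes both sides of the equation in degree n by linear terms. At s, the product
    of t and the monomial of ell_k x, the change is a nonzero multiple of [Psi k t - trunc k t]. The
    truncated sides are homogeneous of the grade of x; if they differ at s, then s has this grade
    and t was not truncated. *)
Lemma Psi_hom_step k : ord n.+1 (Psi k - trunc k).
Proof.
move=> t; rewrite ltnS leq_eqVlt => /orP[/eqP tn|]; last exact: IH.
rewrite fBE; have [->|neq] := eqVneq (Psi k t) (trunc k t); first by rewrite subrr.
have Pt : Psi k t != 0.
  by apply: contraNneq neq => h; rewrite /trunc h if_same.
have St := scPsi Pt; pose s := mono_mul t (emono 0 (k + 2)).
have d := mdisj_emono 0 (k + 2) St.
have sn : sdeg s = n.
  rewrite /s sdegM // tn /sdeg /emono /= enum_mset0; case: oddz => /=.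
    by rewrite fsetDv cardfs0 !addn0.
  by rewrite mem_fsetD1 ?in_fset0 // cardfs0 !addn0.
pose D : K := emulC K k 2 * koszul K t (emono 0 (k + 2)) * (Psi k t - trunc k t).
have D0 : D != 0.
  rewrite /D !mulf_eq0 !negb_or subr_eq0 neq andbT; apply/andP; split.
    have [h2 z2] : half 2 = 1 /\ oddz 2 = false by [].
    rewrite /emulC h2 z2; case: (oddz k); rewrite ?mul0r ?addr0 ?oppr_eq0;
      exact: oner_neq0.
  by apply/eqP => h; have := koszul_sq K d; rewrite h mul0r => /esym/eqP; rewrite oner_eq0.
pose N := expop (negop (Psi_neg_even Psi) (Psi_neg_odd Psi)) sx.
pose N' := expop (negop (fun i => trunc (- (i.+1.*2)%:Z)) (fun i => trunc (- (i.*2.+1)%:Z))) sx.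
pose V := expop (fun f => - posop (Psi_pos_even Psi) (Psi_pos_odd Psi) f) sx.
pose V' := expop (fun f => - posop (fun i => trunc (i.+1.*2)%:Z)
  (fun i => trunc (i.*2.+1)%:Z) f) sx.
pose U := expop (zerop (Psi 0)) V; pose U' := expop (zerop (trunc 0)) V'.
have oxx : ord n (sx - sx) by rewrite subrr.
have dN : N s - N' s = if k < 0 then D else 0.
  rewrite (expop_perturbation negop_perturbation oxx sn) subrr add0r.
  rewrite (negop_x k scPsi St) (negop_x k trunc_scalar St) -/s.
  by case: ifP; rewrite ?subrr // /D mulrBr.
have pV := perturbation_opp posop_perturbation.
have dV : V s - V' s = - (if 0 < k then D else 0).
  rewrite (expop_perturbation pV oxx sn) subrr add0r -opprD.
  rewrite (posop_x k scPsi St) fNE (posop_x k trunc_scalar St) -/s.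
  by case: ifP; rewrite ?subrr // /D mulrBr.
have oV : ord n (V - V') by exact: expop_agree pV oxx.
have V'E : V' = nsExpS (- posdata trunc) sx.
  rewrite /V' /nsExp -expop_Exp; last by apply: (nsOp_raises EM); apply: ordN; exact: posdata_ord1.
  congr (expop _ _); apply/funext => f; rewrite (nsOpN EM) -posop_nsOp //.
  exact: trunc_hom.
have oVx : ord 1 (V - sx).
  have -> : V - sx = (V - V') + (V' - sx) by rewrite addrA subrK.
  apply: ordD; first exact: ord_le n0 oV.
  have [_ r] := nsExp_unip EM (ordN (@posdata_ord1 K trunc)).
  by have [_ /(_ 0%N sx (ord0 _))] := r; rewrite -V'E.
have dU : U s - U' s = - ((if 0 < k then D else 0) + 2 * (if k == 0 then D else 0)).
  rewrite (expop_perturbation zerop_perturbation oV sn) dV opprD; congr (_ + _).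
  have lL := @ellS_lin K 0; have sL := @ellS_local K 0.
  rewrite /zerop !fNE -opprD /sscale Lop0.
  rewrite (smul_top St sn (oPsi 0) _ (@trunc_ord1 0) (@IH 0) (w' := ellS 0 V')).
  - rewrite mulrDr addrAC subrr add0r; congr (- (_ * _)).
    rewrite (smul_ellS_x _ k); last exact: St.
      rewrite eq_sym; case: eqP => [k0|] //.
      by rewrite /D k0 fBE.
    by move=> u; rewrite fBE; have [->|/scPsi //] := eqVneq (Psi 0 u) 0;
      rewrite sub0r oppr_eq0 => /trunc_scalar.
  - by move=> u /trunc_hom[].
  - by rewrite -(linB lL); exact: simlocal_ord.
  - by rewrite -(linB lL); exact: simlocal_ord.
pose G v := nsExpS (xA K) (nsExpS (xB K) v).
have uG : unip G by exact: (unip_comp (nsExp_unip EM (@xA_ord1 K)) (nsExp_unip EM (@xB_ord1 K))).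
have NG : N = G U.
  have := congr1 fst eqPsi; rewrite comp_KH /= => e; rewrite /N e /G; congr (nsExpS _ (nsExpS _ _)).
  rewrite -[LHS]/(alphaL0op (-1) (expop (zerop (Psi 0)) (alphaL0op 1 V))).
  by rewrite S_expop_zerop // S_S.
have dG : G U s - G U' s = U s - U' s.
  have oU : ord n (U - U') by exact: expop_agree zerop_perturbation oV.
  case: uG => [[lG _] [_ rG]]; have := rG _ _ oU s; rewrite add1n sn ltnSn => /(_ erefl).
  by rewrite fBE (linB lG) fBE [X in _ - X]fBE => /eqP; rewrite subr_eq0 => /eqP.
have hx : Hom (-2, 0) sx by rewrite -grade_x; exact: Hom_mono.
have N'E : N' = nsExpS (negdata trunc) sx.
  rewrite /N' /nsExp -expop_Exp; last by apply: (nsOp_raises EM); exact: negdata_ord1.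
  by congr (expop _ _); apply/funext => f; rewrite -negop_nsOp //; exact: trunc_hom.
have U'E : U' = nsExpS (- zerodata trunc) V'.
  rewrite /U' /nsExp -expop_Exp; last first.
    by apply: (nsOp_raises EM); apply: ordN; apply: zerodata_ord1; exact: trunc_ord1.
  by congr (expop _ _); apply/funext => f; rewrite zerop_nsOp //; exact: trunc_hom.
have hN' : Hom (-2, 0) N' by rewrite N'E; exact: Hom_nsExp.
have hGU' : Hom (-2, 0) (G U') by rewrite /G U'E V'E; do !apply: Hom_nsExp.
have gs : grade s = (-2, 0).
  (* As N = G U, the difference is -D, from the negative part if k < 0 and from the positive part if
     k > 0, and -2 D if k = 0, because of the factor 2 in e^{-2 Psi_0 L_0}. *)
  have : N' s - G U' s != 0.
    have : (N' s - G U' s) = - ((N s - N' s) - (G U s - G U' s)) by rewrite NG; ring.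
    move=> ->; rewrite dG dU dN opprK oppr_eq0.
    case: ltgtP => _; rewrite ?mulr0 ?addr0 ?add0r //.
    by rewrite mulf_neq0 // pnatr_eq0.
  have [h|/hN' //] := eqVneq (N' s) 0.
  by rewrite h sub0r oppr_eq0 => /hGU'.
have wem : wt (emono 0 (k + 2)) = 0 /\ wtB (emono 0 (k + 2)) = 0.
  by rewrite /emono; case: oddz; rewrite ?wt_oddvar ?wtB_oddvar //;
    rewrite -[wt _]/(wt mono1) -[wtB _]/(wtB mono1) wt1 wtB1.
have [w0 wB0] := wem.
have kh : k + 2 = half (k + 2) * 2 + (oddz (k + 2))%:Z.
  by case: (boolP (oddz (k + 2))) => [/half_odd|/half_even] {1}->; rewrite ?addr0.
have ns : (None \in modd s) = oddz (k + 2).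
  case/andP: St => _ tn'; rewrite /s /emono /= in_fsetU (negbTE tn').
  by case: oddz; rewrite ?in_fset1 ?in_fset0.
(* The two components of the grade say that t has weight k and that its power of alpha_0 is
   normalized. *)
move: gs; rewrite /grade ns /s wtM // wtBM // w0 wB0 /= => -[g1 g2].
case/andP: (St) => /eqP tx tn'.
have Tt : isT t && (wt t == k).
  rewrite /isT tx tn' /=; apply/andP; split; apply/eqP; first lia.
  by move: g1; rewrite tx; move: kh; case: oddz; lia.
by move: neq; rewrite /trunc Tt eqxx.
Qed.

End Step.

Lemma Psi_hom : homfam Psi.
Proof.
have H n k : ord n.+1 (Psi k - trunc k).
  elim: n k => [|n IH] k; last exact: Psi_hom_step.
  by apply: ordB; [exact: oPsi|exact: trunc_ord1].
have -> : Psi = trunc.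
  apply/funext => k; apply/eqP; rewrite -subr_eq0; apply/eqP.
  by apply: ord_eq0 => -[|n]; [exact: ord0|exact: H].
exact: trunc_hom.
Qed.

Lemma Psi_factorization :
  nsExpS (negdata Psi) sx =
  nsExpS (xA K) (nsExpS (xB K) (nsExpS (- zerodata Psi) (nsExpS (- posdata Psi) sx))).
Proof.
have hP := Psi_hom; have := congr1 fst eqPsi; rewrite comp_KH /=.
rewrite -[X in alphaL0op (-1) X]/(expop (zerop (Psi 0)) (alphaL0op 1
  (expop (fun f => - posop (Psi_pos_even Psi) (Psi_pos_odd Psi) f) sx))).
rewrite S_expop_zerop // S_S.
have -> : negop (Psi_neg_even Psi) (Psi_neg_odd Psi) = nsOpS (negdata Psi).
  by apply/funext => f; exact: negop_nsOp.
have -> : (fun f => - posop (Psi_pos_even Psi) (Psi_pos_odd Psi) f) = nsOpS (- posdata Psi).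
  by apply/funext => f; rewrite (nsOpN EM) -posop_nsOp.
have -> : zerop (Psi 0) = nsOpS (- zerodata Psi).
  by apply/funext => f; exact: zerop_nsOp.
by rewrite !expop_Exp //; apply: (nsOp_raises EM);
  first [apply: ordN; apply: zerodata_ord1; exact: oPsi
        |apply: ordN; exact: posdata_ord1|exact: negdata_ord1].
Qed.

End Homogeneity.

(** * The factorization for Psi *)

Section Faithful.
Variable K : numFieldType.
Local Notation M := (monomial -> K^o).
Local Notation sgK := (idfun : {linear K^o -> K^o}).
Local Notation actK := (act sgK).
Local Notation ellS := (@ellS K).
Local Notation mono := (smono K : monomial -> M).
Local Notation EM := (ellS_module K).
Local Notation nsOpS := (nsOp sgK ellS (fun=> 0)).
Local Notation nsExpS := (nsExp sgK ellS (fun=> 0)).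
Local Notation sx := (xpow K 1 : M).

Lemma emulC2_neq0 k : emulC K k 2 != 0.
Proof.
have [h2 z2] : half 2 = 1 /\ oddz 2 = false by [].
by rewrite /emulC h2 z2; case: (oddz k); rewrite ?mul0r ?addr0 ?oppr_eq0; exact: oner_neq0.
Qed.

Lemma koszul_neq0 s t : mdisj s t -> koszul K s t != 0.
Proof.
move=> d; apply/eqP => h; have := koszul_sq K d; rewrite h mul0r => /esym/eqP.
by rewrite oner_eq0.
Qed.

(** ell_k x is a nonzero multiple of one monomial in x and phi. At the product of t with that
    monomial for k = wt t, only t contributes: the remaining variables identify the divisor, and
    normalization fixes its power of alpha_0. *)
Lemma nsOpS_faithful x t : nsOpS x sx = 0 -> isT t -> (x t).1 = 0.
Proof.
move=> x0 Tt; pose s := mono_mul t (emono 0 (wt t + 2)).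
have dj u L : isT u -> mdisj u (emono 0 L) by move=> /isT_S; exact: mdisj_emono.
have ts : t \in D s by rewrite mem_D Tt mdivM.
have : \sum_(u <- D s) (x u).1 * actK u (ellS (wt u) sx) s = 0.
  rewrite -[RHS](congr1 (fun f : M => f s) x0); apply: eq_bigr => u _.
  by rewrite /nsE scaler0 addr0 actZ fZE.
rewrite (bigD1_seq t) ?uniq_D //=.
have E u : u \in D s -> (x u).1 * actK u (ellS (wt u) sx) s =
    if u == t then (x t).1 * (emulC K (wt t) 2 * koszul K t (emono 0 (wt t + 2))) else 0.
  move=> us; have Tu := D_isT us.
  rewrite ellS_x actZ fZE act_smono ?dj // fZE /smono.
  case: eqP => [h|]; last first.
    move=> h; rewrite ifF ?scaler0 ?mulr0 //; apply/eqP => ut; apply: h.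
    by rewrite ut.
  have -> : u = t.
    have em L : meven (emono 0 L) = mset0 /\ (modd (emono 0 L) `\ None = fset0)%fset.
      rewrite /emono /=; split=> //; case: oddz; rewrite ?fsetDv //.
      by rewrite mem_fsetD1 ?in_fset0.
    have me : meven u = meven t.
      by have := congr1 meven h; rewrite /s /= !msetD0.
    have mo : modd u = modd t.
      have := congr1 (fun w => (modd w `\ None)%fset) h; rewrite /s /= !fsetDUl.
      have [[_ e1] [_ e2]] := (em (wt t + 2), em (wt u + 2)).
      rewrite e1 e2 !fsetU0 !mem_fsetD1 //; first by case/and3P: Tu.
      by case/and3P: Tt.
    case/and3P: Tu => /eqP xu _ /eqP au; case/and3P: Tt => /eqP xt _ /eqP at'.
    by apply: mono_eq; rewrite ?xu ?xt // au at' /wtB me mo.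
  by rewrite eqxx /GRing.scale /= mulr1.
rewrite big_seq_cond big1 ?addr0; last by move=> u /andP[us /negbTE ut]; rewrite E // ut.
rewrite E // eqxx => /eqP; rewrite !mulf_eq0 (negbTE (emulC2_neq0 _)).
by rewrite (negbTE (koszul_neq0 (dj _ _ Tt))) !orbF => /eqP.
Qed.

Lemma Theta_x : Theta sx = 0.
Proof.
apply/funext => s; rewrite /Theta /xpow /smono; case: eqP => [->|_]; last by rewrite scaler0.
by rewrite /sdeg /= enum_mset0 fset0D cardfs0 scale0r.
Qed.

Variable Psi : int -> M.
Hypotheses (scPsi : forall k, scalar (Psi k)) (oPsi : forall k, ord 1 (Psi k)).
Hypothesis eqPsi : Fbar1 Psi = Defs.comp (Fbar2 Psi) (Defs.comp (Kbar K) (Hbar K)).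

Definition Gamma_of : monomial -> K :=
  gamma (xA K) (xB K) (zerodata Psi) (posdata Psi) (negdata Psi).

Lemma defect_Psi t : isT t ->
  (defect (xA K) (xB K) (zerodata Psi) (posdata Psi) (negdata Psi) t).1 = 0.
Proof.
apply: (defect_central (xA_ord1 K) (xB_ord1 K) (zerodata_ord1 (oPsi 0))
  (@posdata_ord1 K Psi) (@negdata_ord1 K Psi) EM Theta_x).
  by move=> x h u Tu; exact: nsOpS_faithful h Tu.
exact: Psi_factorization scPsi oPsi eqPsi.
Qed.

(** The change of module: centrality of the defect is a statement on coefficients, proved with
    vector fields and used here in any module. *)
Lemma Gamma_factorization (V : lmodType K) (sg : {linear V -> V}) ell dd v :
  nsmodule sg ell dd ->
  nsExp sg ell dd (xA K) (nsExp sg ell dd (xB K) v) =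
  nsExp sg ell dd (negdata Psi) (nsExp sg ell dd (posdata Psi)
    (nsExp sg ell dd (zerodata Psi) (nsExp sg ell dd (fun t => (0, Gamma_of t : K^o)) v))).
Proof.
move=> EV; exact: (factorization (xA_ord1 K) (xB_ord1 K) (zerodata_ord1 (oPsi 0))
  (@posdata_ord1 K Psi) (@negdata_ord1 K Psi) EV defect_Psi).
Qed.

End Faithful.

(** * The Neveu-Schwarz module of series with coefficients in U_P(ns) *)

Section UPRelations.
Variable K : numFieldType.
Local Notation U := (UP K).

Lemma toUP_cst (c : K) (u : U) : toUP (Cst c) * u = c *: u.
Proof. by rewrite toUPC -scalerAl mul1r. Qed.

Lemma UP_LL m n : UL K m * UL K n = UL K n * UL K m + (m%:~R - n%:~R) *: UL K (m + n)
  + (if m + n == 0 then (m%:~R ^+ 3 - m%:~R) / 12%:R else 0) *: Ud K.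
Proof.
have /cong_rel/toUPP := rel_LL K m n.
by rewrite !(toUPD, toUPM, toUP_cst) addrA.
Qed.

Lemma UP_GL m n : UG K m * UL K n = UL K n * UG K m
  + (m%:~R - (n%:~R - 1) / 2%:R) *: UG K (m + n).
Proof.
have /cong_rel/toUPP := rel_GL K m n.
by rewrite !(toUPD, toUPM, toUP_cst).
Qed.

Lemma UP_GG m n : UG K m * UG K n = - (UG K n * UG K m) + 2%:R *: UL K (m + n + 1)
  + (if m + n + 1 == 0 then (m%:~R ^+ 2 + m%:~R) / 3%:R else 0) *: Ud K.
Proof.
have /cong_rel/toUPP := rel_GG K m (n + 1).
rewrite !(toUPD, toUPM, toUP_cst) addrK (addrA m) => e.
by rewrite -addrA -e addrC addrK.
Qed.

Lemma UP_dL m : Ud K * UL K m = UL K m * Ud K.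
Proof. by have /cong_rel/toUPP := rel_dL K m; rewrite !toUPM. Qed.
Lemma UP_dG m : Ud K * UG K m = UG K m * Ud K.
Proof. by have /cong_rel/toUPP := rel_dG K m; rewrite !toUPM. Qed.
Lemma UP_Pd i : UPr K i * Ud K = Ud K * UPr K i.
Proof. by have /cong_rel/toUPP := rel_Pd K i; rewrite !toUPM. Qed.
Lemma UP_PL i m : UPr K i * UL K m = UL K m * UPr K (i + m *+ 2).
Proof. by have /cong_rel/toUPP := rel_PL K i m; rewrite !toUPM. Qed.
Lemma UP_PG i m : UPr K i * UG K m = UG K m * UPr K (i + m *+ 2 + 1).
Proof.
have /cong_rel/toUPP := rel_PG K i (m + 1); rewrite !toUPM addrK => ->.
by congr (_ * UPr K _); lia.
Qed.
Lemma UP_PP i j : UPr K i * UPr K j = if i == j then UPr K i else 0.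
Proof.
have /cong_rel/toUPP := rel_PP K i j; rewrite !toUPM => ->.
by case: ifP => // _; rewrite toUPC scale0r.
Qed.

Lemma parity_invD : {morph @parity_inv K : u v / u + v}.
Proof.
elim/UPind => s; elim/UPind => t; rewrite -toUPD !parity_invE /= toUPD.
by rewrite -!parity_invE.
Qed.
Lemma parity_invM : {morph @parity_inv K : u v / u * v}.
Proof.
elim/UPind => s; elim/UPind => t; rewrite -toUPM !parity_invE /= toUPM.
by rewrite -!parity_invE.
Qed.
Lemma parity_inv_lin : linear (@parity_inv K).
Proof.
move=> c u v; rewrite parity_invD; congr (_ + _).
rewrite -!(toUP_cst c) parity_invM; congr (_ * _).
by rewrite parity_invE.
Qed.
HB.instance Definition _ := GRing.isLinear.Build K U U _ (@parity_inv K) parity_inv_lin.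

Definition sgU : {linear U -> U} := @parity_inv K.

Lemma parity_inv_L m : parity_inv (UL K m) = UL K m. Proof. exact: parity_invE. Qed.
Lemma parity_inv_G m : parity_inv (UG K m) = - UG K m.
Proof. by rewrite parity_invE /= toUPM toUP_cst scaleN1r. Qed.
Lemma parity_inv_d : parity_inv (Ud K) = Ud K. Proof. exact: parity_invE. Qed.
Lemma parity_inv_P k : parity_inv (UPr K k) = UPr K k. Proof. exact: parity_invE. Qed.

Definition UE (k : int) : U := if oddz k then UG K (half k) else UL K (half k).

Lemma UE_comm k l : UE k * UE l = (-1) ^+ (oddz k && oddz l) *: (UE l * UE k)
  + nsB K k l *: UE (k + l) + (if k + l == 0 then nsD K k else 0) *: Ud K.
Proof.
rewrite /UE /nsB /nsD oddzD.
case: (boolP (oddz k)) => [/half_odd|/half_even]; move: (half k) => m ->;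
  case: (boolP (oddz l)) => [/half_odd|/half_even]; move: (half l) => n -> /=.
- have -> : half (m * 2 + 1 + (n * 2 + 1)) = m + n + 1 by rewrite /half; lia.
  rewrite UP_GG scaleN1r; congr (_ + _ + _ *: _).
  have -> : (m * 2 + 1 + (n * 2 + 1) == 0) = (m + n + 1 == 0) by lia.
  by case: ifP => // _; rewrite intrD intrM; field.
- have -> : half (m * 2 + 1 + n * 2) = m + n by rewrite /half; lia.
  rewrite UP_GL scale1r ifF ?scale0r ?addr0; last lia.
  by congr (_ + _ *: _); rewrite intrD !intrM; field.
- have -> : half (m * 2 + (n * 2 + 1)) = m + n by rewrite /half; lia.
  rewrite UP_GL scale1r ifF ?scale0r ?addr0; last lia.
  rewrite -addrA (addrC n) -scalerDl -[LHS]addr0; congr (_ + _).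
  by rewrite [X in X *: _](_ : _ = 0) ?scale0r // intrD !intrM; field.
- have -> : half (m * 2 + n * 2) = m + n by rewrite /half; lia.
  rewrite UP_LL scale1r; congr (_ + _ *: _ + _ *: _); first by rewrite !intrM; field.
  have -> : (m * 2 + n * 2 == 0) = (m + n == 0) by lia.
  by case: ifP => // _; rewrite intrM; field.
Qed.

Lemma UE_d k : Ud K * UE k = UE k * Ud K.
Proof. by rewrite /UE; case: oddz; rewrite ?UP_dG ?UP_dL. Qed.

Lemma parity_inv_UE k : parity_inv (UE k) = (-1) ^+ oddz k *: UE k.
Proof. by rewrite /UE; case: oddz; rewrite ?parity_inv_G ?parity_inv_L ?scaleN1r ?scale1r. Qed.

Lemma UP_PE i k : UPr K i * UE k = UE k * UPr K (i + k).
Proof.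
rewrite /UE; case: (boolP (oddz k)) => [/half_odd|/half_even] h.
  by rewrite UP_PG; congr (_ * UPr K _); lia.
by rewrite UP_PL; congr (_ * UPr K _); lia.
Qed.

Definition ellU (k : int) (v : monomial -> U) : monomial -> U := fun s => UE k * v s.
Definition ddU (v : monomial -> U) : monomial -> U := fun s => Ud K * v s.

Lemma sgi_mul n (a u : U) (b : bool) : parity_inv a = (-1) ^+ b *: a ->
  a * sgi sgU n u = (-1) ^+ (b && odd n) *: sgi sgU n (a * u).
Proof.
move=> pa; elim: n => [|n IH]; first by rewrite andbF scale1r.
rewrite /sgi /= -!/(sgi _ _ _).
have e : parity_inv (a * sgi sgU n u) = (-1) ^+ b *: (a * parity_inv (sgi sgU n u)).
  by rewrite parity_invM pa scalerAl.
move: e; rewrite IH linearZ /= => e.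
rewrite -[LHS]scale1r -(sqrr_sign K b) expr2 -scalerA -e scalerA; congr (_ *: _).
by case: b {pa e IH}; case: (odd n); rewrite /= ?expr0 ?expr1; ring.
Qed.

Lemma mul_act t (a : U) v (b : bool) : parity_inv a = (-1) ^+ b *: a ->
  (fun s => a * act sgU t v s) = (-1) ^+ (b && odd #|` modd t|) *: act sgU t (fun s => a * v s).
Proof.
move=> pa; apply/funext => s; rewrite fZE /act; case: ifP => h; last by rewrite mulr0 scaler0.
by rewrite -scalerAr (sgi_mul _ _ pa) !scalerA mulrC.
Qed.

Lemma mul_simlocal (a : U) : simlocal (fun v s => a * v s).
Proof.
move=> s; exists [:: s]; split=> [s'|u h]; first by rewrite inE => /eqP ->.
by rewrite h ?mulr0 ?inE.
Qed.

Lemma mul_lin (a : U) : lin (fun (v : monomial -> U) s => a * v s).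
Proof. by move=> c u v; apply/funext => s; rewrite !(fDE, fZE) mulrDr -scalerAr. Qed.

Lemma ellU_module : nsmodule sgU ellU ddU.
Proof.
split=> [k|k|k t v St|||t v St|k l v|k v].
- exact: mul_lin.
- exact: mul_simlocal.
- by rewrite /ellU (mul_act _ _ (parity_inv_UE k)) oddz_wt.
- exact: mul_lin.
- exact: mul_simlocal.
- by rewrite /ddU (@mul_act _ _ _ false) ?scale1r // parity_inv_d.
- apply/funext => s; rewrite !(fDE, fZE) /ellU /ddU !mulrA UE_comm.
  by rewrite !mulrDl -!scalerAl.
- by apply/funext => s; rewrite /ellU /ddU !mulrA UE_d.
Qed.

End UPRelations.

(** * Exponentials as left multiplications *)

Section Kernels.
Variable K : numFieldType.
Local Notation U := (UP K).
Local Notation M := (monomial -> U).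
Local Notation EU := (ellU_module K).
Local Notation nsOpU := (nsOp (sgU K) (@ellU K) (@ddU K)).
Local Notation nsExpU := (nsExp (sgU K) (@ellU K) (@ddU K)).
Local Notation sgiU := (sgi (sgU K)).

(** Left multiplication by a series over U_P(ns) supported on normalized monomials. The parity
    involution moves the coefficient of v to the left of u. *)
Definition kop (kap v : M) : M := fun t =>
  \sum_(u <- D t) koszul K u (msub t u) *: (kap u * sgiU #|` modd u| (v (msub t u))).

Definition del (p : U) : M := fun t => if t == mono1 then p else 0.
Definition suppT (v : M) : Prop := forall t, v t != 0 -> isT t.

Lemma suppT0 v t : suppT v -> ~~ isT t -> v t = 0.
Proof. by move=> sv; apply: contraNeq => /sv. Qed.

Lemma mono1_T : isT mono1. Proof. exact: D_isT (mono1_D mono1). Qed.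

Lemma sgiM n (u v : U) : sgiU n (u * v) = sgiU n u * sgiU n v.
Proof. by elim: n => //= n IH; rewrite /sgi /= -!/(sgi _ _ _) IH; exact: parity_invM. Qed.
Lemma sgi_fix n (u : U) : parity_inv u = u -> sgiU n u = u.
Proof. by move=> pu; elim: n => //= n IH; rewrite /sgi /= -!/(sgi _ _ _) IH. Qed.
Lemma sgi_P n k : sgiU n (UPr K k) = UPr K k.
Proof. by apply: sgi_fix; exact: parity_inv_P. Qed.
Lemma msub_eq1 u t : mdiv u t -> (msub t u == mono1) = (u == t).
Proof.
move=> h; have [e d] := mdivP h; apply/eqP/eqP => [h1|->].
  by move: e; rewrite h1 mono_mulC mono_mul1.
by apply: mono_eq => /=; rewrite ?subrr ?msetBxx ?fsetDv.
Qed.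

Lemma kop_del kap p t : suppT kap -> kop kap (del p) t = kap t * sgiU #|` modd t| p.
Proof.
move=> sk; have Z u : u \in D t -> u != t ->
    koszul K u (msub t u) *: (kap u * sgiU #|` modd u| (del p (msub t u))) = 0.
  by move=> /D_mdiv h ut; rewrite /del msub_eq1 // (negbTE ut) sgi0 mulr0 scaler0.
have tt : mdiv t t by rewrite /mdiv msubset_refl fsubset_refl.
have [Tt|nT] := boolP (isT t); last first.
  rewrite (suppT0 sk nT) mul0r /kop big1_seq // => u /andP[_ us]; apply: Z => //.
  by apply: contraNneq nT => <-; exact: D_isT us.
have tD : t \in D t by rewrite mem_D Tt tt.
rewrite /kop (bigD1_seq t) ?uniq_D //= big_seq_cond big1; last first.
  by move=> u /andP[/Z h /h].
have /eqP e : msub t t == mono1 by rewrite msub_eq1.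
by rewrite addr0 e koszul_evenr // scale1r /del eqxx.
Qed.

Lemma kop_delC kap p t : suppT kap -> parity_inv p = p -> kop kap (del p) t = kap t * p.
Proof. by move=> sk pp; rewrite kop_del // (sgi_fix _ pp). Qed.

Lemma del_kop v : kop (del 1) v = v.
Proof.
apply/funext => t; rewrite /kop (bigD1_seq mono1) ?uniq_D ?mono1_D //= big1.
  rewrite addr0 /del eqxx mul1r koszul_even // scale1r /=.
  by congr v; apply: mono_eq; rewrite /= ?subr0 ?msetB0 ?fsetD0.
by move=> u u1; rewrite /del (negbTE u1) mul0r scaler0.
Qed.

Lemma suppT_kop kap v : suppT v -> suppT (kop kap v).
Proof.
move=> sv t; apply: contraNT => nT; rewrite /kop big1_seq // => u /andP[_ ut].
rewrite (suppT0 (t := msub t u) sv) ?sgi0 ?mulr0 ?scaler0 //.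
apply: contraNN nT => Tm; have [e d] := mdivP (D_mdiv ut).
by rewrite -e isTM // (D_isT ut).
Qed.

Lemma kopA kap lam v : kop kap (kop lam v) = kop (kop kap lam) v.
Proof.
apply/funext => s; rewrite /kop big_seq.
pose F t1 t2 : U := (koszul K t1 (msub s t1) * koszul K t2 (msub (msub s t1) t2)) *:
  (kap t1 * sgiU #|` modd t1| (lam t2) *
     sgiU (#|` modd t1| + #|` modd t2|) (v (msub s (mono_mul t1 t2)))).
transitivity (\sum_(t1 <- D s) \sum_(t2 <- D (msub s t1)) F t1 t2).
  rewrite big_seq; apply: eq_bigr => t1 t1s.
  rewrite sgi_sum mulr_sumr scaler_sumr; apply: eq_bigr => t2 _.
  rewrite sgiZ sgiM -scalerAr scalerA mulrA /F; congr (_ *: (_ * _)).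
  by rewrite msubMl sgi_add.
rewrite sum_D_assoc big_seq [RHS]big_seq; apply: eq_bigr => t ts.
rewrite mulr_suml scaler_sumr big_seq [RHS]big_seq; apply: eq_bigr => t1 t1t.
have [e d] := mdivP (D_mdiv t1t).
rewrite /F e -scalerAl scalerA -mulrA -mulrA; congr (_ *: (_ * (_ * _))); last first.
  congr (sgi _ _ _); have := congr1 (fun w => size (modd w)) e.
  by rewrite /= (perm_size (perm_fsetU d)) size_cat.
have e2 : mono_mul (msub t t1) (msub s t) = msub s t1.
  have [<- _] := mdivP (mdiv_sub (D_mdiv t1t) (D_mdiv ts)).
  by rewrite (msub_sub _ (D_mdiv t1t)).
by rewrite (msub_sub _ (D_mdiv t1t)) -e2 mulrC -koszul_cocycle e mulrC.
Qed.

(** In [nsOp x] the monomial t stands to the left of its generator, whereas series have their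
    coefficients on the left; hence the parity involution. *)
Definition kap (x : monomial -> nsU K) : M := fun t =>
  if isT t then sgiU #|` modd t|
    ((x t).1 *: UE K (wt t) + (if wt t == 0 then (x t).2 else 0) *: Ud K) else 0.

Lemma suppT_kap x : suppT (kap x).
Proof. by move=> t; rewrite /kap; case: ifP => //; rewrite eqxx. Qed.

Lemma nsOp_kop x v : nsOpU x v = kop (kap x) v.
Proof.
apply/funext => s; rewrite /nsOp /Op /kop big_seq [RHS]big_seq.
apply: eq_bigr => u us; rewrite /act (D_mdiv us) /kap (D_isT us) -sgiM.
by congr (_ *: sgi _ _ _); rewrite /nsE /ellU /ddU mulrDl -!scalerAl.
Qed.

Lemma iter_nsOp_kop x n v : iter n (nsOpU x) v = kop (iter n (nsOpU x) (del 1)) v.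
Proof.
elim: n => [|n IH] /=; first by rewrite del_kop.
by rewrite IH nsOp_kop kopA -nsOp_kop.
Qed.

(** [nsOp x] is a left multiplication, so e^X is left multiplication by its value at 1. *)
Lemma nsExp_kop x v : ord 1 x -> nsExpU x v = kop (nsExpU x (del 1)) v.
Proof.
move=> ox; have rx := nsOp_raises EU ox; apply/funext => s.
rewrite {1}/nsExp /Exp.
under eq_bigr => n _ do rewrite iter_nsOp_kop /kop scaler_sumr.
rewrite exchange_big /kop big_seq [RHS]big_seq; apply: eq_bigr => u us.
rewrite /nsExp (ExpE _ rx (D_sdeg us)) mulr_suml scaler_sumr; apply: eq_bigr => n _.
by rewrite -scalerAl !scalerA mulrC.
Qed.

Lemma suppT_del p : suppT (del p).
Proof. by move=> t; rewrite /del; case: (t =P mono1) => [-> _|_]; rewrite ?eqxx //; exact: mono1_T. Qed.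

Lemma suppT_nsExp x v : suppT v -> suppT (nsExpU x v).
Proof.
move=> sv t; apply: contraNT => nT; rewrite /nsExp /Exp big1 // => n _.
rewrite (suppT0 (v := iter n (nsOpU x) v)) ?scaler0 //.
by elim: (n : nat) => //= m IH; rewrite nsOp_kop; exact: suppT_kop.
Qed.

(** The coefficient of s lies in P_{c(s)/2} U_P(ns). By orthogonality of the P_i, only one column of
    a left factor then meets it. *)
Definition lgraded (c : monomial -> int) (v : M) : Prop := forall s, UPr K (c s) * v s = v s.

Lemma UPr_idem k : UPr K k * UPr K k = UPr K k.
Proof. by rewrite UP_PP eqxx. Qed.

(** A monomial of doubled weight l comes with a generator past which P_{i/2} becomes P_{(i+l)/2}, so
    weights and left idempotents move together. *)
Lemma lgraded_kap x k v : lgraded (fun s => k - wt s) v ->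
  lgraded (fun s => k - wt s) (nsOpU x v).
Proof.
move=> gv s; rewrite nsOp_kop /kop mulr_sumr big_seq [RHS]big_seq.
apply: eq_bigr => u us; rewrite -scalerAr; congr (_ *: _).
have [e d] := mdivP (D_mdiv us); have := wtM d; rewrite e => ->.
rewrite /kap (D_isT us) -sgiM -[X in X * _](sgi_P #|` modd u|) -sgiM mulrA.
congr (sgi _ _ _); rewrite -[in RHS]gv [RHS]mulrA; congr (_ * v _).
rewrite mulrDr mulrDl -!scalerAr -!scalerAl; congr (_ *: _ + _).
  by rewrite UP_PE; congr (_ * UPr K _); lia.
case: eqP => [->|_]; last by rewrite !scale0r.
by rewrite UP_Pd add0r.
Qed.

End Kernels.

(** * Products of formal sums over the P_k, column by column *)

Section Translation.
Variable K : numFieldType.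
Local Notation U := (UP K).
Local Notation M := (monomial -> U).
Local Notation EU := (ellU_module K).
Local Notation nsOpU := (nsOp (sgU K) (@ellU K) (@ddU K)).
Local Notation nsExpU := (nsExp (sgU K) (@ellU K) (@ddU K)).
Local Notation sgiU := (sgi (sgU K)).
Local Notation us := (monomial -> int -> U).

Definition ashinv (c : monomial -> int) : Prop := forall s a, c (ash s a) = c s.

Lemma ash0 s : ash s 0 = s.
Proof. by apply: mono_eq => //=; rewrite addr0. Qed.
Lemma ash_ash s a b : ash (ash s a) b = ash s (a + b).
Proof. by apply: mono_eq => //=; rewrite addrA. Qed.

(* [f] has the column kap P_q alpha_0^{-e q/2} at q. *)
Definition kform (e : int) (kap : M) (f : us) : Prop :=
  suppT kap /\ forall u q, f u q = kap (ash u (e * q)) * UPr K q.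

Lemma sgi_lgraded c n s (v : M) : lgraded c v -> UPr K (c s) * sgiU n (v s) = sgiU n (v s).
Proof. by move=> gv; rewrite -[in LHS](sgi_P K n) -sgiM gv. Qed.

(* Moving P_q to the right fixes the power of alpha_0 in the kernel. *)
Lemma umul_kop e kap (f g : us) c k t : kform e kap f -> ashinv c ->
  lgraded c (g^~ k) ->
  umul f g t k = kop kap (fun s => g (ash s (e * c s)) k) t.
Proof.
move=> [sk fE] ci gc; rewrite /umul.
(* For a normalized divisor u of t, the only contributing column i is given by the left idempotent
   of the right factor; the power alpha_0^{-e i/2} of the left factor is compensated in the right
   one. *)
pose h u := ((ash u (- (e * c (msub t u))), ash (msub t u) (e * c (msub t u))),
  c (msub t u)) : monomial * monomial * int.
pose Q (q : monomial * monomial * int) :=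
  [&& mdisj q.1.1 q.1.2, isT (ash q.1.1 (e * q.2)) & q.2 == c q.1.2].
apply: etrans (fsum_reindex (h := h) (g := fun q => ash q.1.1 (e * q.2))
  (P := fun u => u \in D t) (Q := Q) _ _ _) _.
- move=> [[u s] i] _ /=; rewrite /Q /= fE => /nandP[/(koszul0 K) ->|/nandP[h0|ic]].
  + by rewrite scale0r.
  + by rewrite (suppT0 sk h0) !mul0r scaler0.
  rewrite -[iter _ _ _]/(sgiU _ (g s k)) -(sgi_lgraded _ s gc) -!mulrA (mulrA (UPr K i)).
  by rewrite UP_PP (negbTE ic) mul0r mulr0 scaler0.
- move=> u us; have [E d] := mdivP (D_mdiv us).
  rewrite /Q /h /= !ash_ash addNr ash0 (D_isT us) ci eqxx; split=> //; last by rewrite !andbT; exact: d.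
  by rewrite -[RHS]E; apply: mono_eq => //=; rewrite addrACA addNr addr0.
- move=> [[u s] i] /= E /and3P[d Tu /eqP ic].
  have ms : msub t (ash u (e * i)) = ash s (- (e * i)).
    rewrite -E; apply: mono_eq => /=; first lia.
    - lia.
    - by rewrite msetDKB.
    - by have := congr1 modd (msubM d).
  split; last first.
    by rewrite /h ms ci -/(c s) -ic !ash_ash addrN addNr !ash0.
  rewrite mem_D Tu /= -E /mdiv /= fsubsetUl andbT.
  by apply/msubsetP => a; rewrite msetE2 leq_addr.
rewrite (fsum_seq (r := D t)) ?uniq_D //; last by move=> u /negbTE ->.
rewrite big_seq [RHS]big_seq; apply: eq_bigr => u us; rewrite us /h /= fE.
rewrite ash_ash addNr ash0 -mulrA; congr (_ *: (_ * _)).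
rewrite -[iter _ _ _]/(sgiU _ (g (ash (msub t u) (e * c (msub t u))) k)).
by have := sgi_lgraded #|` modd u| (ash (msub t u) (e * c (msub t u))) gc; rewrite ci.
Qed.

Lemma ashinv_wt k : ashinv (fun s => k - wt s). Proof. by []. Qed.

Lemma umul_kform0 kap (f g : us) c k : kform 0 kap f -> ashinv c -> lgraded c (g^~ k) ->
  (umul f g)^~ k = kop kap (g^~ k).
Proof.
move=> kf ci gc; apply/funext => t; rewrite (umul_kop t kf ci gc); congr kop.
by apply/funext => s; rewrite mul0r ash0.
Qed.

Lemma lgraded_del p c : UPr K (c mono1) * p = p -> lgraded c (del p).
Proof. by move=> h s; rewrite /del; case: eqP => [->|]; rewrite ?mulr0. Qed.

Lemma lgraded_delP k : lgraded (fun s => k - wt s) (del (UPr K k)).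
Proof. by apply: lgraded_del; rewrite wt1 subr0 UPr_idem. Qed.

Lemma uconst_del u k : (uconst u)^~ k = del (u * UPr K k).
Proof. by []. Qed.

Lemma uscalar_uconst (a : monomial -> K) (u : U) l k t : (forall t, a t != 0 -> isT t) ->
  UPr K l * (u * UPr K k) = u * UPr K k ->
  umul (uscalar a) (uconst u) t k = a t *: sgiU #|` modd t| (u * UPr K k).
Proof.
move=> Ta hl; have sa : suppT (fun t => a t *: (1 : U)).
  by move=> v; have [->|/Ta //] := eqVneq (a v) 0; rewrite scale0r eqxx.
rewrite -[LHS]/((umul (uscalar a) (uconst u))^~ k t).
rewrite (umul_kform0 (kap := fun t => a t *: 1) (c := fun=> l)) //.
- by rewrite uconst_del kop_del // -scalerAl mul1r.
- by split=> // v q; rewrite mul0r ash0 -scalerAl mul1r.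
- by rewrite uconst_del; exact: lgraded_del.
Qed.

Lemma uexp_kform (f : us) x : ord 1 x -> kform 0 (kap x) f ->
  kform 0 (nsExpU x (del 1)) (uexp f) /\
  forall k, (uexp f)^~ k = nsExpU x (del (UPr K k)).
Proof.
move=> ox kf; have rx := nsOp_raises EU ox.
have it k n : iter n (umul f) (uconst 1) ^~ k = iter n (nsOpU x) (del (UPr K k)) /\
    lgraded (fun s => k - wt s) (iter n (nsOpU x) (del (UPr K k))).
  elim: n => [|n [IH gr]] /=.
    by rewrite uconst_del mul1r; split=> //; exact: lgraded_delP.
  rewrite (umul_kform0 kf (@ashinv_wt k)) IH // -nsOp_kop; split=> //.
  exact: lgraded_kap.
have E k : (uexp f)^~ k = nsExpU x (del (UPr K k)).
  apply/funext => t; rewrite /uexp (fsum_ord (N := (sdeg t).+1)) => [|n nt].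
    apply: eq_bigr => n _; congr (_ *: _).
    by have [/(congr1 (fun v : M => v t)) h _] := it k n.
  have [/(congr1 (fun v : M => v t)) /= -> _] := it k n.
  by rewrite (iter_ord _ rx) ?scaler0.
split=> //; split=> [|u q]; first by apply: suppT_nsExp; exact: suppT_del.
rewrite mul0r ash0 -[LHS]/((uexp f)^~ q u) E nsExp_kop // kop_delC ?parity_inv_P //.
by apply: suppT_nsExp; exact: suppT_del.
Qed.

Lemma lgraded_nsExp x k v : lgraded (fun s => k - wt s) v ->
  lgraded (fun s => k - wt s) (nsExpU x v).
Proof.
move=> gv s; rewrite /nsExp /Exp mulr_sumr; apply: eq_bigr => n _.
rewrite -scalerAr; congr (_ *: _); move: (n : nat) => {n} n.
suff : lgraded (fun s => k - wt s) (iter n (nsOpU x) v) by apply.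
by elim: n => //= n IH; exact: lgraded_kap.
Qed.

Lemma umul_kform kap lam (f g : us) : kform 0 kap f -> kform 0 lam g ->
  (forall k, lgraded (fun s => k - wt s) (g^~ k)) -> kform 0 (kop kap lam) (umul f g).
Proof.
move=> kf [sl gE] gr; split=> [|u q]; first exact: suppT_kop.
rewrite mul0r ash0 -[LHS]/((umul f g)^~ q u) (umul_kform0 kf (@ashinv_wt q)) //.
have -> : g^~ q = kop lam (del (UPr K q)).
  apply/funext => s; rewrite kop_delC ?parity_inv_P //.
  by rewrite gE mul0r ash0.
by rewrite kopA kop_delC ?parity_inv_P //; exact: suppT_kop.
Qed.

Lemma alphaL0_lgraded h k : lgraded (fun s => k - wt s) ((alphaL0 K h)^~ k).
Proof.
move=> s; rewrite /alphaL0; case: eqP => [->|]; rewrite ?mulr0 //.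
by rewrite -[wt _]/(wt mono1) wt1 subr0 UPr_idem.
Qed.

Lemma umul_alphaL0 kap (f : us) : kform 0 kap f -> kform 1 kap (umul f (alphaL0 K (-1))).
Proof.
move=> kf; split=> [|t q]; first by case: kf.
rewrite mul1r -[LHS]/((umul f (alphaL0 K (-1)))^~ q t).
rewrite (umul_kform0 kf (@ashinv_wt q)); last exact: alphaL0_lgraded.
rewrite -(kop_delC (p := UPr K q) (ash t q)) ?parity_inv_P //; last by case: kf.
rewrite /kop (_ : D (ash t q) = D t); last exact: eq_D.
apply: eq_bigr => u _; congr (_ *: (_ * sgi _ _ _)).
rewrite /alphaL0 /del mulN1r; congr (if _ then _ else _).
apply/eqP/eqP => h.
  have ha := congr1 malpha h; have hx := congr1 mx h; have he := congr1 meven h.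
  have ho := congr1 modd h; move: ha hx he ho => /= ha hx he ho.
  by apply: mono_eq => //=; rewrite ?he //; lia.
have ha := congr1 malpha h; have hx := congr1 mx h; have he := congr1 meven h.
have ho := congr1 modd h; move: ha hx he ho => /= ha hx he ho.
by apply: mono_eq => //=; rewrite ?he //; lia.
Qed.

End Translation.

(** * The kernels of the factors *)

Section Factors.
Variable K : numFieldType.
Local Notation U := (UP K).
Local Notation M := (monomial -> U).
Local Notation S := (monomial -> K^o).
Local Notation EU := (ellU_module K).
Local Notation nsOpU := (nsOp (sgU K) (@ellU K) (@ddU K)).
Local Notation nsExpU := (nsExp (sgU K) (@ellU K) (@ddU K)).
Local Notation sgiU := (sgi (sgU K)).
Local Notation us := (monomial -> int -> U).

Lemma UP_PEP l k : UPr K (k - l) * (UE K l * UPr K k) = UE K l * UPr K k.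
Proof. by rewrite mulrA UP_PE subrK -mulrA UPr_idem. Qed.

Lemma UE_pos (i : nat) : UE K (i.+1.*2)%:Z = UL K i.+1 /\ UE K (i.*2.+1)%:Z = UG K i.
Proof. by rewrite /UE half_double half_Sdouble /oddz /= odd_double. Qed.
Lemma UE_neg (i : nat) : UE K (- (i.+1.*2)%:Z) = UL K (- i.+1%:Z) /\
  UE K (- (i.*2.+1)%:Z) = UG K (- i.+1%:Z).
Proof. by rewrite /UE half_Ndouble half_NSdouble !oddzN /oddz /= odd_double. Qed.

Lemma homfam_uconst (c : int -> S) l k t : homfam c ->
  umul (uscalar (c l)) (uconst (UE K l)) t k = c l t *: sgiU #|` modd t| (UE K l * UPr K k).
Proof. by move=> hc; apply: (uscalar_uconst (l := k - l)); [move=> u /hc[]|exact: UP_PEP]. Qed.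

Definition usgn (b : bool) (c : int -> S) : us :=
  let e k := if b then - k else k in
  usum (fun i => umul (uscalar (c (e (i.+1.*2)%:Z))) (uconst (UE K (e (i.+1.*2)%:Z)))
    + umul (uscalar (c (e (i.*2.+1)%:Z))) (uconst (UE K (e (i.*2.+1)%:Z)))).

Lemma usgnE b c t k : homfam c -> let e k := if b then - k else k in
  usgn b c t k =
  if 0 < e (wt t) then c (wt t) t *: sgiU #|` modd t| (UE K (wt t) * UPr K k) else 0.
Proof.
move=> hc e; have ee l : e (e l) = l by rewrite /e; case: (b); rewrite ?opprK.
pose G l := c (e l) t *: sgiU #|` modd t| (UE K (e l) * UPr K k).
have G0 l : l != e (wt t) -> G l = 0.
  by move=> lt; rewrite /G homfam0 ?scale0r //; apply: contraNneq lt => <-; rewrite ee.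
have E i : (umul (uscalar (c (e (i.+1.*2)%:Z))) (uconst (UE K (e (i.+1.*2)%:Z)))
    + umul (uscalar (c (e (i.*2.+1)%:Z))) (uconst (UE K (e (i.*2.+1)%:Z)))) t k =
    G (i.+1.*2)%:Z + G (i.*2.+1)%:Z.
  rewrite -[LHS]/(umul (uscalar (c (e (i.+1.*2)%:Z))) (uconst (UE K (e (i.+1.*2)%:Z))) t k
    + umul (uscalar (c (e (i.*2.+1)%:Z))) (uconst (UE K (e (i.*2.+1)%:Z))) t k).
  by rewrite !homfam_uconst.
rewrite /usgn /usum (fsum_ord (N := `|e (wt t)|.+1)) => [|i it]; last first.
  by rewrite E !G0 ?addr0 //; lia.
under eq_bigr => i _ do rewrite E.
by rewrite (sum_pos_weights (ltnSn _) G0) /G ee.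
Qed.

Lemma upos_usgn (c : int -> S) :
  upos (fun i => c (i.+1.*2)%:Z) (fun i => c (i.*2.+1)%:Z) = usgn false c.
Proof.
by congr usum; apply/funext => i; case: (UE_pos i) => <- <-.
Qed.

Lemma uneg_usgn (c : int -> S) :
  uneg (fun i => c (- (i.+1.*2)%:Z)) (fun i => c (- (i.*2.+1)%:Z)) = usgn true c.
Proof.
by congr usum; apply/funext => i; case: (UE_neg i) => <- <-.
Qed.

Lemma kap_mul x t k : isT t ->
  kap x t * UPr K k = sgiU #|` modd t|
    (((x t).1 *: UE K (wt t) + (if wt t == 0 then (x t).2 else 0) *: Ud K) * UPr K k).
Proof. by move=> Tt; rewrite /kap Tt sgiM sgi_P. Qed.

Lemma kform_upos (c : int -> S) : homfam c ->
  kform 0 (kap (posdata c)) (upos (fun i => c (i.+1.*2)%:Z) (fun i => c (i.*2.+1)%:Z)).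
Proof.
move=> hc; split=> [|t q]; first exact: suppT_kap.
rewrite mul0r ash0 upos_usgn usgnE //=.
have [Tt|nT] := boolP (isT t); last first.
  rewrite /kap (negbTE nT) mul0r.
  have -> : c (wt t) t = 0 by apply/eqP; apply: contraNT nT => /hc[].
  by rewrite scale0r if_same.
rewrite kap_mul //= if_same scale0r addr0 -scalerAl sgiZ.
by case: ifP; rewrite ?scale0r.
Qed.

Lemma kform_uneg (c : int -> S) : homfam c ->
  kform 0 (kap (negdata c)) (uneg (fun i => c (- (i.+1.*2)%:Z)) (fun i => c (- (i.*2.+1)%:Z))).
Proof.
move=> hc; split=> [|t q]; first exact: suppT_kap.
rewrite mul0r ash0 uneg_usgn usgnE //= oppr_gt0.
have [Tt|nT] := boolP (isT t); last first.
  rewrite /kap (negbTE nT) mul0r.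
  have -> : c (wt t) t = 0 by apply/eqP; apply: contraNT nT => /hc[].
  by rewrite scale0r if_same.
rewrite kap_mul //= if_same scale0r addr0 -scalerAl sgiZ.
by case: ifP; rewrite ?scale0r.
Qed.

Lemma kform_uzero (c : int -> S) : homfam c ->
  kform 0 (kap (zerodata c)) (umul (uscalar (2%:R *:s c 0)) (uconst (UL K 0))).
Proof.
move=> hc; split=> [|t q]; first exact: suppT_kap.
rewrite mul0r ash0 (uscalar_uconst (l := q)); last 2 first.
- by move=> u; rewrite /sscale mulf_eq0 negb_or => /andP[_ /hc[]].
- by have := UP_PEP 0 q; rewrite subr0.
rewrite /sscale; have [Tt|nT] := boolP (isT t); last first.
  rewrite /kap (negbTE nT) mul0r.
  have -> : c 0 t = 0 by apply/eqP; apply: contraNT nT => /hc[].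
  by rewrite mulr0 scale0r.
rewrite kap_mul //= if_same scale0r addr0 -scalerAl sgiZ.
case: eqP => [-> //|/eqP h]; by rewrite homfam0 1?eq_sym // mulr0 !scale0r.
Qed.

Lemma kform_central (g : monomial -> K) : (forall t, g t != 0 -> isT t && (wt t == 0)) ->
  kform 0 (kap (fun t => (0, g t : K^o))) (umul (uscalar g) (uconst (Ud K))).
Proof.
move=> hg; split=> [|t q]; first exact: suppT_kap.
rewrite mul0r ash0 (uscalar_uconst (l := q)); last 2 first.
- by move=> u /hg /andP[].
- by rewrite mulrA UP_Pd -mulrA UPr_idem.
have [Tt|nT] := boolP (isT t); last first.
  rewrite /kap (negbTE nT) mul0r.
  have -> : g t = 0 by apply/eqP; apply: contraNT nT => /hg /andP[].
  by rewrite scale0r.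
rewrite kap_mul //= scale0r add0r -scalerAl sgiZ; case: ifP => // /negbT wt0.
have -> : g t = 0 by apply/eqP; apply: contraNT wt0 => /hg /andP[].
by rewrite !scale0r.
Qed.

Lemma kapN x : kap (- x) = - kap x :> M.
Proof.
apply/funext => t; rewrite fNE /kap; case: ifP => _; last by rewrite oppr0.
rewrite fNE /= -(scaleN1r (sgi _ _ _)) -sgiZ; congr sgi.
by rewrite scalerDr !scalerA !mulN1r; case: eqP; rewrite ?oppr0.
Qed.

Lemma kformN e k (f : us) : kform e k f -> kform e (- k) (- f).
Proof.
move=> [sk fE]; split=> [t|u q]; first by rewrite fNE oppr_eq0; exact: sk.
by rewrite fNE mulNr -fE.
Qed.

(** The analogue of [rl] over U_P(ns). It is multiplicative because weights add up. *)
Definition url (f : us) : us := fun t k => f (ash t (wt t)) k.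

Lemma umul_all (f g : us) t k : umul f g t k =
  \sum_(q \in [set: monomial * monomial * int]%classic)
    if (mono_mul q.1.1 q.1.2 == t) && mdisj q.1.1 q.1.2 then
      koszul K q.1.1 q.1.2 *: (f q.1.1 q.2 * sgiU #|` modd q.1.1| (g q.1.2 k)) else 0.
Proof.
apply: (fsum_reindex (h := id) (g := id)
  (Q := fun q => mdisj q.1.1 q.1.2)) => [q _ /(koszul0 K) ->|q /andP[/eqP]|q /= -> ->] //.
  by rewrite scale0r.
by rewrite eqxx.
Qed.

Lemma url_umul (f g : us) : url (umul f g) = umul (url f) (url g).
Proof.
apply/funext => t; apply/funext => k; rewrite umul_all /url /umul.
pose h (b : int) (q : monomial * monomial * int) :=
  ((ash q.1.1 (b * wt q.1.1), ash q.1.2 (b * wt q.1.2)), q.2) : monomial * monomial * int.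
have hh b b' q : h b (h b' q) = h (b + b') q.
  case: q => [[u s] i]; rewrite /h /= !ash_ash.
  by rewrite -[wt (ash u _)]/(wt u) -[wt (ash s _)]/(wt s) -!mulrDl addrC.
have h0 q : h 0 q = q by case: q => [[u s] i]; rewrite /h /= !mul0r !ash0.
apply: etrans (fsum_reindex (h := h 1) (g := h (-1))
  (P := fun q => (mono_mul q.1.1 q.1.2 == t) && mdisj q.1.1 q.1.2)
  (Q := fun q => mdisj q.1.1 q.1.2) _ _ _) _.
- by move=> q _ /(koszul0 K) ->; rewrite scale0r.
- move=> [[u s] i] /= /andP[/eqP <- d]; split=> //; last by rewrite hh addNr h0.
  by apply: mono_eq => //=; rewrite wtM // !mul1r; lia.
- move=> [[u s] i] /= E d; rewrite hh subrr h0; split=> //.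
  rewrite [mdisj _ _]d andbT; apply/eqP; have w := wtM d.
  have wE : wt (mono_mul u s) = wt t by rewrite E.
  have ha := congr1 malpha E; have hx := congr1 mx E; have he := congr1 meven E.
  have ho := congr1 modd E; move: ha hx he ho => /= ha hx he ho.
  apply: mono_eq => //=; lia.
by apply: eq_fsbigr => -[[u s] i] _ /=; rewrite !mul1r.
Qed.

Lemma url_uconst u : url (uconst u) = uconst u.
Proof.
apply/funext => t; apply/funext => k; rewrite /url /uconst; congr (if _ then _ else _).
apply/eqP/eqP => h; last by rewrite h wt1 ash0.
have w : wt t = 0 by rewrite -[wt t]/(wt (ash t (wt t))) h wt1.
by rewrite -h w ash0.
Qed.

Lemma url_uexp f : url (uexp f) = uexp (url f).
Proof.
apply/funext => t; apply/funext => k; rewrite {1}/url /uexp; apply: eq_fsbigr => n _.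
congr (_ *: _); rewrite -[LHS]/(url (iter n (umul f) (uconst 1)) t k).
congr (_ t k); elim: (n : nat) => /= [|m <-]; first exact: url_uconst.
exact: url_umul.
Qed.

Lemma uneg_varBN : uneg (varB K) (varN K) = url (usgn true (@genfam K)).
Proof.
have -> : varB K = fun i => rl (genfam K (- (i.+1.*2)%:Z)) by apply/funext => i; exact: varB_gen.
have -> : varN K = fun i => rl (genfam K (- (i.*2.+1)%:Z)) by apply/funext => i; exact: varN_gen.
apply/funext => t; apply/funext => k; rewrite /uneg /url /usgn /usum; apply: eq_fsbigr => i _.
case: (UE_neg i) => <- <-.
rewrite -[RHS]/((url (umul (uscalar (genfam K (- (i.+1.*2)%:Z))) (uconst (UE K (- (i.+1.*2)%:Z))))
  + url (umul (uscalar (genfam K (- (i.*2.+1)%:Z))) (uconst (UE K (- (i.*2.+1)%:Z))))) t k).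
by rewrite !url_umul !url_uconst.
Qed.

End Factors.

(** * The columns of the two sides *)

Section Columns.
Variable K : numFieldType.
Local Notation U := (UP K).
Local Notation M := (monomial -> U).
Local Notation S := (monomial -> K^o).
Local Notation EU := (ellU_module K).
Local Notation nsOpU := (nsOp (sgU K) (@ellU K) (@ddU K)).
Local Notation nsExpU := (nsExp (sgU K) (@ellU K) (@ddU K)).
Local Notation sgiU := (sgi (sgU K)).
Local Notation us := (monomial -> int -> U).

Lemma kop_ash kap (v : M) a t : kop kap (fun s => v (ash s a)) t = kop kap v (ash t a).
Proof.
rewrite /kop (_ : D (ash t a) = D t); last exact: eq_D.
apply: eq_bigr => u _; congr (_ *: (_ * sgi _ _ (v _))).
by apply: mono_eq => //=; lia.
Qed.

Lemma nsExp_ash x (v : M) a t : ord 1 x ->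
  nsExpU x (fun s => v (ash s a)) t = nsExpU x v (ash t a).
Proof. by move=> ox; rewrite (nsExp_kop (fun s => v (ash s a)) ox) kop_ash -nsExp_kop. Qed.

(** The column of alpha_0^{-L_0}, that is P_{k/2} alpha_0^{-k/2}. *)
Definition pt (k : int) : M := fun s => del (UPr K k) (ash s k).

Lemma lhs_column k :
  (umul (umul (uexp (- upos (varA K) (varM K))) (alphaL0 K (-1)))
    (uexp (- uneg (varB K) (varN K))))^~ k = nsExpU (xA K) (nsExpU (xB K) (pt k)).
Proof.
have oA := xA_ord1 K; have oB := xB_ord1 K.
have fA : kform 0 (kap (xA K)) (- upos (varA K) (varM K)).
  rewrite /xA kapN; apply: kformN.
  have -> : varA K = fun i => genfam K (i.+1.*2)%:Z by apply/funext => i; exact: varA_gen.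
  have -> : varM K = fun i => genfam K (i.*2.+1)%:Z by apply/funext => i; exact: varM_gen.
  by apply: kform_upos; exact: genfam_hom.
have [/umul_alphaL0 fAl _] := uexp_kform oA fA.
have fB : kform 0 (kap (xB K)) (- usgn true (@genfam K)).
  rewrite /xB kapN -uneg_usgn; apply: kformN; apply: kform_uneg; exact: genfam_hom.
have [_ colB] := uexp_kform oB fB.
have EY : uexp (- uneg (varB K) (varN K)) = url (uexp (- usgn true (@genfam K))).
  by rewrite url_uexp uneg_varBN.
have gB : lgraded (fun s => k - wt s) (nsExpU (xB K) (del (UPr K k))).
  by apply: lgraded_nsExp; exact: lgraded_delP.
have colY s : url (uexp (- usgn true (@genfam K))) s k =
    nsExpU (xB K) (del (UPr K k)) (ash s (wt s)).
  by rewrite -colB.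
apply/funext => t; rewrite EY (umul_kop t fAl (@ashinv_wt k)); last first.
  by move=> s; rewrite colY; exact: gB (ash s (wt s)).
rewrite (nsExp_kop (nsExpU _ _) oA); congr (kop _ _ t); apply/funext => s.
(* The shift k - wt s comes from moving alpha_0^{-L_0} to the right, the shift wt s from the
   variables B, N being unnormalized; their sum is the k in [pt k]. *)
rewrite colY mul1r ash_ash /pt nsExp_ash //; congr (_ _).
by rewrite -[wt (ash _ _)]/(wt s) subrK.
Qed.

Lemma umul_central (g : monomial -> K) t k :
  umul (uscalar g) (uconst (Ud K)) t k = g t *: (Ud K * UPr K k).
Proof.
rewrite umul_all (fsum_seq (r := [:: ((t, mono1), k)])) //.
  have t1 : mono_mul t mono1 = t by rewrite mono_mulC mono_mul1.
  rewrite big_seq1 /= t1 eqxx /= mdisjC mdisj_even // koszul_evenr // scale1r.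
  rewrite /uconst eqxx sgiM sgi_P sgi_fix ?parity_inv_d // /uscalar -scalerAl.
  by rewrite -UP_Pd mulrA UPr_idem.
move=> [[u s] i]; rewrite inE /= => h; case: ifP => // /andP[/eqP ut _].
rewrite /uconst; case: eqP => [s1|_]; last by rewrite sgi0 mulr0 scaler0.
rewrite sgiM sgi_P sgi_fix ?parity_inv_d // /uscalar -scalerAl -UP_Pd mulrA UP_PP.
case: eqP => [ik|_]; last by rewrite mul0r !scaler0.
by move: h; rewrite -ut s1 ik mono_mulC mono_mul1 eqxx.
Qed.

(** The series g d for arbitrary g. A competitor of Gamma need not be normalized or of weight 0, so
    it is handled by columns and not as a kernel. *)
Definition ucent (g : monomial -> K) : us := fun t k => g t *: (Ud K * UPr K k).

Lemma lgraded_ucent g (v : us) k : lgraded (fun=> k) (v^~ k) ->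
  lgraded (fun=> k) ((umul (ucent g) v)^~ k).
Proof.
move=> gv t; rewrite umul_all mulr_sumr; apply: eq_bigr => -[[u s] i] _ /=.
case: ifP => _; last by rewrite mulr0.
rewrite -scalerAr; congr (_ *: _); rewrite -(sgi_lgraded _ s gv) /ucent.
rewrite -!scalerAl -scalerAr; congr (_ *: _).
rewrite -[Ud K * _ * _]mulrA (mulrA (UPr K i)) UP_PP; case: eqP => [->|_].
  have h : UPr K k * (Ud K * UPr K k) = Ud K * UPr K k by rewrite -UP_Pd mulrA UPr_idem.
  by rewrite (mulrA (Ud K)) mulrA h.
by rewrite mul0r !mulr0.
Qed.

Lemma lgraded_uexp g k : lgraded (fun=> k) ((uexp (ucent g))^~ k).
Proof.
move=> t; rewrite /uexp mulr_sumr; apply: eq_bigr => n _.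
rewrite -scalerAr; congr (_ *: _).
suff : lgraded (fun=> k) ((iter n (umul (ucent g)) (uconst 1))^~ k) by apply.
elim: (n : nat) => [|m IH]; last exact: lgraded_ucent.
by rewrite uconst_del mul1r; apply: lgraded_del; exact: UPr_idem.
Qed.

Variable Psi : int -> S.
Hypothesis hPsi : homfam Psi.
Hypothesis oPsi0 : ord 1 (Psi 0).

Lemma rhs_column g k :
  (umul (umul (umul (umul (uexp (uneg (Psi_neg_even Psi) (Psi_neg_odd Psi)))
    (uexp (upos (Psi_pos_even Psi) (Psi_pos_odd Psi))))
    (uexp (umul (uscalar (2%:R *:s Psi 0)) (uconst (UL K 0)))))
    (alphaL0 K (-1)))
    (uexp (umul (uscalar g) (uconst (Ud K)))))^~ k =
  nsExpU (negdata Psi) (nsExpU (posdata Psi) (nsExpU (zerodata Psi)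
    (fun s => uexp (ucent g) (ash s k) k))).
Proof.
have oN := @negdata_ord1 K Psi; have oP := @posdata_ord1 K Psi.
have oZ := zerodata_ord1 oPsi0.
have -> : umul (uscalar g) (uconst (Ud K)) = ucent g.
  by apply/funext => t; apply/funext => q; exact: umul_central.
have [fN _] := uexp_kform oN (kform_uneg hPsi).
have [fP cP] := uexp_kform oP (kform_upos hPsi).
have [fZ cZ] := uexp_kform oZ (kform_uzero hPsi).
have gr x q : lgraded (fun s => q - wt s) (nsExpU x (del (UPr K q))).
  by apply: lgraded_nsExp; exact: lgraded_delP.
have fNP := umul_kform fN fP (fun q => eq_ind_r (lgraded _) (gr _ q) (cP q)).
have fNPZ := umul_kform fNP fZ (fun q => eq_ind_r (lgraded _) (gr _ q) (cZ q)).
have f := umul_alphaL0 fNPZ.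
apply/funext => t; rewrite (umul_kop (c := fun=> k) t f) //; last exact: lgraded_uexp.
rewrite (nsExp_kop (nsExpU _ _) oN) (nsExp_kop (nsExpU _ _) oP).
rewrite (nsExp_kop (fun s => uexp (ucent g) (ash s k) k) oZ) !kopA.
by congr (kop _ _ t); apply/funext => s; rewrite mul1r.
Qed.

Lemma rhs_column_inj g g' k :
  nsExpU (negdata Psi) (nsExpU (posdata Psi) (nsExpU (zerodata Psi)
    (fun s => uexp (ucent g) (ash s k) k))) =
  nsExpU (negdata Psi) (nsExpU (posdata Psi) (nsExpU (zerodata Psi)
    (fun s => uexp (ucent g') (ash s k) k))) ->
  (uexp (ucent g))^~ k = (uexp (ucent g'))^~ k.
Proof.
have oN := @negdata_ord1 K Psi; have oP := @posdata_ord1 K Psi.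
have oZ := zerodata_ord1 oPsi0.
move/(congr1 (nsExpU (- negdata Psi))); rewrite !(nsExpNK EU) //.
move/(congr1 (nsExpU (- posdata Psi))); rewrite !(nsExpNK EU) //.
move/(congr1 (nsExpU (- zerodata Psi))); rewrite !(nsExpNK EU) // => h.
apply/funext => s; have := congr1 (fun v : M => v (ash s (- k))) h.
by rewrite !ash_ash addNr ash0.
Qed.

Lemma uexp_central_column (g : monomial -> K) k t : ord 1 (g : S) ->
  (forall t, g t != 0 -> isT t && (wt t == 0)) ->
  uexp (ucent g) (ash t k) k = nsExpU (fun t => (0, g t : K^o)) (pt k) t.
Proof.
move=> og hg; have o1 : ord 1 (fun t => (0, g t : K^o) : nsU K).
  by move=> s s0; rewrite (og s s0).
have := kform_central hg; have -> : umul (uscalar g) (uconst (Ud K)) = ucent g.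
  by apply/funext => u; apply/funext => q; exact: umul_central.
by case/(uexp_kform o1) => _ c; rewrite /pt nsExp_ash // -c.
Qed.

End Columns.

(** * The series Gamma *)

Section Weights.

Lemma sum_le_size (T : eqType) (r : seq T) (f : T -> int) : (forall v, v \in r -> f v < 0) ->
  \sum_(v <- r) f v <= - (size r)%:Z.
Proof.
elim: r => [|a r IH] h; rewrite ?big_nil ?big_cons //=.
have -> : - (size r).+1%:Z = -1 + - (size r)%:Z by lia.
apply: lerD; first by have := h a (mem_head _ _); lia.
by apply: IH => v vr; apply: h; rewrite inE vr orbT.
Qed.

Lemma sdegS t : isS t -> sdeg t = mono_deg t.
Proof. by case/andP=> _ n; rewrite /sdeg /mono_deg mem_fsetD1. Qed.

(** Without A's and M's every variable has weight at most -1. With the mirror statement, weight 0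
    forces variables of both kinds in every term of Gamma. *)
Lemma wt_has_AM t : isS t -> (0 < sdeg t)%N -> 0 <= wt t -> has_AM t.
Proof.
move=> St; rewrite sdegS // /mono_deg => t0 w0; apply: contrapT => nAM.
have h1 : evensum weven (meven t) <= - (size (meven t))%:Z.
  by apply: sum_le_size => -[] i iv //=; case: nAM; exists i; left.
have h2 : oddsum wodd (modd t) <= - (#|` modd t|)%:Z.
  apply: sum_le_size => -[[] i|] iv //=; first by case: nAM; exists i; right.
  by case/andP: St => _ /negP[].
by move: w0; rewrite /wt; lia.
Qed.

Lemma wt_has_BN t : isS t -> (0 < sdeg t)%N -> wt t <= 0 -> has_BN t.
Proof.
move=> St; rewrite sdegS // /mono_deg => t0 w0; apply: contrapT => nBN.
have h1 : - evensum weven (meven t) <= - (size (meven t))%:Z.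
  rewrite /evensum -sumrN; apply: sum_le_size => -[] i iv //=.
  by case: nBN; exists i; left.
have h2 : - oddsum wodd (modd t) <= - (#|` modd t|)%:Z.
  rewrite /oddsum -sumrN; apply: sum_le_size => -[[] i|] iv //=; first by case: nBN; exists i; right.
  by case/andP: St => _ /negP[].
by move: w0; rewrite /wt; lia.
Qed.

Lemma size1 (T : Type) (r : seq T) : size r = 1%N -> exists v, r = [:: v].
Proof. by case: r => [|v [|]] // _; exists v. Qed.

Lemma sdeg1_wt t : isS t -> sdeg t = 1%N -> wt t != 0.
Proof.
move=> St; rewrite sdegS // /mono_deg /wt /evensum /oddsum.
have nt : None \notin (modd t : seq _) by case/andP: St.
have [/size0nil -> /=|e0] := posnP (size (meven t)); last first.
  have [h s1|o0] := posnP #|` modd t|; last lia.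
  have [v ev] : exists v, (meven t : seq _) = [:: v] by apply: size1; lia.
  have -> : (modd t : seq _) = [::] by apply: size0nil.
  by rewrite ev big_nil big_seq1 addr0; case: v {ev} => i /=; lia.
rewrite add0n => /size1[v ov]; rewrite ov big_nil big_seq1 add0r.
by move: nt; rewrite ov inE; case: v {ov} => [[i|i]|] //= _; lia.
Qed.

End Weights.

(** * The quadratic leading part *)

Section Leading.
Variable K : numFieldType.
Local Notation M := (monomial -> K^o).
Local Notation mono := (smono K : monomial -> M).

Lemma gen_A (i : nat) : gen (i.+1.*2)%:Z = Mono 0 0 [mset inl i]%mset fset0.
Proof. by rewrite /gen /= odd_double; congr (Mono _ _ [mset inl _]%mset _); lia. Qed.
Lemma gen_M (i : nat) : gen (i.*2.+1)%:Z = Mono 0 0 mset0 [fset Some (inl i)]%fset.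
Proof. by rewrite /gen /= odd_double /=; congr (Mono _ _ _ [fset Some (inl _)]%fset); lia. Qed.
Lemma gen_B (i : nat) : gen (- (i.+1.*2)%:Z) = Mono (- (i.+1.*2)%:Z) 0 [mset inr i]%mset fset0.
Proof.
have -> : - (i.+1.*2)%:Z = Negz (i.*2.+1) by lia.
by rewrite /gen /= odd_double /=; congr (Mono _ _ [mset inr _]%mset _); lia.
Qed.
Lemma gen_N (i : nat) :
  gen (- (i.*2.+1)%:Z) = Mono (- (i.*2.+1)%:Z) 0 mset0 [fset Some (inr i)]%fset.
Proof.
have -> : - (i.*2.+1)%:Z = Negz (i.*2) by lia.
by rewrite /gen /= odd_double /=; congr (Mono _ _ _ [fset Some (inr _)]%fset); lia.
Qed.

(** For k > 0 this is alpha_0^{-j} A_j B_j or alpha_0^{-j+1/2} M_{j-1/2} N_{j-1/2}. *)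
Definition gg (k : int) : monomial := mono_mul (gen k) (gen (- k)).

Lemma pos_cases k : 0 < k -> (exists i : nat, k = (i.+1.*2)%:Z) \/ exists i : nat, k = (i.*2.+1)%:Z.
Proof.
case: k => [[|n]|//] // _; case: (boolP (odd n)) => o.
  by left; exists n./2; lia.
by right; exists n./2; lia.
Qed.

Lemma gg_disj k : 0 < k -> mdisj (gen k) (gen (- k)).
Proof.
case/pos_cases => -[i ->]; rewrite /mdisj ?gen_A ?gen_B ?gen_M ?gen_N ?fdisjoint0X //.
by rewrite fdisjointX1 in_fset1.
Qed.

Lemma koszul_gg k : 0 < k -> koszul K (gen k) (gen (- k)) = 1.
Proof.
move=> k0; have d := gg_disj k0; case/pos_cases: k0 => -[i ki].
  by rewrite koszul_even // ki gen_A.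
rewrite koszulE // ki gen_M gen_N /inversions /= !big_seq_fset1 /=.
by rewrite ltnNge leqnSn.
Qed.

Lemma wtB_gen k : 0 < k -> wtB (gen k) = 0 /\ wtB (gen (- k)) = - k.
Proof.
case/pos_cases => -[i ->]; rewrite ?gen_A ?gen_B ?gen_M ?gen_N.
  by rewrite !wtB_evenvar.
by rewrite !wtB_oddvar.
Qed.

Lemma wtB_gg k : 0 < k -> wtB (gg k) = - k.
Proof. by move=> k0; rewrite wtBM ?gg_disj //; case: (wtB_gen k0) => -> ->; rewrite add0r. Qed.

Lemma sdeg_gg k : 0 < k -> sdeg (gg k) = 2%N.
Proof. by move=> k0; rewrite sdegM ?gg_disj // !sdeg_gen. Qed.

(** The sign reverses the product N M of the statement into M N, the increasing order used in
    monomials. *)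
Definition lead_coef k : K := (-1) ^+ oddz k * nsD K k.

(** At most one term of the sum involves t, and its doubled weight is recovered as [- wtB t]. *)
Lemma Gamma_leadE t : Gamma_lead K t =
  if 0 < - wtB t then lead_coef (- wtB t) * (t == gg (- wtB t))%:R else 0.
Proof.
pose G k : K := if 0 < k then lead_coef k * (t == gg k)%:R else 0.
have G0 k : k != - wtB t -> G k = 0.
  rewrite /G; case: ltP => // k0 kt.
  have -> : (t == gg k) = false by apply: contraNF kt => /eqP ->; rewrite wtB_gg // opprK.
  by rewrite mulr0.
have EA (i : nat) : smul (smul (apow K (- (i.+1.*2)%:Z)) (varA K i)) (varB K i) =
    mono (gg (i.+1.*2)%:Z).
  rewrite smul_smonol act_smono ?mdisj_even // koszul_even // scale1r.
  rewrite smul_smonol act_smono ?mdisj_even //=; last by rewrite fset0U.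
  rewrite koszul_evenr // scale1r /gg gen_A gen_B; congr smono.
  by apply: mono_eq; rewrite /= ?mset0D ?fset0U //; lia.
have EM (i : nat) : smul (smul (apow K (- (i.*2.+1)%:Z)) (varN K i)) (varM K i) =
    - mono (gg (i.*2.+1)%:Z).
  have d : mdisj (gen (i.*2.+1)%:Z) (gen (- (i.*2.+1)%:Z)) by exact: gg_disj.
  rewrite smul_smonol act_smono ?mdisj_even // koszul_even // scale1r.
  have e1 : mono_mul (Mono (- (i.*2.+1)%:Z) 0 mset0 fset0)
      (Mono 0 0 mset0 [fset Some (inr i)]%fset) = gen (- (i.*2.+1)%:Z).
    by rewrite gen_N; apply: mono_eq; rewrite /= ?mset0D ?fset0U //; lia.
  rewrite e1 /varM -gen_M smul_smonol act_smono; last by rewrite mdisjC.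
  rewrite koszulC koszul_gg // mulr1 gen_N gen_M /= !cardfs1 expr1 scaleN1r.
  by rewrite mono_mulC -gen_N -gen_M.
have E (i : nat) : (((i.+1%:R ^+ 3 - i.+1%:R) / 12%:R) *:s
      smul (smul (apow K (- (i.+1.*2)%:Z)) (varA K i)) (varB K i)
    + ((i.+1%:R ^+ 2 - i.+1%:R) / 3%:R) *:s
      smul (smul (apow K (- (i.*2.+1)%:Z)) (varN K i)) (varM K i)) t =
    G (i.+1.*2)%:Z + G (i.*2.+1)%:Z :> K.
  rewrite -[LHS]/(((i.+1%:R ^+ 3 - i.+1%:R) / 12%:R) *
      smul (smul (apow K (- (i.+1.*2)%:Z)) (varA K i)) (varB K i) t
    + ((i.+1%:R ^+ 2 - i.+1%:R) / 3%:R) *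
      smul (smul (apow K (- (i.*2.+1)%:Z)) (varN K i)) (varM K i) t).
  rewrite EA EM fNE /smono /G /=; congr (_ + _).
    (* For k = 2j the constant [nsD K k] is (j^3 - j)/12; in the odd case, k = 2j - 1, it is (j^2 -
       j)/3. *)
    congr (_ * _); rewrite /lead_coef /nsD /oddz /= odd_double expr0 mul1r.
    by rewrite -pmulrn -muln2 natrM; field.
  rewrite mulrN -mulNr; congr (_ * _); rewrite /lead_coef /nsD /oddz /= odd_double /= expr1.
  by rewrite -pmulrn -[i.*2.+1]addn1 -[i.+1]addn1 -muln2 !natrD natrM; field.
rewrite /Gamma_lead /ssum (fsum_ord (N := `|wtB t|.+1)) => [|i it]; last first.
  by rewrite E !G0 ?addr0 //; lia.
under eq_bigr => i _ do rewrite E.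
rewrite (sum_pos_weights (w := - wtB t) _ G0); last lia.
by rewrite /G; case: (0 < - wtB t).
Qed.

End Leading.

(** * The defect up to degree two *)

Section SecondOrder.
Variable K : numFieldType.
Local Notation N := (monomial -> nsU K).
Implicit Types x y : N.

Lemma sum2 I (r : seq I) (F : I -> nsU K) : (\sum_(i <- r) F i).2 = \sum_(i <- r) (F i).2.
Proof. exact: (big_morph snd (fun _ _ => erefl) erefl). Qed.

Lemma ad2 x y t : (ad x y t).2 = \sum_(t1 <- D t)
  (koszul K t1 (msub t t1) * (-1) ^+ (oddz (wt t1) && oddz (wt (msub t t1)))) *
  (if wt t1 + wt (msub t t1) == 0 then (x t1).1 * (y (msub t t1)).1 * nsD K (wt t1) else 0).
Proof. by rewrite /ad /brk sum2; apply: eq_bigr => t1 _. Qed.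

Definition wpos (b : bool) x : Prop :=
  forall t, (x t).1 != 0 -> 0 < (if b then - wt t else wt t).

(** A central term needs two opposite weights. *)
Lemma ad2_wpos b x y t : wpos b x -> wpos b y -> (ad x y t).2 = 0.
Proof.
move=> px py; rewrite ad2 big1 // => t1 _; case: eqP => [w|_]; last by rewrite mulr0.
have [->|/px h] := eqVneq (x t1).1 0; first by rewrite !mul0r mulr0.
have [->|/py h'] := eqVneq (y (msub t t1)).1 0; first by rewrite mulr0 mul0r mulr0.
by case: b h h' {px py}; lia.
Qed.

Lemma ord2_ad x y : ord 1 x -> ord 2 y -> ord 3 (ad x y).
Proof. by move=> ox oy; have [_ r] := ad_raises ox; exact: r oy. Qed.

Lemma ad_agree x y y' t : ord 1 x -> ord 2 (y - y') -> sdeg t = 2%N -> ad x y t = ad x y' t.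
Proof.
move=> ox /(ord2_ad ox); have [l _] := ad_raises ox; rewrite (linB l) => h t2.
by apply: ord_agree h _; rewrite t2.
Qed.

Lemma nseta_ord2 x : ord 1 x -> ord 2 (nseta x - x).
Proof.
move=> ox t; rewrite ltnS leq_eqVlt => /orP[/eqP t1|t0].
  rewrite fBE /nseta /eta t1 big_ord1 factS fact0 muln1 invr1 scale1r.
  by rewrite -[iter 0 _ _]/(Theta x) /Theta t1 scale1r subrr.
by rewrite fBE (nseta_ord1 _ t0) ox ?subrr.
Qed.

Lemma nseta2 b x t : ord 1 x -> (forall u, (x u).2 = 0) -> wpos b x \/ ord 2 x ->
  sdeg t = 2%N -> (nseta x t).2 = 0.
Proof.
move=> ox x2 hx t2; rewrite /nseta /eta t2 !big_ord_recl big_ord0 addr0 /=.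
rewrite /Theta x2 scaler0 scaler0 add0r -/(Theta x) -/(ad x (Theta x)).
suff -> : (ad x (Theta x) t).2 = 0 by rewrite scaler0.
case: hx => [px|o2].
  apply: (ad2_wpos _ px) => u; rewrite /Theta /= /GRing.scale /= => h.
  by apply: px; apply: contraNneq h => ->; rewrite mulr0.
rewrite (ord2_ad ox) ?t2 // => u u2.
by rewrite /Theta o2 ?scaler0.
Qed.

Lemma Ad_ord2 x y : ord 1 x -> ord 1 y -> ord 2 (Exp (ad x) y - y).
Proof. by move=> ox oy; have [_ r] := Exp_raises1 (ad_raises ox); exact: r oy. Qed.

Lemma Ad2 x y t : ord 1 x -> ord 1 y -> sdeg t = 2%N ->
  Exp (ad x) y t = y t + ad x y t.
Proof.
move=> ox oy t2; rewrite /Exp t2 !big_ord_recl big_ord0 addr0 /= /bump /= !addn0 !add1n.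
rewrite invr1 !scale1r (ord2_ad (y := ad x y) ox) ?t2 ?scaler0 ?addr0 //.
by have [_ r] := ad_raises ox; exact: r oy.
Qed.

Variables (xA xB y0 yp ym : N).
Hypotheses (oxA : ord 1 xA) (oxB : ord 1 xB) (oy0 : ord 1 y0) (oyp : ord 1 yp)
  (oym : ord 1 ym).
Hypotheses (pA : wpos false xA) (pB : wpos true xB) (pp : wpos false yp) (pm : wpos true ym).
Hypothesis oy0' : ord 2 y0.
Hypotheses (xA2 : forall u, (xA u).2 = 0) (xB2 : forall u, (xB u).2 = 0)
  (y02 : forall u, (y0 u).2 = 0) (yp2 : forall u, (yp u).2 = 0) (ym2 : forall u, (ym u).2 = 0).
Local Notation defect := (defect xA xB y0 yp ym).

Let r3 := nseta (- yp).
Let r2 := nseta (- y0) + Exp (ad (- y0)) r3.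
Let r1 := nseta xB + Exp (ad xB) r2.

Let o3 : ord 1 r3. Proof. exact: nseta_ord1. Qed.
Let o2 : ord 1 r2.
Proof. by apply: ordD; [exact: nseta_ord1|exact: Ad_ord (ordN oy0) o3]. Qed.
Let o1 : ord 1 r1.
Proof. by apply: ordD; [exact: nseta_ord1|exact: Ad_ord oxB o2]. Qed.

Let e3 : ord 2 (r3 - - yp). Proof. exact: nseta_ord2 (ordN oyp). Qed.
Let e2 : ord 2 (r2 - - yp).
Proof.
have -> : r2 - - yp = (nseta (- y0) - - y0) - y0 + ((Exp (ad (- y0)) r3 - r3) + (r3 - - yp)).
  by rewrite !opprK addrK (addrA (_ - r3)) subrK addrA.
apply: ordD; first by apply: ordB => //; exact: nseta_ord2 (ordN oy0).
by apply: ordD => //; exact: Ad_ord2 (ordN oy0) o3.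
Qed.
Let e1 : ord 2 (r1 - (xB - yp)).
Proof.
have -> : r1 - (xB - yp) = (nseta xB - xB) + ((Exp (ad xB) r2 - r2) + (r2 - - yp)).
  by rewrite (addrA (_ - r2)) subrK opprK addrACA opprB (addrC yp).
apply: ordD; first exact: nseta_ord2.
by apply: ordD => //; exact: Ad_ord2.
Qed.

(** To first order Ad is the identity and eta(x) = x, as Theta is the identity in degree 1; y0
    starts in degree 2. *)
Lemma defect_deg1 : ord 2 (defect - (xA + xB - yp - ym)).
Proof.
have -> : defect - (xA + xB - yp - ym) = (nseta xA - xA) + ((Exp (ad xA) r1 - r1)
    + (r1 - (xB - yp))) - (nseta ym - ym).
  rewrite (addrA (_ - r1)) subrK /defect /logder -/r3 -/r2 -/r1 -(addrA xA).
  have rearr (V : zmodType) (a e n x z m : V) :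
      a + e - n - (x + z - m) = (a - x) + (e - z) - (n - m).
    by rewrite !opprB [LHS]addrACA (addrACA a) [RHS]addrACA opprD (addrC (- n)).
  exact: rearr.
apply: ordB; last exact: nseta_ord2.
apply: ordD; first exact: nseta_ord2.
by apply: ordD => //; exact: Ad_ord2.
Qed.

(** The bracket of xA with xB comes from Ad(xA), that of xB with -yp from Ad(xB), and yp is xA to
    first order. The two terms add up to twice the first one; dividing by the degree 2 in [gamma]
    removes the factor. *)
Lemma defect_deg2 t : ord 2 (yp - xA) -> sdeg t = 2%N ->
  (defect t).2 = (ad xA xB t).2 - (ad xB xA t).2.
Proof.
move=> eA t2; have lA := (ad_raises oxA).1; have lB := (ad_raises oxB).1.
have D2 (p q : nsU K) : (p + q).2 = p.2 + q.2 by [].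
have wN b x : wpos b x -> wpos b (- x).
  by move=> px u; rewrite fNE /= oppr_eq0; exact: px.
have N2 x : (forall u, (x u).2 = 0) -> forall u, ((- x) u).2 = 0.
  by move=> h u; rewrite fNE /= h oppr0.
have E3 : (r3 t).2 = 0 by apply: (nseta2 (b := false)); [exact: ordN|exact: N2|left; exact: wN|].
have E2 : (r2 t).2 = 0.
  rewrite /r2 fDE D2 (Ad2 (ordN oy0) o3 t2) D2 E3 add0r.
  rewrite (@nseta2 false) ?add0r //; [|exact: ordN|exact: N2|by right; exact: ordN].
  by rewrite ((ad_raises (ordN oy0')).2 _ _ o3) ?t2.
have E1 : (r1 t).2 = - (ad xB xA t).2.
  rewrite /r1 fDE D2 (Ad2 oxB o2 t2) D2 E2 (nseta2 oxB xB2 (or_introl pB) t2) !add0r.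
  rewrite (ad_agree oxB e2 t2) (linN lB) fNE /=; congr (- _.2).
  exact: ad_agree.
have -> : (defect t).2 = (nseta xA t).2 + (Exp (ad xA) r1 t).2 - (nseta ym t).2 by [].
rewrite (nseta2 oxA xA2 (or_introl pA) t2) add0r.
rewrite (nseta2 oym ym2 (or_introl pm) t2) subr0 (Ad2 oxA o1 t2) D2.
rewrite E1 (ad_agree oxA e1 t2) (linB lA) addrC.
have -> : ((ad xA xB - ad xA yp) t).2 = (ad xA xB t).2 - (ad xA yp t).2 by [].
by rewrite (ad2_wpos _ pA pp) subr0.
Qed.

End SecondOrder.

(** * The shape of Gamma *)

Section GammaProperties.
Variable K : numFieldType.
Local Notation M := (monomial -> K^o).
Local Notation N := (monomial -> nsU K).

Lemma xA1 t : (xA K t).1 = - (if 0 < wt t then (t == gen (wt t))%:R else 0).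
Proof.
rewrite /xA fNE /= /posdata /=; congr (- _); case: ltP => // w0.
by rewrite /genfam gt_eqF.
Qed.
Lemma xB1 t : (xB K t).1 = - (if wt t < 0 then (t == gen (wt t))%:R else 0).
Proof.
rewrite /xB fNE /= /negdata /=; congr (- _); case: ltP => // w0.
by rewrite /genfam lt_eqF.
Qed.

Lemma wpos_xA : wpos false (xA K).
Proof. by move=> t; rewrite xA1; case: ltP => //; rewrite oppr0 eqxx. Qed.
Lemma wpos_xB : wpos true (xB K).
Proof. by move=> t; rewrite xB1 /= oppr_gt0; case: ltP => //; rewrite oppr0 eqxx. Qed.
Lemma wpos_posdata c : wpos false (posdata (c : int -> M)).
Proof. by move=> t; rewrite /posdata /=; case: ltP => //; rewrite eqxx. Qed.
Lemma wpos_negdata c : wpos true (negdata (c : int -> M)).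
Proof. by move=> t; rewrite /negdata /= oppr_gt0; case: ltP => //; rewrite eqxx. Qed.

Lemma xA_gen t : (xA K t).1 != 0 -> 0 < wt t /\ t = gen (wt t).
Proof.
rewrite xA1; case: ltP => [w0|]; last by rewrite oppr0 eqxx.
by case: (t =P gen (wt t)) => [e|]; rewrite ?oppr0 ?eqxx.
Qed.
Lemma xB_gen t : (xB K t).1 != 0 -> wt t < 0 /\ t = gen (wt t).
Proof.
rewrite xB1; case: ltP => [w0|]; last by rewrite oppr0 eqxx.
by case: (t =P gen (wt t)) => [e|]; rewrite ?oppr0 ?eqxx.
Qed.

Lemma xA_val k : 0 < k -> (xA K (gen k)).1 = -1.
Proof. by move=> k0; rewrite xA1 wt_gen ?gt_eqF // k0 eqxx. Qed.
Lemma xB_val k : 0 < k -> (xB K (gen (- k))).1 = -1.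
Proof. by move=> k0; rewrite xB1 wt_gen ?oppr_eq0 ?gt_eqF // oppr_lt0 k0 eqxx. Qed.

Lemma gen_D k : 0 < k -> gen k \in D (gg k) /\ gen (- k) \in D (gg k).
Proof.
by move=> k0; rewrite !mem_D /gg mdivM mdivMr !isT_gen ?oppr_eq0 ?gt_eqF.
Qed.

(* The only contributions are A_j B_j and M_{j-1/2} N_{j-1/2}. *)
Lemma ad_xAxB t : (ad (xA K) (xB K) t).2 =
  if 0 < - wtB t then lead_coef K (- wtB t) * (t == gg (- wtB t))%:R else 0.
Proof.
pose w : int := - wtB t; rewrite -/w; pose F t1 : K := (koszul K t1 (msub t t1)
    * (-1) ^+ (oddz (wt t1) && oddz (wt (msub t t1)))) *
  (if wt t1 + wt (msub t t1) == 0
   then (xA K t1).1 * (xB K (msub t t1)).1 * nsD K (wt t1) else 0).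
rewrite ad2 -[LHS]/(\sum_(t1 <- D t) F t1).
have Z t1 : t1 \in D t -> F t1 != 0 -> 0 < w /\ t = gg w /\ t1 = gen w.
  move=> /D_mdiv /mdivP[e d]; rewrite /F; case: (wt t1 + _ =P 0) => [ws|_]; last by rewrite mulr0 eqxx.
  have [->|/xA_gen[w1 e1]] := eqVneq (xA K t1).1 0; first by rewrite !mul0r mulr0 eqxx.
  have [->|/xB_gen[w2 e2] _] := eqVneq (xB K (msub t t1)).1 0.
    by rewrite mulr0 mul0r mulr0 eqxx.
  have w12 : wt (msub t t1) = - wt t1 by lia.
  have tg : t = gg (wt t1) by rewrite -e {1}e1 e2 w12.
  have ww : w = wt t1 by rewrite /w tg wtB_gg // opprK.
  by rewrite ww.
have [/andP[w0 tgw]|nw] := boolP ((0 < w) && (t == gg w)).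
  have tw := eqP tgw; rewrite w0 tgw mulr1 (bigD1_seq (gen w)) ?uniq_D //=; last first.
    by rewrite tw; case: (gen_D w0).
  rewrite big1_seq ?addr0 => [|t1 /andP[t1w t1t]]; last first.
    by apply/eqP; apply: contraTT t1w => /(Z _ t1t)[_ [_ ->]]; rewrite negbK.
  have w1 : w != 0 by rewrite gt_eqF.
  have wN0 : - w != 0 by rewrite oppr_eq0.
  rewrite /F tw msubM ?gg_disj // koszul_gg // (wt_gen wN0) (wt_gen w1) addrN eqxx.
  by rewrite xA_val // xB_val // oddzN andbb /lead_coef mulrNN !mul1r.
have -> : (if 0 < w then lead_coef K w * (t == gg w)%:R else 0) = 0.
  by move: nw; case: ltP => //= _ /negbTE ->; rewrite mulr0.
rewrite big1_seq // => t1 /andP[_ t1t]; apply/eqP; apply: contraNT nw => /(Z _ t1t).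
by move=> [-> [tw _]]; rewrite tw eqxx.
Qed.

Lemma nsDN k : nsD K (- k) = - (-1) ^+ oddz k * nsD K k.
Proof.
rewrite /nsD oddzN intrN; case: (oddz k); first by rewrite expr1 opprK mul1r sqrrN.
by rewrite expr0; field.
Qed.

Lemma ad2_antisym (x y : N) t : isT t -> (ad y x t).2 = - (ad x y t).2.
Proof.
move=> Tt; rewrite !ad2 (sum_D_sym (fun t1 t2 =>
  (koszul K t1 t2 * (-1) ^+ (oddz (wt t1) && oddz (wt t2))) *
  (if wt t1 + wt t2 == 0 then (y t1).1 * (x t2).1 * nsD K (wt t1) else 0)) Tt).
rewrite -sumrN big_seq [RHS]big_seq; apply: eq_bigr => t1 t1t.
rewrite (addrC (wt (msub _ _))); case: eqP => [w|_]; last by rewrite !mulr0 oppr0.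
have w2 : wt (msub t t1) = - wt t1 by lia.
have T1 := D_isT t1t; have T2 : isT (msub t t1) by rewrite isT_sub ?(D_mdiv t1t).
rewrite (koszulC K t1) signb_odd -!oddz_wt ?isT_S // w2 nsDN oddzN andbb.
by case: (oddz (wt t1)); rewrite ?expr0 ?expr1; ring.
Qed.

Variable Psi : int -> M.
Hypotheses (scPsi : forall k, scalar (Psi k)) (oPsi : forall k, ord 1 (Psi k)).
Hypothesis eqPsi : Fbar1 Psi = Defs.comp (Fbar2 Psi) (Defs.comp (Kbar K) (Hbar K)).
Local Notation Gamma := (Gamma_of Psi).

Lemma zerodata_ord2 : ord 2 (zerodata Psi).
Proof.
move=> t; rewrite ltnS leq_eqVlt => /orP[/eqP t1|t0]; last exact: zerodata_ord1 (oPsi 0) t t0.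
rewrite /zerodata; case: eqP => // w0; have [->|] := eqVneq (Psi 0 t) 0; first by rewrite mulr0.
by move/scPsi/sdeg1_wt => /(_ t1); rewrite w0.
Qed.

(** The noncentral part of the defect vanishes. In degree 1 it is xA + xB - yp - ym, whose part of
    positive weight is xA - yp. *)
Lemma posdata_deg1 : ord 2 (posdata Psi - xA K).
Proof.
have hPsi := Psi_hom scPsi oPsi eqPsi; have oA := xA_ord1 K; have oB := xB_ord1 K.
move=> t t2; rewrite fBE; apply: injective_projections; last by rewrite /= oppr0 subrr.
have nT (c : int -> M) : ~~ isT t -> homfam c -> (posdata c t).1 = 0.
  move=> nT hc; rewrite /posdata /=; case: ifP => // _; apply/eqP.
  by apply: contraNT nT => /hc[].
have [Tt|/nT h] := boolP (isT t); last first.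
  have -> : (posdata Psi t - xA K t).1 = (posdata Psi t).1 - - (posdata (@genfam K) t).1 by [].
  by rewrite (h _ hPsi) (h _ (@genfam_hom K)) oppr0 subrr.
have := congr1 fst (defect_deg1 oA oB (zerodata_ord1 (oPsi 0)) (@posdata_ord1 K Psi)
  (@negdata_ord1 K Psi) zerodata_ord2 t2).
rewrite -[LHS]/((defect (xA K) (xB K) (zerodata Psi) (posdata Psi) (negdata Psi) t).1
  - ((xA K t).1 + (xB K t).1 - (posdata Psi t).1 - (negdata Psi t).1)).
rewrite defect_Psi // sub0r => /eqP.
rewrite oppr_eq0 -[X in _ -> X]/((posdata Psi t).1 - (xA K t).1 = 0).
case: (ltP 0 (wt t)) => w0; last first.
  by rewrite xA1 /posdata /= ltNge w0 /= oppr0 subrr.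
have -> : (negdata Psi t).1 = 0 by rewrite /negdata /= ltNge (ltW w0).
have -> : (xB K t).1 = 0 by rewrite xB1 ltNge (ltW w0) oppr0.
by rewrite addr0 subr0 subr_eq0 => /eqP ->; rewrite subrr.
Qed.

Lemma Gamma_neq0 t : Gamma t != 0 -> isT t && (wt t == 0).
Proof. by rewrite /Gamma_of /gamma; case: ifP; rewrite ?eqxx. Qed.

Lemma Gamma_deg2 t : (sdeg t <= 2)%N -> Gamma t = Gamma_lead K t.
Proof.
have oA := xA_ord1 K; have oB := xB_ord1 K.
rewrite Gamma_leadE leq_eqVlt => /orP[/eqP t2|t2]; last first.
  have -> : Gamma t = 0.
    rewrite /Gamma_of /gamma; case: ifP => // /andP[Tt w0].
    have [t1|t1] := posnP (sdeg t); first by rewrite t1 invr0 mul0r.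
    by have := @sdeg1_wt t (isT_S Tt); rewrite w0 => /(_ ltac:(lia)).
  case: ltP => // w0; case: eqP => [tg|_]; last by rewrite mulr0.
  by move: t2; rewrite tg sdeg_gg.
rewrite -ad_xAxB /Gamma_of /gamma; case: ifP => [/andP[Tt w0]|nT].
  rewrite t2 (defect_deg2 oA oB (zerodata_ord1 (oPsi 0)) (@posdata_ord1 K Psi)
    (@negdata_ord1 K Psi) wpos_xA wpos_xB (@wpos_posdata Psi) (@wpos_negdata Psi)
    zerodata_ord2 _ _ _ _ _ posdata_deg1 t2) //; try by move=> u; rewrite /xA /xB fNE /= oppr0.
  by rewrite (ad2_antisym (xA K) (xB K) Tt) opprK; field.
move/negbT: nT => nT; rewrite ad_xAxB; case: ltP => // w0; case: eqP => [tg|_]; last by rewrite mulr0.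
have [T0 T1] := gen_D w0; have d := gg_disj w0; move: (- wtB t) w0 tg T0 T1 d => w w0 tg T0 T1 d.
have w1 : w != 0 by rewrite gt_eqF.
have wN : - w != 0 by rewrite oppr_eq0.
case/negP: nT; rewrite tg /gg isTM ?(D_isT T0) ?(D_isT T1) //= wtM // !wt_gen //.
by rewrite addrN.
Qed.

Lemma Gamma_parity : has_parity false Gamma.
Proof.
move=> t /Gamma_neq0/andP[Tt /eqP w0]; rewrite -oddz_wt ?isT_S //.
by rewrite w0.
Qed.

Lemma Gamma_scalar : is_scalar Gamma.
Proof.
split=> [t /Gamma_neq0/andP[/isT_S/andP[/eqP -> ->]] //|e o].
(* Normalization leaves a single power of alpha_0 for given variables. *)
apply: (sub_finite_set (B := [set wtB (Mono 0 0 e o)]%classic)); last exact: finite_set1.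
by move=> k /= /Gamma_neq0/andP[/and3P[_ _ /eqP]].
Qed.

Lemma Gamma_ord1 : ord 1 (Gamma : M).
Proof.
move=> t; rewrite ltnS leqn0 => /eqP t0; rewrite /Gamma_of /gamma t0 invr0 mul0r.
by rewrite if_same.
Qed.

Lemma Gamma_remainder (t : monomial) : (Gamma - Gamma_lead K) t != 0 ->
  [/\ (3 <= mono_deg t)%N, has_AM t & has_BN t].
Proof.
have [t2|t3] := leqP (sdeg t) 2.
  by rewrite -[(_ - _) t]/(Gamma t - Gamma_lead K t) Gamma_deg2 // subrr eqxx.
have -> : (Gamma - Gamma_lead K) t = Gamma t.
  rewrite -[LHS]/(Gamma t - Gamma_lead K t) Gamma_leadE; case: ltP; rewrite ?subr0 // => w0.
  case: eqP => [tg|_]; last by rewrite mulr0 subr0.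
  by move: t3; rewrite tg sdeg_gg.
move/Gamma_neq0/andP=> [/isT_S St /eqP w0]; rewrite -sdegS //; split=> //.
  by apply: wt_has_AM => //; [exact: leq_trans t3|rewrite w0].
by apply: wt_has_BN => //; [exact: leq_trans t3|rewrite w0].
Qed.

End GammaProperties.

(** * Exponentials of central series determine the series *)

Section Uniqueness.
Variable K : numFieldType.
Local Notation U := (UP K).
Local Notation S := (monomial -> K^o).
Local Notation V := (monomial -> U).
Local Notation us := (monomial -> int -> U).

Lemma ucent_ord g (v : us) k i : ord 1 (g : S) -> ord i (v^~ k : V) ->
  ord i.+1 ((umul (ucent g) v)^~ k : V).
Proof.
move=> og ov t ti; rewrite umul_all fsbig1 // => -[[u s] l] _ /=.
case: ifP => // /andP[/eqP us d]; move: ti; rewrite -us sdegM // => ti.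
have [u0|u0] := posnP (sdeg u); first by rewrite /ucent og ?u0 // scale0r mul0r scaler0.
by rewrite (ov s) ?sgi0 ?mulr0 ?scaler0 //; lia.
Qed.

Lemma ucent_agree n g g' (v v' : us) k i j t : ord 1 (g : S) -> ord 1 (g' : S) ->
  ord n ((g : S) - g') -> ord i (v^~ k : V) -> ord i (v'^~ k : V) ->
  ord j ((v^~ k : V) - v'^~ k) -> (sdeg t < minn j.+1 (n + i))%N ->
  umul (ucent g) v t k = umul (ucent g') v' t k.
Proof.
move=> og og' ogg ov ov' ovv; rewrite leq_min => /andP[tj tn].
rewrite [LHS]umul_all [RHS]umul_all; apply: eq_fsbigr => -[[u s] l] _ /=.
case: ifP => // /andP[/eqP us d]; move: tj tn; rewrite -us sdegM // => tj tn.
have [u0|u0] := posnP (sdeg u); first by rewrite /ucent og ?og' ?u0 // !scale0r !mul0r.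
have [un|un] := ltnP (sdeg u) n.
  have -> : v s k = v' s k by apply: (ord_agree (u := v^~ k : V) ovv); lia.
  by rewrite /ucent (ord_agree ogg un).
have sv : v s k = 0 by apply: ov; lia.
have sv' : v' s k = 0 by apply: ov'; lia.
by rewrite sv sv' sgi0 !mulr0.
Qed.

Lemma ucent_one g t k : umul (ucent g) (uconst 1) t k = g t *: (Ud K * UPr K k).
Proof.
rewrite umul_all (fsum_seq (r := [:: ((t, mono1), k)])) //.
  have t1 : mono_mul t mono1 = t by rewrite mono_mulC mono_mul1.
  rewrite big_seq1 /= t1 eqxx /= mdisjC mdisj_even // koszul_evenr // scale1r.
  by rewrite /uconst eqxx mul1r sgi_P /ucent -scalerAl -mulrA UPr_idem.
move=> [[u s] i]; rewrite inE /= => h; case: ifP => // /andP[/eqP ut _].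
rewrite /uconst; case: eqP => [s1|_]; last by rewrite sgi0 mulr0 scaler0.
rewrite mul1r sgi_P /ucent -scalerAl -mulrA UP_PP.
case: eqP => [ik|_]; last by rewrite mulr0 !scaler0.
by move: h; rewrite -ut s1 ik mono_mulC mono_mul1 eqxx.
Qed.

(** From the second power on, the lowest discrepancy of g and g' is multiplied by a term of positive
    degree. In its own degree it is therefore seen by the linear term alone, as a multiple of d
    P_0. *)
Lemma uexp_inj g g' : Ud K * UPr K 0 != 0 -> ord 1 (g : S) -> ord 1 (g' : S) ->
  (uexp (ucent g))^~ 0 = (uexp (ucent g'))^~ 0 -> g = g'.
Proof.
move=> d0 og og' E.
suff H n : ord n ((g : S) - g').
  have : (g : S) - g' = 0 by apply: ord_eq0.
  by move/eqP; rewrite subr_eq0 => /eqP.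
case: n => [|n]; first exact: ord0.
elim: n => [|n IH]; first exact: ordB.
pose it (h : monomial -> K) m : us := iter m (umul (ucent h)) (uconst 1).
have oi h m : ord 1 (h : S) -> ord m ((it h m)^~ 0 : V).
  by move=> oh; elim: m => [|m IHm]; [exact: ord0|exact: ucent_ord].
have step i j m : ord j (((it g m)^~ 0 : V) - (it g' m)^~ 0) -> (i <= m)%N ->
    ord (minn j.+1 (n.+1 + i)) (((it g m.+1)^~ 0 : V) - (it g' m.+1)^~ 0).
  move=> oj im t tm; rewrite fBE; apply/eqP; rewrite subr_eq0; apply/eqP.
  by exact: ucent_agree og og' IH (ord_le im (oi g m og)) (ord_le im (oi g' m og')) oj tm.
have h1 : ord n.+1 (((it g 1%N)^~ 0 : V) - (it g' 1%N)^~ 0).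
  have := step 0%N n.+1 0%N; rewrite subrr addn0 => /(_ _ (leqnn _)).
  by move=> h; apply: ord_le (h _); [rewrite leq_min leqnSn leqnn|].
have h2 m : ord n.+2 (((it g m.+2)^~ 0 : V) - (it g' m.+2)^~ 0).
  elim: m => [|m IHm].
    by apply: ord_le (step 1%N n.+1 1%N h1 (leqnn _)); rewrite leq_min leqnn addn1 leqnn.
  apply: ord_le (step 1%N n.+2 m.+2 IHm _); last by [].
  by rewrite leq_min leqnSn addn1 leqnn.
move=> t; rewrite ltnS leq_eqVlt => /orP[/eqP tn|]; last exact: IH.
have EE h : ord 1 (h : S) -> uexp (ucent h) t 0 =
    uconst 1 t 0 + h t *: (Ud K * UPr K 0)
    + \sum_(m < n) (m.+2`!%:R)^-1 *: it h m.+2 t 0.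
  move=> oh; rewrite /uexp (fsum_ord (N := n.+2)) => [|m mn]; last first.
    have -> : iter m (umul (ucent h)) (uconst 1) t 0 = 0 by apply: (oi h m oh); rewrite tn.
    by rewrite scaler0.
  rewrite !big_ord_recl !lift0 /= fact0 factS fact0 muln1 !invr1 !scale1r addrA.
  by rewrite ucent_one.
have := congr1 (fun v : V => v t) E; rewrite /= !EE //.
have -> : \sum_(m < n) (m.+2`!%:R)^-1 *: it g m.+2 t 0 =
    \sum_(m < n) (m.+2`!%:R)^-1 *: it g' m.+2 t 0.
  apply: eq_bigr => m _; congr (_ *: _).
  by apply: (ord_agree (u := (it g m.+2)^~ 0 : V) (h2 m)); rewrite tn.
move/addIr/addrI/eqP; rewrite -subr_eq0 -scalerBl scaler_eq0 (negbTE d0) orbF => /eqP.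
by [].
Qed.

End Uniqueness.

(** * The central element acts non-trivially *)

Section CentralElement.
Variable K : numFieldType.

(* The module with basis e, f_l (l an integer) and z: the f_l are the functions
   x^n (l = -2n) and phi x^n (l = -2n-1), z is central, and d e = z. *)
Local Notation W := (K^o * (int -> K^o) * K^o)%type.
Implicit Type w : W.

Definition rhoL (m l : int) : K := if oddz l then (l - m)%:~R / 2 else l%:~R / 2.
Definition rhoG (l : int) : K := if oddz l then -1 else - l%:~R / 2.
(** Up to a common scalar, cL and cG are the superdivergences of the vector fields, a 1-cocycle with
    values in functions. zL pairs it with functions by the residue of f dg, with factor 1/24, and zG
    is the odd counterpart. Both orders of L_m and L_{-m} on e then give (m^3 - m)/24 up to sign, so
    that their commutator yields (m^3 - m)/12, as it must for d e = z. *)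
Definition cL (m : int) : K := (m + 1)%:~R.
Definition cG (m : int) : K := - 2 * (m + 1)%:~R.
Definition zL (m : int) : K := - m%:~R * (m + 1)%:~R / 24.
Definition zG (m : int) : K := (m + 1)%:~R / 12.

Definition evL (m : int) w : W :=
  (0, (fun l => rhoL m (l + m * 2) * w.1.2 (l + m * 2)
    + (if l + m * 2 == 0 then cL m else 0) * w.1.1), zL m * w.1.2 (m * 2)).
Definition evG (m : int) w : W :=
  (0, (fun l => rhoG (l + m * 2 + 1) * w.1.2 (l + m * 2 + 1)
    + (if l + m * 2 + 1 == 0 then cG m else 0) * w.1.1), zG m * w.1.2 (m * 2 + 1)).
Definition evd w : W := (0, 0, w.1.1).
Definition evP (k : int) w : W :=
  ((k == 0)%:R * w.1.1, (fun l => (l == k)%:R * w.1.2 l), (k == 0)%:R * w.2).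

Fixpoint ev (t : term K) : W -> W :=
  match t with
  | Gen (Lg m) => evL m
  | Gen (Gg m) => evG m
  | Gen dg => evd
  | Gen (Pg k) => evP k
  | Cst c => fun w => c *: w
  | Add s t => fun w => ev s w + ev t w
  | Mul s t => fun w => ev s (ev t w)
  end.

Lemma W_eq w w' : w.1.1 = w'.1.1 -> (forall l, w.1.2 l = w'.1.2 l) -> w.2 = w'.2 -> w = w'.
Proof.
by case: w w' => [[a h] c] [[a' h'] c'] /= -> hh ->; congr (_, _, _); apply/funext.
Qed.

Lemma ev_lin t c w w' : ev t (c *: w + w') = c *: ev t w + ev t w'.
Proof.
elim: t c w w' => [[m|m||k]|b|s IHs t IHt|s IHs t IHt] c w w' /=.
- by apply: W_eq => [|l|] /=; rewrite ?(fDE, fZE, f0E) /GRing.scale /=; ring.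
- by apply: W_eq => [|l|] /=; rewrite ?(fDE, fZE, f0E) /GRing.scale /=; ring.
- by apply: W_eq => [|l|] /=; rewrite ?(fDE, fZE, f0E) /GRing.scale /=; ring.
- by apply: W_eq => [|l|] /=; rewrite ?(fDE, fZE, f0E) /GRing.scale /=; ring.
- by rewrite scalerDr !scalerA mulrC.
- by rewrite IHs IHt scalerDr addrACA.
- by rewrite IHt IHs.
Qed.

Lemma oddz2 l k : oddz (l + k * 2) = oddz l.
Proof. by rewrite oddzD /oddz abszM oddM andbF addbF. Qed.
Lemma oddz21 l k : oddz (l + k * 2 + 1) = ~~ oddz l.
Proof. by rewrite oddzD oddz2 addbT. Qed.
Lemma oddz_2 k : oddz (k * 2) = false. Proof. by have := oddz2 0 k; rewrite add0r. Qed.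
Lemma oddz_21 k : oddz (k * 2 + 1) = true. Proof. by have := oddz21 0 k; rewrite add0r. Qed.

Lemma rhoLE m l k : rhoL m (l + k * 2) =
  if oddz l then (l%:~R + k%:~R * 2 - m%:~R) / 2 else (l%:~R + k%:~R * 2) / 2.
Proof. by rewrite /rhoL oddz2 intrB !intrD intrM. Qed.
Lemma rhoGE l k : rhoG (l + k * 2 + 1) =
  if oddz l then - (l%:~R + k%:~R * 2 + 1) / 2 else -1.
Proof. by rewrite /rhoG oddz21 if_neg !intrD intrM. Qed.

Lemma ev_LL m n w : evL m (evL n w) = evL n (evL m w) + ((zint K m - zint K n) *: evL (m + n) w
  + (if m + n == 0 then (zint K m ^+ 3 - zint K m) / 12%:R else 0) *: evd w).
Proof.
case: w => [[a h] c]; apply: W_eq => [|l|] /=; rewrite ?(fDE, fZE, f0E) /GRing.scale /=.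
- by ring.
- have e1 : l + m * 2 + n * 2 = l + (m + n) * 2 by lia.
  have e2 : l + n * 2 + m * 2 = l + (m + n) * 2 by lia.
  rewrite e1 e2 !rhoLE /cL /zint !intrD; move: (h _) => H.
  case: (boolP (oddz l)) => ol; case: eqP => [L0|_]; try by field.
    have lE : l = - (m + n) * 2 by lia.
    by rewrite lE oddz_2 in ol.
  have lE : l = - (m + n) * 2 by lia.
  have -> : l%:~R = - (m%:~R + n%:~R) * 2 :> K by rewrite lE intrM intrN intrD.
  by rewrite !mulr0; field.
have e1 : m * 2 + n * 2 = (m + n) * 2 by lia.
have e2 : n * 2 + m * 2 = (m + n) * 2 by lia.
have e3 : ((m + n) * 2 == 0) = (m + n == 0) by lia.
rewrite e1 e2 e3 /rhoL oddz_2 /zL /cL /zint !(intrM, intrD); move: (h _) => H.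
case: eqP => [mn|_]; last by field.
have -> : n = - m by lia.
by rewrite intrN; field.
Qed.

Lemma ev_GL m n w : evG m (evL n w) = evL n (evG m w)
  + (zint K m - (zint K n - 1) / 2%:R) *: evG (m + n) w.
Proof.
case: w => [[a h] c]; apply: W_eq => [|l|] /=; rewrite ?(fDE, fZE, f0E) /GRing.scale /=.
- by ring.
- have e1 : l + m * 2 + 1 + n * 2 = l + (m + n) * 2 + 1 by lia.
  have e2 : l + n * 2 + m * 2 + 1 = l + (m + n) * 2 + 1 by lia.
  rewrite e1 e2 (_ : rhoL n (l + (m + n) * 2 + 1) =
    if oddz l then (l%:~R + (m%:~R + n%:~R) * 2 + 1) / 2
    else (l%:~R + (m%:~R + n%:~R) * 2 + 1 - n%:~R) / 2); last first.
    by rewrite /rhoL oddz21 if_neg intrB !intrD intrM intrD.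
  rewrite !rhoGE rhoLE /cL /cG /zint !intrD; move: (h _) => H.
  case: (boolP (oddz l)) => ol; case: eqP => [L0|_]; rewrite ?mulr0 ?mul0r; try by field.
    have lE : l = - (m + n + 1) * 2 + 1 by lia.
    have -> : l%:~R = - (m%:~R + n%:~R + 1) * 2 + 1 :> K.
      by rewrite lE intrD intrM intrN !intrD.
    by field.
  have lE : l = - (m + n + 1) * 2 + 1 by lia.
  by rewrite lE oddz_21 in ol.
have e1 : m * 2 + 1 + n * 2 = (m + n) * 2 + 1 by lia.
have e2 : n * 2 + m * 2 + 1 = (m + n) * 2 + 1 by lia.
have e3 : ((m + n) * 2 + 1 == 0) = false by lia.
rewrite e1 e2 e3.
rewrite /rhoL /rhoG oddz_21 /zL /zG /cL /cG /zint.
rewrite intrB !(intrM, intrD); move: (h _) => H.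
by rewrite !mul0r !addr0; field.
Qed.

Lemma ev_GG m n w : evG m (evG (n - 1) w) + evG (n - 1) (evG m w) =
  2%:R *: evL (m + n) w
  + (if m + n == 0 then (zint K m ^+ 2 + zint K m) / 3%:R else 0) *: evd w.
Proof.
case: w => [[a h] c]; apply: W_eq => [|l|] /=; rewrite ?(fDE, fZE, f0E) /GRing.scale /=.
- by ring.
- have e1 : l + m * 2 + 1 + (n - 1) * 2 + 1 = l + (m + n) * 2 by lia.
  have e2 : l + (n - 1) * 2 + 1 + m * 2 + 1 = l + (m + n) * 2 by lia.
  rewrite e1 e2 !rhoGE rhoLE /rhoG oddz2 /cL /cG /zint intrB !intrD intrM intrD.
  move: (h _) => H.
  case: (boolP (oddz l)) => ol; case: eqP => [L0|_]; rewrite ?mulr0 ?mul0r; try by field.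
  have lE : l = - (m + n) * 2 by lia.
  by rewrite lE oddz_2 in ol.
have e1 : m * 2 + 1 + (n - 1) * 2 + 1 = (m + n) * 2 by lia.
have e2 : (n - 1) * 2 + 1 + m * 2 + 1 = (m + n) * 2 by lia.
have e3 : ((m + n) * 2 == 0) = (m + n == 0) by lia.
rewrite e1 e2 e3 /rhoG oddz_2 /zG /zL /cG /zint !(intrM, intrD); move: (h _) => H.
case: eqP => [mn|_]; last by rewrite !intrN; field.
have -> : n = - m by lia.
by rewrite !intrN; field.
Qed.

Lemma ev_rel s t : defining_relation s t -> ev s =1 ev t.
Proof.
case=> {s t} [m n|m n|m n|m|m|i j|i m|i m|i] w.
- exact: ev_LL.
- exact: ev_GL.
- exact: ev_GG.
all: apply: W_eq => [|l|] //=; rewrite ?(fDE, fZE, f0E) /GRing.scale /= ?mulr0 ?addr0 //.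
- case: (i =P j) => [<-|ij] /=; first by case: eqP => _; rewrite ?mul1r ?mul0r.
  rewrite /GRing.scale /=; case: eqP => [i0|]; rewrite ?mul0r // mul1r.
  by case: eqP => [j0|]; rewrite ?mul0r //; case: ij; rewrite i0.
- case: (i =P j) => [<-|ij] /=; first by case: eqP => _; rewrite ?mul1r ?mul0r.
  rewrite fZE /GRing.scale /= mul0r; case: eqP => [i0|]; rewrite ?mul0r // mul1r.
  by case: eqP => [j0|]; rewrite ?mul0r //; case: ij; rewrite -i0.
- case: (i =P j) => [<-|ij] /=; first by case: eqP => _; rewrite ?mul1r ?mul0r.
  rewrite /GRing.scale /=; case: eqP => [i0|]; rewrite ?mul0r // mul1r.
  by case: eqP => [j0|]; rewrite ?mul0r //; case: ij; rewrite i0.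
- have -> : (l + m * 2 == i + m *+ 2) = (l == i) by lia.
  case: (l =P i) => [->|li]; rewrite ?mul1r ?mul0r ?mulr0 ?add0r.
    have -> : (i + m *+ 2 == 0) = (i + m * 2 == 0) by lia.
    by case: eqP; rewrite ?mul1r ?mul0r.
  case: eqP => [l0|]; rewrite ?mul0r //.
  by case: eqP => [i0|]; rewrite ?mul0r ?mulr0 //; case: li; lia.
- have -> : (m * 2 == i + m *+ 2) = (i == 0) by lia.
  by rewrite mulrCA.
- have -> : (l + (m - 1) * 2 + 1 == i + m *+ 2 - 1) = (l == i) by lia.
  case: (l =P i) => [->|li]; rewrite ?mul1r ?mul0r ?mulr0 ?add0r.
    have -> : (i + m *+ 2 - 1 == 0) = (i + (m - 1) * 2 + 1 == 0) by lia.
    by case: eqP; rewrite ?mul1r ?mul0r.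
  case: eqP => [l0|]; rewrite ?mul0r //.
  by case: eqP => [i0|]; rewrite ?mul0r ?mulr0 //; case: li; lia.
- have -> : ((m - 1) * 2 + 1 == i + m *+ 2 - 1) = (i == 0) by lia.
  by rewrite mulrCA.
Qed.

Lemma ev_cong s t : cong s t -> ev s =1 ev t.
Proof.
elim=> {s t} /=.
- exact: ev_rel.
- by [].
- by move=> s t _ e w; rewrite e.
- by move=> s t u _ e _ e' w; rewrite e e'.
- by move=> s s' t t' _ e _ e' w; rewrite e e'.
- by move=> s s' t t' _ e _ e' w; rewrite e' e.
- by move=> s t u w; rewrite addrA.
- by move=> s t w; rewrite addrC.
- by move=> s w; rewrite scale0r add0r.
- by move=> s w; rewrite scaleN1r addNr scale0r.
- by [].
- by move=> s w; rewrite scale1r.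
- by [].
- by move=> s t u w; rewrite -[ev t w]scale1r ev_lin !scale1r.
- by move=> a b w; rewrite scalerDl.
- by move=> a b w; rewrite scalerA.
- move=> a s w; have s0 : ev s 0 = 0.
    by have := ev_lin s (-1) 0 0; rewrite scaler0 addr0 scaleN1r addNr.
  by rewrite -[a *: w in RHS]addr0 ev_lin s0 addr0.
Qed.

Lemma Ud_P0_neq0 : Ud K * UPr K 0 != 0.
Proof.
rewrite -toUPM; apply/eqP => h.
have /toUPP/ev_cong/(_ (1, 0, 0)) : toUP (Mul (Gen K dg) (Gen K (Pg 0))) = toUP (Cst 0) := h.
by move/(congr1 snd); rewrite /= mul1r scale0r => /eqP; rewrite oner_eq0.
Qed.

End CentralElement.

(** The only property of the scalars that matters is that nonzero integers are invertible. Existence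
    and uniqueness both compare the two sides column by column; for uniqueness the column of P_0
    suffices. *)
Lemma exists_unique_Gamma (K : numFieldType) (Psi : int -> monomial -> K) :
  is_Psi Psi ->
  exists! Gamma : monomial -> K,
    [/\ is_scalar Gamma,
        has_parity false Gamma,
        exists Gamma0 : monomial -> K,
          Gamma = Gamma_lead K + Gamma0 /\
          (forall t, Gamma0 t != 0 ->
             [/\ (3 <= mono_deg t)%N, has_AM t & has_BN t])
      & uexp (- upos (varA K) (varM K))
        *u alphaL0 K (-1)
        *u uexp (- uneg (varB K) (varN K))
        = uexp (uneg (Psi_neg_even Psi) (Psi_neg_odd Psi))
          *u uexp (upos (Psi_pos_even Psi) (Psi_pos_odd Psi))
          *u uexp (uscalar (2%:R *:s Psi 0) *u uconst (UL K 0))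
          *u alphaL0 K (-1)
          *u uexp (uscalar Gamma *u uconst (Ud K))].
Proof.
case=> scP _ ncP eqPsi.
have sc k : scalar (Psi k) by move=> u /(scP k).1 [ux un]; rewrite /isS ux eqxx.
have o k : ord 1 (Psi k : monomial -> K^o).
  move=> t; rewrite ltnS leqn0 => /eqP t0; apply/eqP; apply: contraT => Pt.
  by have := ncP k t Pt; rewrite -sdegS ?t0 //; exact: sc k t Pt.
have hPsi := Psi_hom sc o eqPsi; have o0 := o 0.
pose G := Gamma_of Psi; have oG : ord 1 (G : monomial -> K^o) := Gamma_ord1 Psi.
have id_G : uexp (- upos (varA K) (varM K)) *u alphaL0 K (-1) *u uexp (- uneg (varB K) (varN K))
    = uexp (uneg (Psi_neg_even Psi) (Psi_neg_odd Psi))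
      *u uexp (upos (Psi_pos_even Psi) (Psi_pos_odd Psi))
      *u uexp (uscalar (2%:R *:s Psi 0) *u uconst (UL K 0))
      *u alphaL0 K (-1) *u uexp (uscalar G *u uconst (Ud K)).
  apply/funext => t; apply/funext => k.
  have := congr1 (fun v => v t) (lhs_column K k); rewrite /= => ->.
  have := congr1 (fun v => v t) (rhs_column hPsi o0 G k); rewrite /= => ->.
  rewrite (Gamma_factorization sc o eqPsi _ (ellU_module K)); congr (nsExp _ _ _ _ (nsExp _ _ _ _ (nsExp _ _ _ _ _)) t).
  by apply/funext => s; rewrite -(uexp_central_column k s oG) //; exact: Gamma_neq0.
exists G; split.
  split=> //; [exact: Gamma_scalar|exact: Gamma_parity|].
  exists (G - Gamma_lead K); rewrite addrC subrK; split=> // t.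
  exact: Gamma_remainder sc o eqPsi t.
move=> g [scg _ [g0 [gE hg0]]]; rewrite id_G => id_g.
(* The prescribed shape of a competitor excludes terms of degree 0, so that e^{g d} is governed by
   the degree filtration. *)
have og : ord 1 (g : monomial -> K^o).
  move=> t; rewrite ltnS leqn0 => /eqP t0; apply/eqP; apply: contraT => gt.
  have St : isS t by have [tx tn] := scg.1 t gt; rewrite /isS tx eqxx.
  have l0 : Gamma_lead K t = 0.
    rewrite Gamma_leadE; case: ltP => // w0; case: eqP => [tg|_]; last by rewrite mulr0.
    by move: t0; rewrite tg sdeg_gg.
  have : g0 t != 0 by move: gt; rewrite gE -[(_ + _) t]/(Gamma_lead K t + g0 t) l0 add0r.
  by case/hg0; rewrite -sdegS // t0.
apply: uexp_inj (Ud_P0_neq0 K) oG og (rhs_column_inj (k := 0) o0 _).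
rewrite -(rhs_column hPsi o0 G 0) -(rhs_column hPsi o0 g 0).
by apply/funext => t; rewrite id_g.
Qed.

Theorem proposition3p33 (R : realType) (Psi : int -> series R[i]) :
  is_Psi Psi ->
  exists! Gamma : series R[i],
    [/\ is_scalar Gamma,
        has_parity false Gamma,
        exists Gamma0 : series R[i],
          Gamma = Gamma_lead R[i] + Gamma0 /\
          (forall t, Gamma0 t != 0 ->
             [/\ (3 <= mono_deg t)%N, has_AM t & has_BN t])
      & uexp (- upos (varA R[i]) (varM R[i]))
        *u alphaL0 R[i] (-1)
        *u uexp (- uneg (varB R[i]) (varN R[i]))
        = uexp (uneg (Psi_neg_even Psi) (Psi_neg_odd Psi))
          *u uexp (upos (Psi_pos_even Psi) (Psi_pos_odd Psi))
          *u uexp (uscalar (2%:R *:s Psi 0) *u uconst (UL R[i] 0))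
          *u alphaL0 R[i] (-1)
          *u uexp (uscalar Gamma *u uconst (Ud R[i]))].
Proof. exact: exists_unique_Gamma. Qed.
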